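(* Let $I\subset\mathbb{R}$ be a compact interval, let $f\in C^{(2)}(I)$, and let $\mathcal{C}=\{(x,f(x)):x\in I\}$ be the associated planar curve. Let $s\in(0,1)$ and assume that $\mathcal{C}$ is non-degenerate with respect to $\mathcal{H}^s$, i.e. $\mathcal{H}^s(\{x\in I: f''(x)=0\})=0$. Let $\psi:\mathbb{N}\to\mathbb{R}^+$ be an approximating function, and let $\lambda:\mathbb{R}^2\to\mathbb{R}$ be an inhomogeneous function whose restriction to $\mathcal{C}$ is $C^{(2)}$, i.e. $x\mapsto\lambda(x,f(x))$ is in $C^{(2)}(I)$. Define $$W(\mathcal{C},\lambda,\psi)=\Big\{x\in I:\ |a_2f(x)+a_1x+a_0+\lambda(x,f(x))|<\psi(|\mathbf{a}|)\ \text{for infinitely many } (a_0,a_1,a_2)\in\mathbb{Z}\times(\mathbb{Z}^2\setminus\{\mathbf{0}\})\Big\},$$ where $\mathbf{a}=(a_1,a_2)$ and $|\mathbf{a}|=\max\{|a_1|,|a_2|\}$. If $$\sum_{q=1}^{\infty}\psi(q)^s q^{2-s}<\infty,$$ then $\mathcal{H}^s(W(\mathcal{C},\lambda,\psi))=0$.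
   Context: An approximating function is a positive, (monotonically) decreasing function $\psi:\mathbb{N}\to\mathbb{R}^+$ with $\psi(n)\to0$ as $n\to\infty$. $\mathcal{H}^s$ denotes $s$-dimensional Hausdorff measure on $\mathbb{R}$. *)

(* Defs.v *)
From HB Require Import structures.
From mathcomp Require Import all_boot all_order all_algebra.
From mathcomp Require Import all_classical all_reals all_analysis.

Set Implicit Arguments.
Unset Strict Implicit.
Unset Printing Implicit Defensive.

Import Order.TTheory GRing.Theory Num.Theory.
Import numFieldNormedType.Exports.

Local Open Scope classical_set_scope.
Local Open Scope ring_scope.

(** ** Hausdorff measure on the real line *)

(* The added 0 makes the diameter of the empty set 0 instead of -oo. *)
Definition diam (R : realType) (A : set R) : \bar R :=
  ereal_sup ([set 0%E] `|` [set `|x.1 - x.2|%:E | x in A `*` A]).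

Definition delta_cover (R : realType) (delta : R) (A : set R)
    (F : nat -> set R) : Prop :=
  A `<=` \bigcup_k F k /\ forall k, (diam (F k) <= delta%:E)%E.

(* Only meant for s > 0: then (diam set0) `^ s = 0, so that finite covers are
   the sequences that are eventually empty. *)
Definition hausdorff_premeasure (R : realType) (s delta : R) (A : set R) :
    \bar R :=
  ereal_inf [set (\sum_(0 <= k <oo) diam (F k) `^ s)%E
            | F in [set F | delta_cover delta A F]].

(* The premeasure is nonincreasing in delta, so its limit as delta tends to 0
   from the right is its supremum over delta > 0. *)
Definition hausdorff_measure (R : realType) (s : R) (A : set R) : \bar R :=
  ereal_sup [set hausdorff_premeasure s delta A
            | delta in [set delta : R | 0 < delta]].

(** ** Functions of class C^2 on a set *)

(* Difference quotients use points of D only, so at an endpoint of an interval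
   the derivative is one-sided and values outside D are irrelevant. *)
Definition derivable_in (R : realType) (D : set R) (f : R -> R) (x : R) : Prop :=
  cvg ((f y - f x) / (y - x) @[y --> within D x^']).

Definition derive_in (R : realType) (D : set R) (f : R -> R) (x : R) : R :=
  lim ((f y - f x) / (y - x) @[y --> within D x^']).

Definition C2_on (R : realType) (D : set R) (f : R -> R) : Prop :=
  [/\ forall x, D x -> derivable_in D f x,
      forall x, D x -> derivable_in D (derive_in D f) x
    & {within D, continuous (derive_in D (derive_in D f))}].

(** ** Diophantine approximation on the curve y = f x *)

Definition nondegenerate_curve (R : realType) (D : set R) (f : R -> R) (s : R) :
    Prop :=
  hausdorff_measure s
    (D `&` [set x | derive_in D (derive_in D f) x = 0]) = 0%E.

(* The domain is {1, 2, ...}: the value at 0 is never constrained nor used. *)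
Definition approximating_function (R : realType) (psi : nat -> R) : Prop :=
  [/\ forall n, (0 < n)%N -> 0 < psi n,
      forall m n, (0 < m)%N -> (m <= n)%N -> psi n <= psi m
    & psi n @[n --> \oo] --> 0].

Definition dual_approx_set (R : realType) (D : set R) (f : R -> R)
    (lam : R * R -> R) (psi : nat -> R) : set R :=
  [set x | D x /\
    infinite_set [set t : int * int * int |
      let: (a0, a1, a2) := t in
      (a1, a2) <> (0, 0) /\
      `|a2%:~R * f x + a1%:~R * x + a0%:~R + lam (x, f x)|
        < psi (maxn `|a1|%N `|a2|%N)]].

(* Main.v *)
(** The set [{x : |a2 f(x) + a1 x + a0 + l(x)| < psi}] is cheap to cover as long
    as the derivative [F'] of the form is at least 1 in absolute value: summing
    the lengths [psi / |F'|] dyadically costs [psi^s Q^(3-s)] for all [|a|] in a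
    block [[Q, 32 Q)], and the hypothesis says that these costs are summable.

    The nearly tangent forms, [|F'| < 1], are the crux.  Write [Q = X^5].  By
    Dirichlet every [x] has a primitive [b = (b1, b2)] with [b2 <= X^2] and
    [|b2 f'(x) + b1| <= X^-2].  Sort the [a] belonging to points with the same [b]
    into the lines [a + Z b].  Along a line, the integers [a0] attached to three
    [a] at distance less than a multiple of [X^3] have a second difference which
    is smaller than 1, hence 0, and then convexity of the forms ([f'' <> 0]) leaves room
    only for few [a].  Up to a factor [X^(1/8)], a block contains [X^9 M + X^7] forms with
    [|F'| <= M] somewhere on their solution set, instead of the trivial [X^10].
    Since summability makes [psi(Q)] at most of order [Q^(1-3/s)], the corresponding
    intervals cost [O(X^(-3/8))] in total, a geometric series.

    Points with [f'' <> 0] are covered by countably many rational intervals on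
    which [|f''|] is bounded below, so only a null set is left over. *)

Require Import Defs.
From HB Require Import structures.
From mathcomp Require Import all_boot all_order all_algebra.
From mathcomp Require Import all_classical all_reals all_analysis.
From mathcomp Require Import ring lra zify.
Import Order.TTheory GRing.Theory Num.Theory.
Import numFieldNormedType.Exports.
Local Open Scope classical_set_scope.
Local Open Scope ring_scope.
Set Implicit Arguments.
Unset Strict Implicit.
Unset Printing Implicit Defensive.

(** The exponent to beat is 15/2. A form whose derivative has the smallest relevant size is small on
    an interval whose length has [s]-th power about X^(-15/2), for every [s]. So a block may contain
    only fewer than X^(15/2) = Q^(3/2) forms that are tangent to this extent, while the trivial
    count is Q^2.

    The exponents 2, 3, 5 come from a balance. With b2 <= N and K consecutive forms on a line, the
    second difference is of order K^3 / (N^2 Q), and a line with b2 of size N has about Q / N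
    places. Asking for K^3 = N^2 Q and N K = Q forces N = Q^(2/5) and K = Q^(3/5), and then the
    count Q^2 / K = X^7 is below X^(15/2).

    No set of forms is ever counted. [scover] carries the cost of a cover explicitly, and an integer
    attached to the forms multiplies this cost by the number of values it can take. In the
    tangential part, levels have ratio X^(1/8) instead of 2: their number then does not depend on X,
    and a factor X^(1/8) is the price. *)

(* [scover s A k]: the s-dimensional Hausdorff content of [A] is at most [k],
   the bound being attained by some cover. *)
Definition scover (R : realType) (s : R) (A : set R) (k : R) : Prop :=
  exists F : nat -> set R, exists d : nat -> R,
  [/\ A `<=` \bigcup_i F i, forall i, 0 <= d i,
      forall i x y, F i x -> F i y -> `|x - y| <= d i
    & forall N, \sum_(i < N) d i `^ s <= k].

(** * Calculus of covers and their cost *)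

Section Covers.
Context {R : realType}.
Variables (s : R).
Hypothesis s_gt0 : 0 < s.
Implicit Types (A B : set R) (k : R).

Lemma scover_ge0 A k : scover s A k -> 0 <= k.
Proof. by case=> F [d [_ _ _ /(_ 0%N)]]; rewrite big_ord0. Qed.

Lemma scover_sub A B k : A `<=` B -> scover s B k -> scover s A k.
Proof. by move=> AB [F [d [BF ? ? ?]]]; exists F, d; split=> //; apply: subset_trans BF. Qed.

Lemma scover_le A k k' : k <= k' -> scover s A k -> scover s A k'.
Proof. by move=> kk' [F [d [? ? ? H]]]; exists F, d; split=> // N; apply: le_trans (H N) _. Qed.

Lemma scover0 k : 0 <= k -> scover s set0 k.
Proof.
move=> k0; exists (fun=> set0), (fun=> 0); split=> // N.
by rewrite big1// => i _; rewrite powR0// gt_eqF.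
Qed.

Lemma scover_diam A d : 0 <= d -> (forall x y, A x -> A y -> `|x - y| <= d) ->
  scover s A (d `^ s).
Proof.
move=> d0 Ad.
exists (fun i => if i is 0%N then A else set0), (fun i => if i is 0%N then d else 0).
split=> [x Ax|[|i]//|[|i]//|[|N]]; first by exists 0%N.
  by rewrite big_ord0 powR_ge0.
rewrite big_ord_recl/= big1 ?addr0// => i _.
by rewrite powR0// gt_eqF.
Qed.

(** Countable subadditivity. No epsilon is lost, because every bound comes with a cover that attains
    it; the covers are chosen simultaneously and merged along an enumeration of pairs. *)
Lemma scover_bigcup (A : nat -> set R) (k : nat -> R) S :
    (forall i, scover s (A i) (k i)) -> (forall N, \sum_(i < N) k i <= S) ->
  scover s (\bigcup_i A i) S.
Proof.
move=> Ak kS.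
have [F /choice[d Fd]] := choice Ak.
pose h (p : nat * nat) := d p.1 p.2 `^ s.
have h0 p : 0 <= h p by exact: powR_ge0.
pose pi (n : nat) : option (nat * nat) := pickle_inv n.
exists (fun n => if pi n is Some p then F p.1 p.2 else set0).
exists (fun n => if pi n is Some p then d p.1 p.2 else 0); split.
- move=> x [i _ Aix]; have [/(_ _ Aix)[j _ Fx] _ _ _] := Fd i.
  by exists (pickle (i, j)) => //=; rewrite /pi pickleK_inv.
- by move=> n; case: (pi n) => [[i j]|//]; have [] := Fd i.
- move=> n x y; case: (pi n) => [[i j]|//]/=; have [_ _ + _] := Fd i; exact.
move=> N; set r := pmap pi (iota 0 N).
have -> : \sum_(i < N) (if pi i is Some p then d p.1 p.2 else 0) `^ s
          = \sum_(p <- r) h p.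
  rewrite -(big_mkord xpredT (fun i => (if pi i is Some p then d p.1 p.2 else 0) `^ s)).
  rewrite /index_iota subn0 /r; elim: (iota 0 N) => [|n l IH]; first by rewrite !big_nil.
  rewrite big_cons IH /=; case: (pi n) => [p|]/=; first by rewrite big_cons.
  by rewrite powR0 ?gt_eqF// add0r.
have ur : uniq r by apply: (pmap_uniq (@pickle_invK _)); rewrite iota_uniq.
(* The first [N] codes decode into finitely many distinct pairs, all in a square of side [m]. The
   terms are nonnegative, so the sum over the whole square dominates, and it is bounded row by
   row. *)
pose m := (\max_(p <- r) maxn p.1 p.2).+1.
have rm : {subset r <= [seq (i, j) | i <- iota 0 m, j <- iota 0 m]}.
  move=> [i j] pr; apply/allpairsP; exists (i, j); rewrite !mem_iota /= !add0n !ltnS.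
  have := @leq_bigmax_seq _ r xpredT (fun p => maxn p.1 p.2) (i, j) pr isT.
  by rewrite /= geq_max => /andP[-> ->].
apply: (@le_trans _ _ (\sum_(p <- [seq (i, j) | i <- iota 0 m, j <- iota 0 m]) h p)).
  rewrite big_seq [leRHS](bigID (mem r))/=.
  apply: (@le_trans _ _ (\sum_(i <- [seq (i, j) | i <- iota 0 m, j <- iota 0 m] | i \in r) h i)); last first.
    by rewrite lerDl sumr_ge0.
  rewrite -big_seq -[leRHS]big_filter.
  rewrite (perm_big [seq x <- [seq (i, j) | i <- iota 0 m, j <- iota 0 m] | x \in r])//.
  apply: uniq_perm => //.
    by apply: filter_uniq; apply: allpairs_uniq; rewrite ?iota_uniq// => -[? ?] [? ?] _ _ [-> ->].
  move=> p; rewrite mem_filter andb_idr//; exact: rm.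
have -> : iota 0 m = index_iota 0 m by rewrite /index_iota subn0.
rewrite big_allpairs; apply: le_trans (kS m); rewrite big_mkord.
apply: ler_sum => i _; have [_ _ _ /(_ m)] := Fd i.
by rewrite big_mkord.
Qed.

Lemma scoverU A B k k' : scover s A k -> scover s B k' -> scover s (A `|` B) (k + k').
Proof.
move=> Ak Bk'.
pose C i := if i is 0%N then A else if i is 1%N then B else set0.
pose c i := if i is 0%N then k else if i is 1%N then k' else 0.
apply: (@scover_sub _ (\bigcup_i C i)).
  by move=> x [Ax|Bx]; [exists 0%N|exists 1%N].
apply: (@scover_bigcup _ c) => [[|[|i]]//|].
  exact: scover0.
move: (scover_ge0 Ak) (scover_ge0 Bk') => k0 k0'.
case=> [|[|N]]; rewrite ?big_ord0 ?addr_ge0//.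
  by rewrite big_ord_recl big_ord0 /= addr0 lerDl.
by rewrite !big_ord_recl /= big1// addr0.
Qed.

Lemma scover_iter (A : nat -> set R) k N : (forall i, (i < N)%N -> scover s (A i) k) ->
  scover s [set x | exists2 i, (i < N)%N & A i x] (N%:R * k).
Proof.
elim: N => [|N IH] Ak.
  by apply: scover_sub (scover0 _); rewrite ?mul0r// => x [].
rewrite -natr1 mulrDl mul1r.
apply: scover_sub (scoverU (IH _) (Ak N _)) => //; last by move=> i /ltnW; exact: Ak.
move=> x [i]; rewrite ltnS leq_eqVlt => /predU1P[-> ?|]; first by right.
by move=> ? ?; left; exists i.
Qed.

(** This replaces counting. All indices that occur lie within [V] of any one of them, so at most
    [2 * V + 1] fibres are nonempty. Nested uses with different indices multiply the factors. *)
Lemma scover_fiber (T : Type) (P : T -> R -> Prop) (idx : T -> int) (V k : R) :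
    0 <= V -> 0 <= k ->
    (forall t t' x x', P t x -> P t' x' -> `|(idx t - idx t')%:~R| <= V) ->
    (forall z, scover s [set x | exists2 t, P t x & idx t = z] k) ->
  scover s [set x | exists t, P t x] ((2 * V + 1) * k).
Proof.
move=> V0 k0 PV Pk.
have Vk0 : 0 <= (2 * V + 1) * k by rewrite mulr_ge0// addr_ge0// mulr_ge0.
have [[x0 [t0 Px0]]|nP] := pselect (exists x t, P t x); last first.
  by apply: scover_sub (scover0 Vk0) => x [t Pt]; apply: nP; exists x, t.
pose m := Num.truncn V.
have /andP[mV Vm] : m%:R <= V < m.+1%:R by exact: truncn_itv.
pose A i := [set x | exists2 t, P t x & idx t = idx t0 - m%:Z + i%:Z].
apply: (@scover_le _ ((2 * m).+1%:R * k)).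
  by rewrite ler_wpM2r// -natr1 natrM lerD2r ler_wpM2l.
apply: scover_sub (@scover_iter A k (2 * m).+1 _) => [x [t Pt]|i _]; last exact: Pk.
have := PV _ _ _ _ Pt Px0; set z : int := idx t - idx t0 => zV.
have zm : (`|z| <= m)%N.
  by rewrite -ltnS -(ltr_nat R); apply: le_lt_trans Vm; rewrite natr_absz intr_norm.
exists (absz (z + m%:Z)); first by lia.
by exists t => //; rewrite /z in zm *; lia.
Qed.

(** The convergence half of the Borel-Cantelli lemma: every tail of [U] covers [A], and the tails of
    a convergent series of costs tend to 0. *)
Lemma limsup_scover (U : nat -> set R) (t : nat -> R) (S : R) (A : set R) :
    (forall n, 0 <= t n) -> (forall n, scover s (U n) (t n)) ->
    (forall N, \sum_(n < N) t n <= S) ->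
    (forall x, A x -> forall N, exists2 n, (N <= n)%N & U n x) ->
  forall e, 0 < e -> scover s A e.
Proof.
move=> t0 Ut tS AU e e0.
have nd : nondecreasing_seq (series t).
  by apply/nondecreasing_seqP => n; rewrite seriesSr lerDl.
have cv : cvgn (series t).
  apply: nondecreasing_is_cvgn => //.
  by exists S => _ [n _ <-]; rewrite /series/= big_mkord.
set l := limn (series t).
have sl n : series t n <= l by exact: nondecreasing_cvgn_le.
have [N _ /(_ N (leqnn N)) Nl] : \forall n \near \oo, l - e < series t n.
  by apply: (cvgr_gt l) => //; rewrite ltrBlDr ltrDl.
apply: (@scover_sub _ (\bigcup_i U (N + i)%N)).
  by move=> x /AU /(_ N)[n Nn Unx]; exists (n - N)%N => //; rewrite subnKC.
apply: (@scover_bigcup _ (fun i => t (N + i)%N)) => // n.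
have := sl (N + n)%N; rewrite /series /= (big_cat_nat (n := N))//= ?leq_addr//.
have -> : \sum_(N <= i < N + n) t i = \sum_(i < n) t (N + i)%N.
  by rewrite -{1}(add0n N) big_addn addKn big_mkord; apply: eq_bigr => i _; rewrite addnC.
by move: Nl; rewrite /series /=; lra.
Qed.
End Covers.

(** * Hausdorff measure zero means arbitrarily cheap covers *)

Section HausdorffNull.
Context {R : realType}.
Variables (s : R).
Hypothesis s_gt0 : 0 < s.

Lemma diam_ge0 (A : set R) : (0 <= diam A)%E.
Proof. by apply: ereal_sup_ubound; left. Qed.

Lemma diam_le (A : set R) (d : R) : 0 <= d ->
  (forall x y, A x -> A y -> `|x - y| <= d) -> (diam A <= d%:E)%E.
Proof.
move=> d0 Ad; apply: ge_ereal_sup => _ [->|[[x y] [Ax Ay] <-]]; rewrite lee_fin//.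
exact: Ad.
Qed.

Lemma hausdorff_null (A : set R) :
  (forall e, 0 < e -> scover s A e) -> hausdorff_measure s A = 0%E.
Proof.
move=> Ae; apply/eqP; rewrite eq_le; apply/andP; split; last first.
  apply: (@le_trans _ _ (hausdorff_premeasure s 1 A)); last first.
    by apply: ereal_sup_ubound; exists 1 => //=.
  apply: le_ereal_inf_tmp => _ [F _ <-]; apply: nneseries_ge0 => n _ _.
  exact: poweR_ge0.
apply: ge_ereal_sup => _ [delta /= delta0 <-].
apply/lee_addgt0Pr => e e0; rewrite add0e.
pose e' := Num.min e (delta `^ s).
have e'0 : 0 < e' by rewrite lt_min e0 powR_gt0.
have [F [d [AF d0 Fd de]]] := Ae _ e'0.
have dd i : d i <= delta.
  rewrite leNgt; apply/negP => dlt.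
  have : delta `^ s < d i `^ s.
    by apply: (gt0_ltr_powR s_gt0) => //; rewrite nnegrE ?d0// ltW.
  apply/negP; rewrite -leNgt; apply: le_trans (_ : e' <= _); last by rewrite ge_min lexx orbT.
  apply: le_trans (de i.+1); rewrite big_ord_recr /= lerDr sumr_ge0// => *.
  exact: powR_ge0.
have Fdiam i : (diam (F i) <= (d i)%:E)%E by apply: diam_le => // x y; exact: Fd.
apply: (@le_trans _ _ (\sum_(0 <= k <oo) diam (F k) `^ s)%E).
  apply: ereal_inf_lbound; exists F => //; split=> // k.
  by apply: le_trans (Fdiam k) _; rewrite lee_fin.
apply: lime_le.
  by apply: is_cvg_nneseries => *; exact: poweR_ge0.
apply: nearW => n.
apply: (@le_trans _ _ (\sum_(0 <= k < n) ((d k) `^ s)%:E)%E).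
  apply: lee_sum => i _; rewrite -poweR_EFin; apply: gt0_ler_poweR => //.
  - exact: ltW.
  - by rewrite in_itv /= diam_ge0 leey.
  - by rewrite in_itv /= lee_fin d0 leey.
rewrite sumEFin lee_fin big_mkord; apply: le_trans (de n) _.
by rewrite ge_min lexx.
Qed.

Lemma null_hausdorff (A : set R) :
  hausdorff_measure s A = 0%E -> forall e, 0 < e -> scover s A e.
Proof.
move=> A0 e e0.
(* [scover] puts no limit on the diameters, so one value of [delta] is enough; any finite one makes
   the diameters finite, and [fine] then loses nothing. *)
have : (hausdorff_premeasure s 1 A < e%:E)%E.
  apply: (@le_lt_trans _ _ (hausdorff_measure s A)).
    by apply: ereal_sup_ubound; exists 1 => //=.
  by rewrite A0 lte_fin.
move=> /ereal_inf_lt[_ [F [AF F1] <-] Fe].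
have Ffin i : diam (F i) \is a fin_num.
  rewrite ge0_fin_numE ?diam_ge0//; apply: le_lt_trans (F1 i) _.
  by rewrite ltry.
exists F, (fun i => fine (diam (F i))); split=> //.
- by move=> i; apply: fine_ge0; exact: diam_ge0.
- move=> i x y Fx Fy; rewrite -lee_fin fineK//.
  by apply: ereal_sup_ubound; right; exists (x, y).
move=> N; rewrite -lee_fin -sumEFin; apply: le_trans (ltW Fe).
rewrite -(big_mkord xpredT (fun i => (fine (diam (F i)) `^ s)%:E)).
under eq_bigr do rewrite -poweR_EFin fineK//.
by apply: nneseries_lim_ge => *; exact: poweR_ge0.
Qed.

Lemma scover_countable (A : set R) (P : nat -> set R) :
  (forall i e, 0 < e -> scover s (P i) e) -> A `<=` \bigcup_i P i ->
  forall e, 0 < e -> scover s A e.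
Proof.
move=> Pe AP e e0; apply: scover_sub AP _.
apply: (@scover_bigcup _ _ s_gt0 _ (fun i => e / 2 ^+ i.+1)) => [i|N].
  by apply: Pe; rewrite divr_gt0// exprn_gt0.
have -> : \sum_(i < N) e / 2 ^+ i.+1 = e - e / 2 ^+ N.
  elim: N => [|N IH]; first by rewrite big_ord0 expr0 divr1 subrr.
  rewrite big_ord_recr /= IH exprS; field.
  by rewrite expf_neq0.
by rewrite gerBl divr_ge0// ?ltW// exprn_gt0.
Qed.

End HausdorffNull.

(** * Derivatives relative to an interval, mean values, Taylor bounds *)

Section Calculus.
Context {R : realType}.
Implicit Types (f g : R -> R) (a b x y : R).

Lemma within_dnbhs_interior (D : set R) x : D° x -> within D x^' = x^'.
Proof.
move=> Dx; apply/seteqP; split=> A H.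
  have {}H : nbhs x (fun y => y != x -> D y -> A y) := H.
  have {}Dx : nbhs x D := Dx.
  change (nbhs x (fun y => y != x -> A y)).
  by apply: filterS2 H Dx => y h Dy yx; exact: h.
have {}H : nbhs x (fun y => y != x -> A y) := H.
change (nbhs x (fun y => y != x -> D y -> A y)).
by apply: filterS H => y h yx _; exact: h.
Qed.

Lemma derive_in_is_derive (D : set R) f x : D° x -> derivable_in D f x ->
  is_derive x 1 f (derive_in D f x).
Proof.
move=> Dx; rewrite /derivable_in /derive_in (within_dnbhs_interior Dx).
set l := lim _ => fl.
apply/is_derive1_caratheodory.
exists (fun z => if z == x then l else (f z - f x) / (z - x)); split.
- move=> z; case: eqVneq => [->|zx]; first by rewrite !subrr mulr0.
  by rewrite divfK// subr_eq0.
- apply/continuous_withinNx; rewrite eqxx.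
  apply: cvg_trans fl; apply: near_eq_cvg; near=> z.
  have /negPf -> // : z != x by near: z; exact: nbhs_dnbhs_neq.
- by rewrite eqxx.
Unshelve. all: by end_near. Qed.

(** Only interior points are kept, since the two endpoints will go into the null set. The last
    conjunct ties [f2] to the function whose zeros are controlled by the nondegeneracy
    hypothesis. *)
Lemma C2_on_derivatives a b f : C2_on `[a, b] f ->
  exists f1 f2 : R -> R, [/\ forall x, a < x < b -> is_derive x 1 f (f1 x),
     forall x, a < x < b -> is_derive x 1 f1 (f2 x),
     forall x, a < x < b -> {for x, continuous f2}
   & f2 = derive_in `[a, b] (derive_in `[a, b] f)].
Proof.
move=> [d1 d2 c2].
have int x : a < x < b -> (`[a, b]%classic : set R)° x.
  by move=> xab; rewrite interior_itv /= in_itv.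
exists (derive_in `[a, b] f), (derive_in `[a, b] (derive_in `[a, b] f)).
split=> // x xab.
- by apply: derive_in_is_derive (int _ xab) (d1 _ _); exact: interior_subset (int _ xab).
- by apply: derive_in_is_derive (int _ xab) (d2 _ _); exact: interior_subset (int _ xab).
- have := (subspace_continuousP _ _).1 c2 x (interior_subset (int _ xab)).
  by rewrite (within_interior (int _ xab)).
Qed.

Lemma mean_value u v f f1 : (forall x, u <= x <= v -> is_derive x 1 f (f1 x)) ->
  forall x y, u <= x -> x <= y -> y <= v -> exists2 z, x <= z <= y & f y - f x = f1 z * (y - x).
Proof.
move=> df x y ux xy yv.
have [z zxy ->] : exists2 z, z \in `[x, y] & f y - f x = f1 z * (y - x).
  apply: MVT_segment => // [z|].
    rewrite in_itv /= => /andP[xz zy]; apply: df.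
    by rewrite (le_trans ux (ltW xz)) (le_trans (ltW zy) yv).
  apply: derivable_within_continuous => z; rewrite in_itv /= => /andP[xz zy].
  by have [] : is_derive z 1 f (f1 z) by apply: df; rewrite (le_trans ux xz) (le_trans zy yv).
by exists z.
Qed.

End Calculus.

Section Taylor.
Context {R : realType}.
Variables (u v : R) (f f1 f2 : R -> R).
Hypothesis df : forall x, u <= x <= v -> is_derive x 1 f (f1 x).
Hypothesis df1 : forall x, u <= x <= v -> is_derive x 1 f1 (f2 x).

Lemma derive_lipschitz K : (forall x, u <= x <= v -> `|f1 x| <= K) ->
  forall x y, u <= x <= v -> u <= y <= v -> `|f x - f y| <= K * `|x - y|.
Proof.
move=> fK x y; wlog xy : x y / x <= y => [H|].
  have [|/ltW yx] := leP x y; first exact: H.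
  by move=> ? ?; rewrite distrC (distrC x); exact: H.
move=> /andP[ux xv] /andP[uy yv].
have [z /andP[xz zy] E] := mean_value df ux xy yv.
rewrite distrC E normrM (distrC x) ler_wpM2r// fK//.
by rewrite (le_trans ux xz) (le_trans zy yv).
Qed.

Lemma derive_incr m : (forall x, u <= x <= v -> m <= f2 x) ->
  forall x y, u <= x -> x <= y -> y <= v -> m * (y - x) <= f1 y - f1 x.
Proof.
move=> mf x y ux xy yv; have [z /andP[xz zy] ->] := mean_value df1 ux xy yv.
by rewrite ler_wpM2r ?subr_ge0// mf// (le_trans ux xz) (le_trans zy yv).
Qed.

(* Splitting at the midpoint recovers a quadratic lower bound from two
   applications of the mean value theorem. *)
Lemma taylor_ge m : 0 <= m -> (forall x, u <= x <= v -> m <= f2 x) ->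
  forall x y, u <= x <= v -> u <= y <= v ->
  m / 4 * (y - x) ^+ 2 <= f y - f x - f1 x * (y - x).
Proof.
move=> m0 mf x y /andP[ux xv] /andP[uy yv].
have inc := derive_incr mf.
pose w := (x + y) / 2.
have [xy|/ltW yx] := leP x y.
- have xw : x <= w by rewrite /w; lra.
  have wy : w <= y by rewrite /w; lra.
  have [z /andP[wz zy] E1] := mean_value df (le_trans ux xw) wy yv.
  have [z' /andP[xz' zw'] E2] := mean_value df ux xw (le_trans wy yv).
  have h1 := inc w z (le_trans ux xw) wz (le_trans zy yv).
  have h2 := inc x w ux xw (le_trans wy yv).
  have h3 := inc x z' ux xz' (le_trans zw' (le_trans wy yv)).
  have g1 : f1 x + m * (w - x) <= f1 z.
    have : 0 <= m * (z - w) by rewrite mulr_ge0// subr_ge0.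
    lra.
  have g2 : f1 x <= f1 z'.
    have : 0 <= m * (z' - x) by rewrite mulr_ge0// subr_ge0.
    lra.
  have k1 : (f1 x + m * (w - x)) * (y - w) <= f y - f w.
    by rewrite E1 ler_wpM2r// subr_ge0.
  have k2 : f1 x * (w - x) <= f w - f x by rewrite E2 ler_wpM2r// subr_ge0.
  have -> : m / 4 * (y - x) ^+ 2 = m * (w - x) * (y - w) by rewrite /w; field.
  lra.
- have yw : y <= w by rewrite /w; lra.
  have wx : w <= x by rewrite /w; lra.
  have [z /andP[yz zw] E1] := mean_value df uy yw (le_trans wx xv).
  have [z' /andP[wz' zx'] E2] := mean_value df (le_trans uy yw) wx xv.
  have h1 := inc z w (le_trans uy yz) zw (le_trans wx xv).
  have h2 := inc w x (le_trans uy yw) wx xv.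
  have h3 := inc z' x (le_trans (le_trans uy yw) wz') zx' xv.
  have g1 : f1 z <= f1 x - m * (x - w).
    have : 0 <= m * (w - z) by rewrite mulr_ge0// subr_ge0.
    lra.
  have g2 : f1 z' <= f1 x.
    have : 0 <= m * (x - z') by rewrite mulr_ge0// subr_ge0.
    lra.
  have k1 : f w - f y <= (f1 x - m * (x - w)) * (w - y).
    by rewrite E1 ler_wpM2r// subr_ge0.
  have k2 : f x - f w <= f1 x * (x - w) by rewrite E2 ler_wpM2r// subr_ge0.
  have -> : m / 4 * (y - x) ^+ 2 = m * (x - w) * (w - y) by rewrite /w; field.
  lra.
Qed.
End Taylor.

Lemma taylor_remainder {R : realType} (u v : R) (f f1 f2 : R -> R) K :
  (forall x, u <= x <= v -> is_derive x 1 f (f1 x)) ->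
  (forall x, u <= x <= v -> is_derive x 1 f1 (f2 x)) ->
  (forall x, u <= x <= v -> `|f2 x| <= K) ->
  forall x y, u <= x <= v -> u <= y <= v ->
  `|f y - f x - f1 x * (y - x)| <= K * (y - x) ^+ 2.
Proof.
move=> df df1 f2K x y xuv yuv; have L := derive_lipschitz df1 f2K.
have K0 : 0 <= K by apply: le_trans (f2K x xuv).
case/andP: (xuv) => ux xv; case/andP: (yuv) => uy yv.
have [z [zuv zx E]] : exists z, [/\ u <= z <= v, `|z - x| <= `|y - x| &
    f y - f x = f1 z * (y - x)].
  have [xy|/ltW yx] := leP x y.
    have [z /andP[xz zy] E] := mean_value df ux xy yv.
    exists z; split=> //; first by rewrite (le_trans ux xz) (le_trans zy yv).
    by rewrite !ger0_norm ?subr_ge0// lerD2r.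
  have [z /andP[xz zy] E] := mean_value df uy yx xv.
  exists z; split=> //; first by rewrite (le_trans uy xz) (le_trans zy xv).
    by rewrite !ler0_norm ?subr_le0// lerN2 lerD2r.
  by rewrite -[LHS]opprB E; ring.
have -> : (y - x) ^+ 2 = `|y - x| * `|y - x| by rewrite -normrM -expr2 ger0_norm ?sqr_ge0.
rewrite E -mulrBl normrM mulrA ler_wpM2r//.
by apply: le_trans (L z x zuv xuv) _; rewrite ler_wpM2l.
Qed.

(** * Arcs of positive curvature, and convex functions close to tangency *)

Record curve_bounds (R : realType) (J : set R) (C : R) (f f1 l l1 : R -> R) : Prop :=
  CurveBounds {
  cb_ge1 : 1 <= C;
  cb_len : forall x y, J x -> J y -> `|x - y| <= C;
  cb_f1 : forall x, J x -> `|f1 x| <= C;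
  cb_l1 : forall x, J x -> `|l1 x| <= C;
  cb_flip : forall x y, J x -> J y -> `|f x - f y| <= C * `|x - y|;
  cb_llip : forall x y, J x -> J y -> `|l x - l y| <= C * `|x - y|;
  cb_f1lip : forall x y, J x -> J y -> `|f1 x - f1 y| <= C * `|x - y|;
  cb_l1lip : forall x y, J x -> J y -> `|l1 x - l1 y| <= C * `|x - y|;
  cb_f1incr : forall x y, J x -> J y -> (x - y) ^+ 2 / C <= (f1 x - f1 y) * (x - y);
  cb_fge : forall x y, J x -> J y -> (y - x) ^+ 2 / C <= f y - f x - f1 x * (y - x);
  cb_fle : forall x y, J x -> J y -> f y - f x - f1 x * (y - x) <= C * (y - x) ^+ 2;
  cb_lrem : forall x y, J x -> J y -> `|l y - l x - l1 x * (y - x)| <= C * (y - x) ^+ 2 }.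

(** This is where differentiability is traded for inequalities between two points, with a single
    constant [C]: the arithmetic part never differentiates. Positive curvature is assumed; negative
    curvature is reduced to it by reflecting [f]. *)
Lemma derivatives_curve_bounds (R : realType) (u v m K : R) (f f1 f2 l l1 l2 : R -> R) :
    u <= v -> 0 < m ->
    (forall x, u <= x <= v -> is_derive x 1 f (f1 x)) ->
    (forall x, u <= x <= v -> is_derive x 1 f1 (f2 x)) ->
    (forall x, u <= x <= v -> is_derive x 1 l (l1 x)) ->
    (forall x, u <= x <= v -> is_derive x 1 l1 (l2 x)) ->
    (forall x, u <= x <= v -> m <= f2 x <= K) ->
    (forall x, u <= x <= v -> `|l2 x| <= K) ->
  exists C, curve_bounds [set x | u <= x <= v] C f f1 l l1.
Proof.
move=> uv m0 df df1 dl dl1 f2b l2K.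
have f2m x : u <= x <= v -> m <= f2 x by move=> /f2b /andP[].
have f2K x : u <= x <= v -> `|f2 x| <= K.
  by move=> /f2b /andP[h1 h2]; rewrite ger0_norm// (le_trans (ltW m0) h1).
have uuv : u <= u <= v by rewrite lexx.
have K0 : 0 <= K by apply: le_trans (l2K u uuv).
have Lf1 := derive_lipschitz df1 f2K.
have Ll1 := derive_lipschitz dl1 l2K.
pose A := Num.max `|f1 u| `|l1 u| + K * (v - u).
have xu x : u <= x <= v -> K * `|x - u| <= K * (v - u).
  by move=> /andP[ux xv]; rewrite ler_wpM2l// ger0_norm ?subr_ge0// lerD2r.
have f1A x : u <= x <= v -> `|f1 x| <= A.
  move=> xuv; have := Lf1 x u xuv uuv; have := xu x xuv.
  have : `|f1 x| <= `|f1 x - f1 u| + `|f1 u| by rewrite -{1}(subrK (f1 u) (f1 x)) ler_normD.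
  have : `|f1 u| <= Num.max `|f1 u| `|l1 u| by rewrite le_max lexx.
  rewrite /A; lra.
have l1A x : u <= x <= v -> `|l1 x| <= A.
  move=> xuv; have := Ll1 x u xuv uuv; have := xu x xuv.
  have : `|l1 x| <= `|l1 x - l1 u| + `|l1 u| by rewrite -{1}(subrK (l1 u) (l1 x)) ler_normD.
  have : `|l1 u| <= Num.max `|f1 u| `|l1 u| by rewrite le_max lexx orbT.
  rewrite /A; lra.
have A0 : 0 <= A by apply: le_trans (f1A u uuv).
(* The summand [4 / m] makes [C^-1] at most [m / 4], the constant lost in [taylor_ge]; the other
   summands dominate the slopes, the second derivatives and the length. *)
pose C := 1 + A + K + (v - u) + 4 / m.
have vu0 : 0 <= v - u by rewrite subr_ge0.
have m40 : 0 < 4 / m by rewrite divr_gt0.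
have C1 : 1 <= C by rewrite /C; lra.
have C0 : 0 < C by lra.
have AC : A <= C by rewrite /C; lra.
have KC : K <= C by rewrite /C; lra.
have Cm : C^-1 <= m / 4.
  by rewrite -[m / 4]invrK lef_pV2 ?posrE ?invr_gt0 ?divr_gt0// invf_div /C; lra.
exists C; split=> //.
- move=> x y /= /andP[ux xv] /andP[uy yv]; rewrite ler_norml; apply/andP; split; rewrite /C; lra.
- by move=> x /= /f1A /le_trans; exact.
- by move=> x /= /l1A /le_trans; exact.
- by move=> x y xJ yJ; apply: le_trans (derive_lipschitz df f1A xJ yJ) _; rewrite ler_wpM2r.
- by move=> x y xJ yJ; apply: le_trans (derive_lipschitz dl l1A xJ yJ) _; rewrite ler_wpM2r.
- by move=> x y xJ yJ; apply: le_trans (Lf1 _ _ xJ yJ) _; rewrite ler_wpM2r.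
- by move=> x y xJ yJ; apply: le_trans (Ll1 _ _ xJ yJ) _; rewrite ler_wpM2r.
- move=> x y; wlog xy : x y / y <= x => [H|].
    have [|/ltW yx] := leP y x; first exact: H.
    move=> xJ yJ; rewrite -sqrrN opprB.
    have -> : (f1 x - f1 y) * (x - y) = (f1 y - f1 x) * (y - x) by ring.
    exact: H.
  move=> /= /andP[ux xv] /andP[uy yv].
  rewrite mulrC expr2 mulrA ler_wpM2r ?subr_ge0//.
  apply: le_trans (derive_incr df1 f2m uy xy xv).
  by rewrite ler_wpM2r ?subr_ge0//; apply: le_trans Cm _; lra.
- move=> x y xJ yJ; apply: le_trans (taylor_ge df df1 (ltW m0) f2m xJ yJ).
  by rewrite mulrC ler_wpM2r// sqr_ge0.
- move=> x y xJ yJ; apply: le_trans (ler_norm _) _.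
  by apply: le_trans (taylor_remainder df df1 f2K xJ yJ) _; rewrite ler_wpM2r// sqr_ge0.
- move=> x y xJ yJ.
  by apply: le_trans (taylor_remainder dl dl1 l2K xJ yJ) _; rewrite ler_wpM2r// sqr_ge0.
Qed.

(* The quantitative convexity used of a real function [F] with derivative [F1]:
   [F''] lies between [Q / D] and [D Q]. *)
Record convex_pair (R : realType) (J : set R) (Q D : R) (F F1 : R -> R) : Prop :=
  ConvexPair {
  cp_incr : forall x y, J x -> J y -> Q / D * `|x - y| <= `|F1 x - F1 y|;
  cp_lip : forall x y, J x -> J y -> `|F1 x - F1 y| <= D * Q * `|x - y|;
  cp_ge : forall x y, J x -> J y -> F x + F1 x * (y - x) + Q / D * (y - x) ^+ 2 <= F y;
  cp_le : forall x y, J x -> J y -> F y <= F x + F1 x * (y - x) + D * Q * (y - x) ^+ 2 }.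

(** The derivative moves at rate at least [Q / D], so a change of slope of at most [Y] keeps [y]
    within [D * Y / Q] of [x]. Over that distance the linear and the quadratic Taylor terms are both
    of order [Y ^+ 2 / Q]. *)
Lemma convex_pair_transfer (R : realType) (J : set R) (Q D M Y psi : R) (W V : R -> R)
    (x y : R) : 1 <= D -> 0 < Q -> 0 <= M -> M <= Y -> convex_pair J Q D W V ->
    J x -> J y -> `|W x| <= psi -> `|V x| <= M -> `|V x - V y| <= Y ->
  `|W y| <= psi + 2 * D ^+ 3 * Y ^+ 2 / Q.
Proof.
move=> D1 Q0 M0 YM c Jx Jy wx vx vY.
have D0 : 0 < D by lra.
set d := `|x - y|; have d0 : 0 <= d by exact: normr_ge0.
have dY : d <= D * Y / Q.
  have h := le_trans (cp_incr c Jx Jy) vY; rewrite -/d in h.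
  rewrite ler_pdivlMr// -ler_pdivrMl//.
  by rewrite (_ : _ * _ = Q / D * d)//; ring.
have d2E : (y - x) ^+ 2 = d ^+ 2 by rewrite /d real_normK ?num_real//; ring.
have lin : `|V x * (y - x)| <= D * Y ^+ 2 / Q.
  rewrite normrM (distrC y) -/d (_ : _ / Q = Y * (D * Y / Q)); last by ring.
  by apply: ler_pM => //; exact: le_trans vx YM.
have quad : D * Q * d ^+ 2 <= D ^+ 3 * Y ^+ 2 / Q.
  have -> : D ^+ 3 * Y ^+ 2 / Q = D * Q * (D * Y / Q) ^+ 2 by field; rewrite gt_eqF.
  apply: ler_wpM2l; first exact: mulr_ge0 (ltW D0) (ltW Q0).
  by rewrite ler_sqr ?nnegrE// (le_trans d0 dY).
have DD : D * Y ^+ 2 / Q <= D ^+ 3 * Y ^+ 2 / Q.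
  rewrite ler_pM2r ?invr_gt0//; apply: ler_wpM2r; first exact: sqr_ge0.
  by rewrite -{1}(expr1 D) ler_weXn2l.
have q2 : 0 <= Q / D * d ^+ 2 by rewrite mulr_ge0 ?sqr_ge0// divr_ge0// ltW.
have := cp_ge c Jx Jy; have := cp_le c Jx Jy; rewrite d2E.
rewrite (_ : 2 * D ^+ 3 * Y ^+ 2 / Q = D ^+ 3 * Y ^+ 2 / Q + D ^+ 3 * Y ^+ 2 / Q); last by ring.
move: lin wx quad DD q2; set u := D ^+ 3 * _ / Q; set t := D * Y ^+ 2 / Q.
set p := V x * _; set q := D * Q * _; set r := Q / D * _; clear.
rewrite !ler_norml => /andP[? ?] /andP[? ?] ? ? ? ? ?.
by apply/andP; split; lra.
Qed.

Lemma convex_pair_ge (R : realType) (J : set R) (Q D M psi : R) (W V : R -> R) (x y : R) :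
    convex_pair J Q D W V -> J x -> J y -> `|W x| <= psi -> `|V x| <= M ->
  Q / D * (y - x) ^+ 2 - M * `|y - x| - psi <= W y.
Proof.
move=> c Jx Jy wx vx; have := cp_ge c Jx Jy.
have : `|V x * (y - x)| <= M * `|y - x| by rewrite normrM ler_wpM2r.
move: wx; rewrite !ler_norml => /andP[? ?] /andP[? ?]; lra.
Qed.

Lemma parabola_ge (R : realType) (Q D M d : R) : 0 < Q -> 0 < D ->
  - (D * M ^+ 2 / Q) <= Q / D * d ^+ 2 - M * `|d|.
Proof.
move=> Q0 D0.
have d2 : d ^+ 2 = `|d| ^+ 2 by rewrite real_normK ?num_real.
have : 0 <= Q / D * (`|d| - D * M / (2 * Q)) ^+ 2.
  by rewrite mulr_ge0 ?sqr_ge0// divr_ge0// ltW.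
have -> : Q / D * (`|d| - D * M / (2 * Q)) ^+ 2
   = Q / D * `|d| ^+ 2 - M * `|d| + D * M ^+ 2 / Q / 4 by field; lra.
have : 0 <= D * M ^+ 2 / Q by rewrite divr_ge0 ?(ltW Q0)// mulr_ge0 ?sqr_ge0// ltW.
rewrite d2; lra.
Qed.

Lemma parabola_sublevel (R : realType) (Q D A M d : R) : 0 < Q -> 1 <= D -> 1 <= A -> 0 < M ->
    Q / D * d ^+ 2 - M * d <= A * M ^+ 2 / Q ->
  d <= 4 * D * (1 + A) * M / Q.
Proof.
move=> Q0 D1 A1 M0; set y := Q * d => h.
have D0 : 0 < D by lra.
have DA : 2 <= D * (1 + A) by nra.
rewrite ler_pdivlMr// mulrC -/y leNgt; apply/negP => k.
have My : M < y by apply: le_lt_trans k; rewrite ler_peMl//; lra.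
have E : y ^+ 2 / D - M * y = (Q / D * d ^+ 2 - M * d) * Q by rewrite /y; field; lra.
have h' : y ^+ 2 / D - M * y <= A * M ^+ 2.
  by rewrite E; move: h; rewrite -(ler_pM2r Q0) divfK// gt_eqF.
have k1 : (1 + A) * M * y <= y ^+ 2 / D.
  rewrite ler_pdivlMr// expr2 (_ : _ * D = D * (1 + A) * M * y); last by ring.
  have Z0 : 0 <= D * (1 + A) * M by rewrite mulr_ge0//; lra.
  by rewrite ler_wpM2r//; lra.
have k2 : A * M * M < A * M * y by rewrite ltr_pM2l// mulr_gt0//; lra.
by move: h' k1 k2; rewrite expr2; clear; lra.
Qed.

(* Once the second difference of the three values at [x2] vanishes, convexity
   forces the nearer neighbour of [x2] to be as close as the tangency
   parameter [M] allows. *)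
Lemma nearest_neighbour (R : realType) (J : set R) (Q D B M psi : R)
    (W V W' V' : R -> R) (x x' x2 r r' w v : R) :
    1 <= D -> 0 < Q -> 1 <= B -> 0 < M -> psi <= B * M ^+ 2 / Q ->
    convex_pair J Q D W V -> convex_pair J Q D W' V' -> J x -> J x' -> J x2 ->
    `|W x| <= psi -> `|V x| <= M -> `|W' x'| <= psi -> `|V' x'| <= M ->
    w <= psi -> `|v| <= M ->
    0 < r -> r <= r' -> r' * W x2 + r * W' x2 = (r + r') * w ->
  `|V x2 - v| <= (2 + D * (4 * D * (1 + (4 * B + D)))) * M.
Proof.
move=> D1 Q0 B1 M0 psiB c c' Jx Jx' J2 wx vx wx' vx' wpsi vM r0 rr' E.
have D0 : 0 < D by lra.
have d2E : (x2 - x) ^+ 2 = `|x2 - x| ^+ 2 by rewrite real_normK ?num_real.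
have h1 := convex_pair_ge c Jx J2 wx vx; rewrite d2E in h1.
have h2 := convex_pair_ge c' Jx' J2 wx' vx'.
have h3 := parabola_ge M (x2 - x') Q0 D0.
have psi0 : 0 <= psi := le_trans (normr_ge0 _) wx.
(* The nearer form [W] carries the larger weight [r']. The other form is at least [- T - psi] after
   completing the square, so dividing the relation by [r'] leaves [ph <= 4 * psi + T], a quadratic
   inequality for the distance from [x] to [x2]. *)
have sub : Q / D * `|x2 - x| ^+ 2 - M * `|x2 - x| <= (4 * B + D) * M ^+ 2 / Q.
  have -> : (4 * B + D) * M ^+ 2 / Q = 4 * (B * M ^+ 2 / Q) + D * M ^+ 2 / Q by ring.
  have T0 : 0 <= D * M ^+ 2 / Q.
    by rewrite divr_ge0 ?(ltW Q0)// mulr_ge0 ?sqr_ge0// ltW.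
  move: psiB T0 h1 h2 h3; set T := D * M ^+ 2 / Q; set b := B * _ / Q.
  set ph := Q / D * _ - M * `|x2 - x|; set ph' := Q / D * _ - M * `|x2 - x'|.
  move=> psib T0 h1 h2 h3.
  have k1 : r' * (ph - psi) <= r' * W x2 by rewrite ler_wpM2l//; lra.
  have k2 : r * (- T - psi) <= r * W' x2 by apply: ler_wpM2l (ltW r0) _ _ _; lra.
  have k3 : (r + r') * w <= (r + r') * psi by rewrite ler_wpM2l//; lra.
  have k4 : r * (T + 2 * psi) <= r' * (T + 2 * psi) by rewrite ler_wpM2r//; lra.
  have : r' * ph <= r' * (4 * psi + T).
    by move: k1 k2 k3 k4 E; clear; lra.
  by rewrite ler_pM2l; [|lra]; move: psib; clear; lra.
have A1 : 1 <= 4 * B + D by lra.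
have dE := parabola_sublevel Q0 D1 A1 M0 sub.
have l := cp_lip c J2 Jx.
have Qd : D * Q * `|x2 - x| <= D * (4 * D * (1 + (4 * B + D))) * M.
  have -> : D * (4 * D * (1 + (4 * B + D))) * M
    = D * Q * (4 * D * (1 + (4 * B + D)) * M / Q) by field; rewrite gt_eqF.
  by apply: ler_wpM2l dE; exact: mulr_ge0 (ltW D0) (ltW Q0).
have vg : `|V x2 - v| <= `|V x| + `|V x2 - V x| + `|v|.
  apply: le_trans (ler_normB _ _) _; rewrite lerD2r.
  by rewrite -{1}(subrKC (V x) (V x2)) ler_normD.
by move: vg l Qd vx vM; clear; lra.
Qed.

(** The forms sit at positions [- p], 0, [q] on a line of slope increment [g]. The weights [q],
    [- (p + q)], [p] annihilate everything affine along the line, so the combination is an integer.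
    Moving the outer forms to [x2] shows that it is smaller than 1, and its vanishing is the
    relation that [nearest_neighbour] exploits. *)
Lemma three_points (R : realType) (J : set R) (Q D B M psi K tm tp : R)
    (W1 V1 W2 V2 W3 V3 : R -> R) (x1 x2 x3 p q g : R) (z : int) :
    1 <= D -> 0 < Q -> 1 <= B -> 0 < M -> 0 <= tm -> 0 <= psi ->
    psi <= B * M ^+ 2 / Q ->
    0 < K -> K * (2 * psi + 2 * D ^+ 3 * (2 * M + K * tp) ^+ 2 / Q) < 1 ->
    convex_pair J Q D W1 V1 -> convex_pair J Q D W2 V2 -> convex_pair J Q D W3 V3 ->
    J x1 -> J x2 -> J x3 ->
    `|W1 x1| <= psi -> `|W2 x2| <= psi -> `|W3 x3| <= psi ->
    `|V1 x1| <= M -> `|V2 x2| <= M -> `|V3 x3| <= M ->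
    0 < p -> 0 < q -> p + q <= K -> tm <= `|g| <= tp ->
    V1 x2 = V2 x2 - p * g -> V3 x2 = V2 x2 + q * g ->
    q * W1 x2 - (p + q) * W2 x2 + p * W3 x2 = z%:~R ->
  Num.min p q * tm <= (2 + D * (4 * D * (1 + (4 * B + D)))) * M.
Proof.
move=> D1 Q0 B1 M0 tm0 psi0 psiB K0 small c1 c2 c3 J1 J2 J3 w1 w2 w3 v1 v2 v3 p0 q0 pqK.
move=> /andP[tmg gtp] e1 e3 ez.
have tp0 : 0 <= tp := le_trans (normr_ge0 _) gtp.
have KY : 0 <= K * tp := mulr_ge0 (ltW K0) tp0.
have diff (V : R -> R) (x r : R) : 0 < r -> r <= K -> `|V x| <= M ->
    `|V x2 - V2 x2| = r * `|g| -> `|V x - V x2| <= 2 * M + K * tp.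
  move=> r0 rK vx E.
  have h1 : r * `|g| <= K * tp by apply: ler_pM => //; exact: ltW.
  have h2 : `|V x - V x2| <= `|V x| + (`|V2 x2| + `|V x2 - V2 x2|).
    apply: le_trans (ler_normB _ _) _; rewrite lerD2l.
    by rewrite -{1}(subrKC (V2 x2) (V x2)) ler_normD.
  by move: h1 h2 vx v2; rewrite E; clear; lra.
have E1 : `|V1 x2 - V2 x2| = p * `|g|.
  by rewrite e1 addrAC subrr add0r normrN normrM (ger0_norm (ltW p0)).
have E3 : `|V3 x2 - V2 x2| = q * `|g|.
  by rewrite e3 addrAC subrr add0r normrM (ger0_norm (ltW q0)).
have pK : p <= K by move: p0 q0 pqK; clear; lra.
have qK : q <= K by move: p0 q0 pqK; clear; lra.
have YM : M <= 2 * M + K * tp by move: KY M0; clear; lra.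
have S1 := convex_pair_transfer D1 Q0 (ltW M0) YM c1 J1 J2 w1 v1 (diff _ _ _ p0 pK v1 E1).
have S3 := convex_pair_transfer D1 Q0 (ltW M0) YM c3 J3 J2 w3 v3 (diff _ _ _ q0 qK v3 E3).
move: small S1 S3; set S := 2 * D ^+ 3 * _ / Q => small S1 S3.
have D0 : 0 < D by move: D1; clear; lra.
have S0 : 0 <= S.
  by rewrite /S divr_ge0 ?(ltW Q0)// mulr_ge0 ?sqr_ge0// mulr_ge0// exprn_ge0// ltW.
have pq0 : 0 <= p + q by exact: addr_ge0 (ltW p0) (ltW q0).
(* At [x2] the outer forms are at most [psi + S] and the middle one at most [psi], so the integer is
   bounded by [(p + q) * (2 * psi + S)], below 1 by the choice of [K]. *)
have z0 : z = 0.
  apply/eqP; rewrite -absz_eq0 -leqn0 -ltnS -(ltr_nat R) natr_absz intr_norm -ez.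
  apply: le_lt_trans small.
  apply: (@le_trans _ _ (q * (psi + S) + (p + q) * psi + p * (psi + S))).
    apply: le_trans (ler_normD _ _) _; apply: lerD; last first.
      by rewrite normrM (ger0_norm (ltW p0)) ler_wpM2l// ltW.
    apply: le_trans (ler_normB _ _) _; apply: lerD.
      by rewrite normrM (ger0_norm (ltW q0)) ler_wpM2l// ltW.
    by rewrite normrM (ger0_norm pq0) ler_wpM2l.
  have -> : q * (psi + S) + (p + q) * psi + p * (psi + S) = (p + q) * (2 * psi + S) by ring.
  by rewrite ler_wpM2r// addr_ge0// mulr_ge0.
move: ez; rewrite z0 mulr0z => ez.
have w2' : W2 x2 <= psi := le_trans (ler_norm _) w2.
have [pq|/ltW qp] := leP p q.
- apply: le_trans (ler_wpM2l (ltW p0) tmg) _; rewrite -E1.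
  apply: (nearest_neighbour D1 Q0 B1 M0 psiB c1 c3 J1 J3 J2 w1 v1 w3 v3 w2' v2 p0 pq).
  by move: ez; clear; lra.
- apply: le_trans (ler_wpM2l (ltW q0) tmg) _; rewrite -E3.
  apply: (nearest_neighbour D1 Q0 B1 M0 psiB c3 c1 J3 J1 J2 w3 v3 w1 v1 w2' v2 q0 qp).
  by move: ez; clear; lra.
Qed.

(** * The forms and their convexity *)

Definition dual_form (R : realType) (f l : R -> R) (a : int * int * int) (x : R) : R :=
  a.2%:~R * f x + a.1.2%:~R * x + a.1.1%:~R + l x.

Definition dual_form1 (R : realType) (f1 l1 : R -> R) (a : int * int * int) (x : R) : R :=
  a.2%:~R * f1 x + a.1.2%:~R + l1 x.

(** The integer [e] is the sign of [a2], so the curvature of [a2 f] becomes positive of order [Q].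
    The condition [8 * C ^+ 3 <= Q] lets it absorb the curvature of the inhomogeneous term; 33 is
    the bound 32 on [a2 / Q] plus one for that term. *)
Lemma dual_form_convex (R : realType) (J : set R) (C : R) (f f1 l l1 : R -> R) (Q : R)
    (e : int) (a : int * int * int) :
    curve_bounds J C f f1 l l1 -> 8 * C ^+ 3 <= Q -> (e = 1 \/ e = -1) ->
    Q / (4 * C) <= (e * a.2)%:~R <= 32 * Q ->
  convex_pair J Q (33 * C ^+ 2) (fun x => e%:~R * dual_form f l a x)
    (fun x => e%:~R * dual_form1 f1 l1 a x).
Proof.
move=> cb CQ e1 /andP[]; rewrite intrM.
set A : R := e%:~R * a.2%:~R => QA AQ.
have C1 := cb_ge1 cb.
have C0 : 0 < C by lra.
have e2 : `|e%:~R| = 1 :> R by case: e1 => ->; rewrite ?normrN normr1.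
have QC : 8 * C <= Q by apply: le_trans CQ; rewrite ler_pM2l// -{1}(expr1 C) ler_weXn2l.
have Q0 : 0 < Q by lra.
have lo : Q / (33 * C ^+ 2) <= A / C - C.
  have h1 : Q / (4 * C) / C <= A / C by rewrite ler_pM2r ?invr_gt0.
  have h2 : C <= Q / (8 * C ^+ 2).
    rewrite ler_pdivlMr; last by rewrite mulr_gt0// exprn_gt0.
    by apply: le_trans CQ; rewrite (_ : C * _ = 8 * C ^+ 3); [|ring].
  have h3 : Q / (4 * C) / C = Q / (8 * C ^+ 2) + Q / (8 * C ^+ 2) by field; lra.
  have h4 : Q / (33 * C ^+ 2) <= Q / (8 * C ^+ 2).
    rewrite ler_pM2l// lef_pV2 ?posrE ?mulr_gt0 ?exprn_gt0//.
    by rewrite ler_pM2r ?exprn_gt0//; lra.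
  lra.
have hi : A * C + C <= 33 * C ^+ 2 * Q.
  have h1 : A * C <= 32 * Q * C by rewrite ler_pM2r.
  have h2 : C <= C * Q by rewrite ler_peMr//; lra.
  have h3 : C * Q <= C ^+ 2 * Q by rewrite ler_pM2r// -{1}(expr1 C) ler_weXn2l.
  lra.
have A0 : 0 <= A by apply: le_trans QA; rewrite divr_ge0// ?mulr_ge0// ltW.
have F1E x y : e%:~R * dual_form1 f1 l1 a x - e%:~R * dual_form1 f1 l1 a y
    = A * (f1 x - f1 y) + e%:~R * (l1 x - l1 y) by rewrite /dual_form1 /A; ring.
have FE x y : e%:~R * dual_form f l a y - (e%:~R * dual_form f l a x
      + e%:~R * dual_form1 f1 l1 a x * (y - x))
    = A * (f y - f x - f1 x * (y - x)) + e%:~R * (l y - l x - l1 x * (y - x)).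
  by rewrite /dual_form /dual_form1 /A; ring.
clearbody A; have rem (r K : R) : `|r| <= K -> - K <= e%:~R * r <= K.
  by move=> rK; rewrite -ler_norml normrM e2 mul1r.
split=> x y Jx Jy.
- rewrite F1E; have [->|xy] := eqVneq x y; first by rewrite subrr normr0 mulr0.
  have xy0 : 0 < `|x - y| by rewrite normr_gt0 subr_eq0.
  rewrite -(ler_pM2r xy0) -[leRHS]normrM; apply: le_trans (ler_norm _).
  have sq : `|x - y| * `|x - y| = (x - y) ^+ 2 by rewrite -normrM -expr2 ger0_norm ?sqr_ge0.
  rewrite -[leLHS]mulrA sq [leRHS]mulrDl.
  have h1 : (A / C) * (x - y) ^+ 2 <= A * (f1 x - f1 y) * (x - y).
    have -> : (A / C) * (x - y) ^+ 2 = A * ((x - y) ^+ 2 / C) by ring.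
    by rewrite -[leRHS]mulrA; exact: ler_wpM2l A0 _ _ (cb_f1incr cb Jx Jy).
  have /rem /andP[h2 _] : `|(l1 x - l1 y) * (x - y)| <= C * (x - y) ^+ 2.
    by rewrite normrM -sq mulrA ler_wpM2r//; exact: cb_l1lip cb _ _ Jx Jy.
  have h3 : Q / (33 * C ^+ 2) * (x - y) ^+ 2 <= (A / C - C) * (x - y) ^+ 2.
    by rewrite ler_wpM2r// sqr_ge0.
  lra.
- rewrite F1E; apply: le_trans (ler_normD _ _) _; rewrite !normrM e2 mul1r (ger0_norm A0).
  have h1 := ler_wpM2l A0 (cb_f1lip cb Jx Jy); have h2 := cb_l1lip cb Jx Jy.
  have h3 := ler_wpM2r (normr_ge0 (x - y)) hi; lra.
- have := FE x y; have h1 := ler_wpM2l A0 (cb_fge cb Jx Jy).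
  have /rem /andP[h2 _] := cb_lrem cb Jx Jy.
  have h3 := ler_wpM2r (sqr_ge0 (y - x)) lo; lra.
- have := FE x y; have h1 := ler_wpM2l A0 (cb_fle cb Jx Jy).
  have /rem /andP[_ h2] := cb_lrem cb Jx Jy.
  have h3 := ler_wpM2r (sqr_ge0 (y - x)) hi; lra.
Qed.

(** If two indices differ by more than [2 * g], every other index is within [g] of one of them; if
    not, all lie within [2 * g] of each other. So there are at most two clusters, each with at most
    [4 * g + 1] indices. *)
Lemma scover_gap (R : realType) (s : R) (T : Type) (P : T -> R -> Prop) (idx : T -> int)
    (g k : R) : 0 < s -> 0 <= g -> 0 <= k ->
    (forall t1 t2 t3 x1 x2 x3, P t1 x1 -> P t2 x2 -> P t3 x3 ->
       idx t1 < idx t2 -> idx t2 < idx t3 ->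
       (idx t2 - idx t1)%:~R <= g \/ (idx t3 - idx t2)%:~R <= g) ->
    (forall z, scover s [set x | exists2 t, P t x & idx t = z] k) ->
  scover s [set x | exists t, P t x] (2 * ((4 * g + 1) * k)).
Proof.
move=> s0 g0 k0 gap Pk.
have gk0 : 0 <= (4 * g + 1) * k by rewrite mulr_ge0//; lra.
have cluster (z : int) : scover s
    [set x | exists t, P t x /\ `|(idx t - z)%:~R| <= g] ((4 * g + 1) * k).
  have -> : 4 * g + 1 = 2 * (2 * g) + 1 by ring.
  apply: (@scover_fiber _ _ s0 _ (fun t x => P t x /\ `|(idx t - z)%:~R| <= g) idx) => //.
  - lra.
  - move=> t t' x x' [_ h] [_ h'].
    have -> : idx t - idx t' = (idx t - z) - (idx t' - z) by ring.
    by rewrite rmorphB /=; apply: le_trans (ler_normB _ _) _; lra.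
  - by move=> z'; apply: scover_sub (Pk z') => x [t [Pt _] <-]; exists t.
have [[t [t' [x [x' [Pt Pt' far]]]]]|near_] := pselect (exists t t' x x',
    [/\ P t x, P t' x' & 2 * g < (idx t' - idx t)%:~R]).
- rewrite mulrDl mul1r.
  apply: scover_sub (scoverU s0 (cluster (idx t)) (cluster (idx t'))) => y [r Pr].
  have tt' : idx t < idx t'.
    by rewrite -subr_gt0 -(ltr0z R); lra.
  have absz_le (z z' : int) : z <= z' -> (z' - z)%:~R <= g -> `|(z - z')%:~R| <= g.
    by move=> zz' h; rewrite -opprB rmorphN normrN ger0_norm// ler0z subr_ge0.
  have absz_le' (z z' : int) : z <= z' -> (z' - z)%:~R <= g -> `|(z' - z)%:~R| <= g.
    by move=> zz' h; rewrite ger0_norm// ler0z subr_ge0.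
  have [rt|tr|rt] := ltgtP (idx r) (idx t).
  + have [h|h] := gap _ _ _ _ _ _ Pr Pt Pt' rt tt'; last by exfalso; lra.
    by left; exists r; split=> //; apply: absz_le => //; exact: ltW.
  + have [rt'|tr'|rt'] := ltgtP (idx r) (idx t').
    * have [h|h] := gap _ _ _ _ _ _ Pt Pr Pt' tr rt'.
        by left; exists r; split=> //; apply: absz_le' => //; exact: ltW.
      by right; exists r; split=> //; apply: absz_le => //; exact: ltW.
    * have [h|h] := gap _ _ _ _ _ _ Pt Pt' Pr tt' tr'; first by exfalso; lra.
      by right; exists r; split=> //; apply: absz_le' => //; exact: ltW.
    * by right; exists r; split=> //; rewrite rt' subrr normr0.
  + by left; exists r; split=> //; rewrite rt subrr normr0.
apply: (@scover_le _ _ _ ((2 * (2 * g) + 1) * k)); first by lra.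
apply: (@scover_fiber _ _ s0 _ P idx) => //; first lra.
move=> t t' x x' Pt Pt'; rewrite leNgt; apply/negP => h; apply: near_.
have [z0|z0] := leP 0 (idx t - idx t').
  by exists t', t, x', x; split=> //; move: h; rewrite ger0_norm// ler0z.
exists t, t', x, x'; split=> //; move: h; rewrite ltr0_norm ?ltrz0//.
by rewrite -rmorphN /= opprB.
Qed.

(** * Forms attached to one direction *)

Section FixedDirection.
Context {R : realType}.
Variables (s : R) (J : set R) (C : R) (f f1 l l1 : R -> R).
Hypothesis s_gt0 : 0 < s.
Hypothesis cb : curve_bounds J C f f1 l l1.
Variables (Q B M psi : R) (e : int).
Let D : R := 33 * C ^+ 2.
Hypothesis CQ : 8 * C ^+ 3 <= Q.
Hypothesis B1 : 1 <= B.
Hypothesis M01 : 0 < M <= 1.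
Hypothesis psiB : 0 <= psi <= B * M ^+ 2 / Q.
Hypothesis e1 : e = 1 \/ e = -1.
Variable T : int * int * int -> R -> Prop.
Hypothesis TP : forall a x, T a x -> [/\ J x, Q / (4 * C) <= (e * a.2)%:~R <= 32 * Q,
  `|dual_form f l a x| <= psi & `|dual_form1 f1 l1 a x| <= M].
Variable k : R.
Hypothesis Tk : forall a, scover s [set x | T a x] k.
Variables (b1 b2 u v : int).
Hypothesis bezout : u * b1 + v * b2 = 1.
Hypothesis b2_ge1 : 1 <= b2.
Variables (tm tp : R).
Hypothesis tp_ge0 : 0 <= tp.
Hypothesis Tg : forall a x, T a x -> tm <= `|b2%:~R * f1 x + b1%:~R| <= tp.

Let k0 : 0 <= k. Proof. exact: scover_ge0 (Tk (0, 0, 0)). Qed.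
Let C1 : 1 <= C. Proof. exact: cb_ge1 cb. Qed.
Let D1 : 1 <= D.
Proof.
have : 1 <= C ^+ 2 by rewrite exprn_ege1.
rewrite /D; lra.
Qed.
Let Q1 : 1 <= Q.
Proof.
have : 1 <= C ^+ 3 by rewrite exprn_ege1.
by move: CQ; lra.
Qed.
Let M0 : 0 < M. Proof. by case/andP: M01. Qed.
Let M1 : M <= 1. Proof. by case/andP: M01. Qed.
Let norme : `|e%:~R| = 1 :> R.
Proof. by case: e1 => ->; rewrite ?normrN normr1. Qed.
Let b2R : 1 <= b2%:~R :> R. Proof. by rewrite -[1]/(1%:~R) ler_int. Qed.

Let consts : [/\ 1 <= B, 1 <= C, 1 <= D & 1 <= Q] /\ (0 < M /\ M <= 1).
Proof. by split; [split|]. Qed.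

Let TC a x : T a x -> convex_pair J Q D (fun x => e%:~R * dual_form f l a x)
    (fun x => e%:~R * dual_form1 f1 l1 a x).
Proof. by case/TP => _ + _ _; exact: dual_form_convex. Qed.

(* [a0] is determined by [(a1, a2)] up to a bounded error: nearly tangent forms
   with the same [(a1, a2)] are small only near their common critical point. *)
Lemma fixed_coefficients (c1 c2 : int) :
  scover s [set x | exists a0, T (a0, c1, c2) x] ((2 * (2 * B + 6 * D ^+ 3) + 1) * k).
Proof.
have [[B1' C1' D1' Q1'] [M0' M1']] := consts.
have B0 : 0 <= 2 * B + 6 * D ^+ 3.
  have : 0 <= D ^+ 3 by rewrite exprn_ge0//; lra.
  lra.
apply: (@scover_fiber _ _ s_gt0 _ (fun a0 x => T (a0, c1, c2) x) id) => //; last first.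
  by move=> z; apply: scover_sub (Tk (z, c1, c2)) => x [t Tt] <-.
move=> a a' x x' Tx Tx'.
have [Jx _ Fx F1x] := TP Tx; have [Jx' _ Fx' F1x'] := TP Tx'.
have cp := TC Tx; case/andP: psiB => psi0 psiB'.
set d := `|x' - x|; have d0 : 0 <= d by exact: normr_ge0.
have M2 : M ^+ 2 / Q <= 1.
  by rewrite ler_pdivrMr ?mul1r; [|lra]; apply: le_trans Q1; rewrite expr_le1 ?(ltW M0).
have M20 : 0 <= M ^+ 2 / Q by rewrite divr_ge0 ?sqr_ge0//; lra.
have psib : psi <= B by apply: le_trans psiB' _; rewrite -mulrA ler_piMr//; lra.
have F1E : dual_form1 f1 l1 (a', c1, c2) x' = dual_form1 f1 l1 (a, c1, c2) x' by [].
rewrite F1E in F1x'.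
have dle : d <= 2 * D * M / Q.
  have := cp_incr cp Jx' Jx; rewrite -mulrBr normrM norme mul1r -/d => h.
  have h2 : Q / D * d <= 2 * M.
    by apply: le_trans h _; apply: le_trans (ler_normB _ _) _; lra.
  have -> : 2 * D * M / Q = D / Q * (2 * M) by ring.
  have -> : d = D / Q * (Q / D * d) by field; lra.
  by rewrite ler_wpM2l// divr_ge0//; lra.
have d2 : (x' - x) ^+ 2 = d ^+ 2 by rewrite /d real_normK ?num_real.
have h1 : `|dual_form f l (a, c1, c2) x' - dual_form f l (a, c1, c2) x| <= 6 * D ^+ 3.
  have lin : `|dual_form1 f1 l1 (a, c1, c2) x * (x' - x)| <= 2 * D * (M ^+ 2 / Q).
    rewrite normrM -/d (_ : 2 * D * _ = M * (2 * D * M / Q)); last by ring.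
    by apply: ler_pM.
  have quad : D * Q * d ^+ 2 <= 4 * D ^+ 3 * (M ^+ 2 / Q).
    have -> : 4 * D ^+ 3 * (M ^+ 2 / Q) = D * Q * (2 * D * M / Q) ^+ 2 by field; lra.
    apply: ler_wpM2l; first by apply: mulr_ge0; lra.
    by rewrite ler_sqr ?nnegrE// (le_trans d0 dle).
  have q0 : 0 <= Q / D * d ^+ 2 by rewrite mulr_ge0 ?sqr_ge0// divr_ge0//; lra.
  have D3 : D <= D ^+ 3 by rewrite -{1}(expr1 D) ler_weXn2l.
  have D30 : 0 <= D ^+ 3 by lra.
  have m1 : 2 * D * (M ^+ 2 / Q) <= 2 * D ^+ 3.
    by apply: (@le_trans _ _ (2 * D)); [apply: ler_piMr; lra|lra].
  have m2 : 4 * D ^+ 3 * (M ^+ 2 / Q) <= 4 * D ^+ 3 by apply: ler_piMr; lra.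
  have := cp_ge cp Jx Jx'; have := cp_le cp Jx Jx'; rewrite d2 /= => hi lo.
  have eE (p r : R) : `|p - r| = `|e%:~R * p - e%:~R * r|.
    by rewrite -mulrBr normrM norme mul1r.
  rewrite eE; have lin' : `|e%:~R * dual_form1 f1 l1 (a, c1, c2) x * (x' - x)| <= 2 * D ^+ 3.
    by rewrite -mulrA normrM norme mul1r; lra.
  move: lin'; rewrite !ler_norml => /andP[? ?]; apply/andP; split; lra.
have -> : (a - a')%:~R = dual_form f l (a, c1, c2) x' - dual_form f l (a, c1, c2) x
   + dual_form f l (a, c1, c2) x - dual_form f l (a', c1, c2) x' :> R.
  by rewrite rmorphB /= /dual_form/=; ring.
apply: le_trans (ler_normB _ _) _; apply: le_trans (lerD (ler_normD _ _) (lexx _)) _.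
lra.
Qed.

Let line (a : int * int * int) : int := a.1.2 * b2 - a.2 * b1.

(* [line a = b2 F' - a2 (b2 f' + b1) - b2 l'], where the first two terms are
   small and the last varies little since [f'] is within [tp / b2] of [- b1 / b2]. *)
Lemma line_spread a a' x x' : T a x -> T a' x' ->
  `|(line a - line a')%:~R| <= 2 * b2%:~R * M + (64 * Q + 2 * C ^+ 2) * tp :> R.
Proof.
have [[B1' C1' D1' Q1'] [M0' M1']] := consts; have b2R' := b2R.
move=> Tx Tx'; have [Jx ax _ F1x] := TP Tx; have [Jx' ax' _ F1x'] := TP Tx'.
have /andP[_ gx] := Tg Tx; have /andP[_ gx'] := Tg Tx'.
have tp0 : 0 <= tp by apply: le_trans gx.
have C0 : 0 < C by lra.
have b20 : 0 <= b2%:~R :> R by lra.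
have lx : b2%:~R * `|l1 x - l1 x'| <= 2 * C ^+ 2 * tp.
  have h1 : `|x - x'| <= C * `|f1 x - f1 x'|.
    have [->|xx] := eqVneq x x'; first by rewrite !subrr normr0 mulr0.
    have xy0 : 0 < `|x - x'| by rewrite normr_gt0 subr_eq0.
    have sq : `|x - x'| * `|x - x'| = (x - x') ^+ 2 by rewrite -normrM -expr2 ger0_norm ?sqr_ge0.
    rewrite -(ler_pM2r xy0) sq -[leRHS]mulrA -normrM -ler_pdivrMl// mulrC.
    by apply: le_trans (ler_norm _); exact: cb_f1incr cb _ _ Jx Jx'.
  have h2 : b2%:~R * `|f1 x - f1 x'| <= 2 * tp.
    rewrite -{1}(ger0_norm b20) -normrM (_ : b2%:~R * (f1 x - f1 x')
      = (b2%:~R * f1 x + b1%:~R) - (b2%:~R * f1 x' + b1%:~R)); last by ring.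
    by apply: le_trans (ler_normB _ _) _; lra.
  have h3 := cb_l1lip cb Jx Jx'.
  have h4 : b2%:~R * `|l1 x - l1 x'| <= C ^+ 2 * (b2%:~R * `|f1 x - f1 x'|).
    rewrite mulrCA ler_pM2l; last lra.
    by apply: le_trans h3 _; rewrite expr2 -mulrA ler_pM2l.
  have h5 := ler_wpM2l (sqr_ge0 C) h2; lra.
have A a2 (y : R) : Q / (4 * C) <= (e * a2)%:~R <= 32 * Q -> `|y| <= tp ->
    `|a2%:~R * y| <= 32 * Q * tp.
  move=> /andP[h1 h2] yt; rewrite normrM; apply: ler_pM => //.
  have -> : `|a2%:~R| = `|(e * a2)%:~R| :> R by rewrite intrM normrM norme mul1r.
  rewrite ger0_norm//.
  by apply: le_trans h1; rewrite divr_ge0//; lra.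
have lE c y : (line c)%:~R = b2%:~R * dual_form1 f1 l1 c y
   - c.2%:~R * (b2%:~R * f1 y + b1%:~R) - b2%:~R * l1 y.
  by rewrite /line /dual_form1 rmorphB /= !rmorphM /=; ring.
have -> : (line a - line a')%:~R = (b2%:~R * dual_form1 f1 l1 a x - b2%:~R * dual_form1 f1 l1 a' x')
   - (a.2%:~R * (b2%:~R * f1 x + b1%:~R) - a'.2%:~R * (b2%:~R * f1 x' + b1%:~R))
   - b2%:~R * (l1 x - l1 x').
  by rewrite rmorphB /= (lE a x) (lE a' x'); ring.
have bM c y : `|dual_form1 f1 l1 c y| <= M -> `|b2%:~R * dual_form1 f1 l1 c y| <= b2%:~R * M.
  by move=> h; rewrite normrM (ger0_norm b20) ler_wpM2l.
apply: le_trans (ler_normB _ _) _; apply: le_trans (lerD (ler_normB _ _) (lexx _)) _.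
have := ler_normB (b2%:~R * dual_form1 f1 l1 a x) (b2%:~R * dual_form1 f1 l1 a' x').
have := ler_normB (a.2%:~R * (b2%:~R * f1 x + b1%:~R)) (a'.2%:~R * (b2%:~R * f1 x' + b1%:~R)).
have := bM _ _ F1x; have := bM _ _ F1x'; have := A _ _ ax gx; have := A _ _ ax' gx'.
rewrite [`|b2%:~R * (l1 x - l1 x')|]normrM (ger0_norm b20); lra.
Qed.

Let step (c a : int * int * int) : int := u * (a.1.2 - c.1.2) + v * (a.2 - c.2).

(** Primitivity enters here: the determinant [line] labels the cosets of the multiples of [b], and
    the Bezout coefficients read off the integer position on a coset. *)
Lemma on_line c a : line a = line c ->
  a.1.2 = c.1.2 + step c a * b1 /\ a.2 = c.2 + step c a * b2.
Proof.
rewrite /line /step => E.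
move: E bezout; set A := a.1.2; set A' := a.2; set c1 := c.1.2; set c2 := c.2 => E bz.
have E' : (A - c1) * b2 = (A' - c2) * b1 by clear -E; rewrite !mulrBl; lia.
split.
- have -> : (u * (A - c1) + v * (A' - c2)) * b1
    = u * b1 * (A - c1) + v * ((A' - c2) * b1) by ring.
  rewrite -E' (_ : _ + _ = (u * b1 + v * b2) * (A - c1)); last by ring.
  by rewrite bz mul1r addrC subrK.
- have -> : (u * (A - c1) + v * (A' - c2)) * b2
    = u * ((A - c1) * b2) + v * b2 * (A' - c2) by ring.
  rewrite E' (_ : _ + _ = (u * b1 + v * b2) * (A' - c2)); last by ring.
  by rewrite bz mul1r addrC subrK.
Qed.

Let k1 : R := (2 * (2 * B + 6 * D ^+ 3) + 1) * k.

Let k1_ge0 : 0 <= k1.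
Proof. exact: scover_ge0 (fixed_coefficients 0 0). Qed.

Let fixed_step c z : scover s [set x | exists2 a, T a x /\ line a = line c & step c a = z] k1.
Proof.
apply: scover_sub (fixed_coefficients (c.1.2 + z * b1) (c.2 + z * b2)) => x.
move=> [a [Ta /on_line[E E']] <-]; exists a.1.1; rewrite -E -E'.
by move: Ta; case: a {E E'} => [[]].
Qed.

(** One step along the line changes [a2] by [b2], while [e * a2] stays in an interval of length at
    most [32 * Q]. *)
Let step_spread c a a' x x' : T a x -> T a' x' -> line a = line c -> line a' = line c ->
  `|(step c a - step c a')%:~R| <= 32 * Q / b2%:~R :> R.
Proof.
have [[B1' C1' D1' Q1'] [M0' M1']] := consts; have b2R' := b2R.
move=> Ta Ta' /on_line[_ E] /on_line[_ E'].
have [_ /andP[h1 h2] _ _] := TP Ta; have [_ /andP[h1' h2'] _ _] := TP Ta'.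
rewrite ler_pdivlMr; last lra.
have -> : b2%:~R = `|b2%:~R| :> R by rewrite ger0_norm//; lra.
rewrite -normrM -intrM (_ : (_ - _) * b2 = a.2 - a'.2); last by rewrite E E'; ring.
have -> : `|(a.2 - a'.2)%:~R| = `|(e * a.2)%:~R - (e * a'.2)%:~R| :> R.
  by rewrite !intrM -mulrBr normrM norme mul1r intrB.
have : 0 <= Q / (4 * C) by rewrite divr_ge0//; lra.
by move=> ?; rewrite ler_norml; apply/andP; split; lra.
Qed.

Let line_factor_ge0 : 0 <= 2 * (2 * b2%:~R * M + (64 * Q + 2 * C ^+ 2) * tp) + 1.
Proof.
have [[B1' C1' D1' Q1'] [M0' M1']] := consts; have b2R' := b2R.
have h1 : 0 <= b2%:~R * M by rewrite mulr_ge0//; lra.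
have h2 : 0 <= Q * tp by rewrite mulr_ge0//; lra.
have h3 : 0 <= C ^+ 2 * tp by rewrite mulr_ge0// sqr_ge0.
lra.
Qed.

(** Every place on every line is paid for. This is affordable when [tp] is so small that few lines
    occur, namely when [Q * tp] is of the order of [b2 * M + 1]. *)
Lemma direction_cover_small :
  scover s [set x | exists a, T a x]
    ((2 * (2 * b2%:~R * M + (64 * Q + 2 * C ^+ 2) * tp) + 1) *
     ((2 * (32 * Q / b2%:~R) + 1) * k1)).
Proof.
have [[B1' C1' D1' Q1'] [M0' M1']] := consts; have b2R' := b2R.
have V0 : 0 <= 32 * Q / b2%:~R by rewrite divr_ge0//; lra.
have V1 : 0 <= (2 * (32 * Q / b2%:~R) + 1) * k1 by rewrite mulr_ge0//; lra.
have [[x0 [c Tc]]|nP] := pselect (exists x a, T a x); last first.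
  apply: scover_sub (scover0 s_gt0 _) => [x [t Pt]|]; first by apply: nP; exists x, t.
  by apply: mulr_ge0 => //; exact: line_factor_ge0.
apply: (@scover_fiber _ _ s_gt0 _ T line) => //.
- by apply: le_trans (line_spread Tc Tc).
- exact: line_spread.
move=> z.
have [[y0 [c' [Tc' E]]]|nP] := pselect (exists x a, T a x /\ line a = z); last first.
  by apply: scover_sub (scover0 s_gt0 V1) => x [t Pt E]; apply: nP; exists x, t.
rewrite -E; apply: scover_sub (@scover_fiber _ _ s_gt0 _
  (fun a x => T a x /\ line a = line c') (step c') _ _ V0 k1_ge0 _ (fixed_step c')).
  by move=> x [t Tt Et]; exists t.
by move=> t t' x x' [Tt Et] [Tt' Et']; exact: step_spread Tt Tt' Et Et'.
Qed.

Variable K : R.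
Hypothesis K0 : 0 < K.
Hypothesis Ksmall : K * (2 * psi + 2 * D ^+ 3 * (2 * M + K * tp) ^+ 2 / Q) < 1.
Hypothesis tm0 : 0 < tm.
Let g : R := (2 + D * (4 * D * (1 + (4 * B + D)))) * M / tm.

(** Steps with the same [floor (step / K)] differ by less than [K], so [three_points] applies to any
    three forms of the block and bounds the smaller of two gaps by [g], which is the hypothesis of
    [scover_gap]. *)
Let block_cover c m : scover s
  [set x | exists a, (T a x /\ line a = line c) /\ Num.floor ((step c a)%:~R / K) = m]
  (2 * ((4 * g + 1) * k1)).
Proof.
have [[B1' C1' D1' Q1'] [M0' M1']] := consts; have tm0' := tm0.
have g0 : 0 <= g.
  by rewrite /g divr_ge0 ?(ltW tm0)// mulr_ge0// ?(ltW M0)// addr_ge0// !mulr_ge0//; lra.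
apply: (@scover_gap _ _ _ (fun a x => (T a x /\ line a = line c) /\
   Num.floor ((step c a)%:~R / K) = m) (step c)) => //; last first.
  by move=> z; apply: scover_sub (fixed_step c z) => x [a [Ta _] <-]; exists a.
move=> a1 a2 a3 x1 x2 x3 [[T1 L1] m1] [[T2 L2] m2] [[T3 L3] m3] s12 s23.
have [J1 _ w1 v1] := TP T1; have [J2 _ w2 v2] := TP T2; have [J3 _ w3 v3] := TP T3.
have [E1 E1'] := on_line L1; have [E2 E2'] := on_line L2; have [E3 E3'] := on_line L3.
have eN (y : R) : `|e%:~R * y| = `|y| by rewrite normrM norme mul1r.
case/andP: (psiB) => psi0 psiB'.
set p : R := (step c a2 - step c a1)%:~R; set q : R := (step c a3 - step c a2)%:~R.
have p0 : 0 < p by rewrite ltr0z subr_gt0.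
have q0 : 0 < q by rewrite ltr0z subr_gt0.
have pqK : p + q <= K.
  have -> : p + q = (step c a3)%:~R - (step c a1)%:~R by rewrite /p /q !rmorphB /=; ring.
  have f1_ : m%:~R * K <= (step c a1)%:~R by rewrite -ler_pdivlMr// -m1 floor_le.
  have f3_ : (step c a3)%:~R < (m + 1)%:~R * K.
    by rewrite -ltr_pdivrMr// -m3 floorD1_gt.
  by move: f3_; rewrite intrD mulrDl; lra.
(* The integer supplied is [e] times the weighted second difference of the [a0]: along the line [a1]
   and [a2] are affine in the step, and [l] occurs with total weight 0. *)
have tri : Num.min p q * tm <= (2 + D * (4 * D * (1 + (4 * B + D)))) * M.
  apply: (@three_points _ J Q D B M psi K tm tp
    (fun x => e%:~R * dual_form f l a1 x) (fun x => e%:~R * dual_form1 f1 l1 a1 x)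
    (fun x => e%:~R * dual_form f l a2 x) (fun x => e%:~R * dual_form1 f1 l1 a2 x)
    (fun x => e%:~R * dual_form f l a3 x) (fun x => e%:~R * dual_form1 f1 l1 a3 x)
    x1 x2 x3 p q (e%:~R * (b2%:~R * f1 x2 + b1%:~R))
    (e * ((step c a3 - step c a2) * a1.1.1 - (step c a3 - step c a1) * a2.1.1
      + (step c a2 - step c a1) * a3.1.1))) => //; rewrite ?eN//.
  - lra.
  - lra.
  - exact: TC T1.
  - exact: TC T2.
  - exact: TC T3.
  - exact: Tg T2.
  - by rewrite /dual_form1 E1 E1' E2 E2' /p; ring.
  - by rewrite /dual_form1 E3 E3' E2 E2' /q; ring.
  - by rewrite /dual_form E1 E1' E2 E2' E3 E3' /p /q; ring.
move: tri; rewrite -ler_pdivlMr// -/g ge_min => /orP[|] h; [by left|by right].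
Qed.

(** The factors are the number of lines, the number of blocks on a line, the two clusters in a
    block, and, inside [k1], the values of [a0] for given [(a1, a2)]. *)
Lemma direction_cover :
  scover s [set x | exists a, T a x]
    ((2 * (2 * b2%:~R * M + (64 * Q + 2 * C ^+ 2) * tp) + 1) *
     ((2 * (32 * Q / b2%:~R / K + 1) + 1) * (2 * ((4 * g + 1) * k1)))).
Proof.
have [[B1' C1' D1' Q1'] [M0' M1']] := consts; have b2R' := b2R; have K0' := K0.
have V0 : 0 <= 32 * Q / b2%:~R / K + 1 by rewrite addr_ge0// !divr_ge0//; lra.
have k2 : 0 <= 2 * ((4 * g + 1) * k1) by exact: scover_ge0 (block_cover (0, 0, 0) 0).
have V1 : 0 <= (2 * (32 * Q / b2%:~R / K + 1) + 1) * (2 * ((4 * g + 1) * k1)).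
  by rewrite mulr_ge0//; lra.
have [[x0 [c Tc]]|nP] := pselect (exists x a, T a x); last first.
  apply: scover_sub (scover0 s_gt0 _) => [x [t Pt]|]; first by apply: nP; exists x, t.
  by apply: mulr_ge0 => //; exact: line_factor_ge0.
apply: (@scover_fiber _ _ s_gt0 _ T line) => //.
- by apply: le_trans (line_spread Tc Tc).
- exact: line_spread.
move=> z.
have [[y0 [c' [Tc' E]]]|nP] := pselect (exists x a, T a x /\ line a = z); last first.
  by apply: scover_sub (scover0 s_gt0 V1) => x [t Pt E]; apply: nP; exists x, t.
rewrite -E; apply: scover_sub (@scover_fiber _ _ s_gt0 _
  (fun a x => T a x /\ line a = line c') (fun a => Num.floor ((step c' a)%:~R / K))
  _ _ V0 k2 _ _).
- by move=> x [t Tt Et]; exists t.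
- move=> t t' x x' [Tt Et] [Tt' Et'].
  have h := step_spread Tt Tt' Et Et'.
  have {}h : `|(step c' t)%:~R / K - (step c' t')%:~R / K| <= 32 * Q / b2%:~R / K.
    have iK : 0 < K^-1 by rewrite invr_gt0.
    by rewrite -mulrBl -intrB normrM (ger0_norm (ltW iK)) ler_pM2r.
  move: h; set y := _ / K; set y' := (step c' t')%:~R / K => h.
  rewrite /= -/y -/y' intrB.
  have := floor_le y; have := floorD1_gt y; have := floor_le y'; have := floorD1_gt y'.
  move: h; rewrite !intrD !ler_norml => /andP[? ?] ? ? ? ?.
  by apply/andP; split; lra.
- by move=> m; apply: scover_sub (block_cover c' m) => x [a [Ta Ea] Em]; exists a.
Qed.

End FixedDirection.

(** Pigeonhole on the fractional parts of [i * al] for [i <= N]. Dividing by the gcd keeps [b2] in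
    range and only shrinks the error. The Bezout coefficients are returned because they parametrise
    the lines. *)
Lemma dirichlet_primitive (R : realType) (al : R) (N : nat) : (0 < N)%N ->
  exists b1 b2 u v : int, [/\ 1 <= b2, b2 <= N%:Z, u * b1 + v * b2 = 1 &
    `|b2%:~R * al + b1%:~R| <= N%:R^-1].
Proof.
move=> N0.
pose y (i : nat) : R := i%:R * al - (Num.floor (i%:R * al))%:~R.
have y01 i : 0 <= y i < 1.
  have := floor_le (i%:R * al); have := floorD1_gt (i%:R * al).
  by rewrite intrD /y => ? ?; apply/andP; split; lra.
pose t i := Num.truncn (N%:R * y i).
have tP i : (t i)%:R <= N%:R * y i < (t i).+1%:R.
  by apply: truncn_itv; rewrite mulr_ge0//; case/andP: (y01 i).
have NR : 0 < N%:R :> R by rewrite ltr0n.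
have tN i : (t i < N)%N.
  rewrite -(ltr_nat R); case/andP: (tP i) => h _; apply: le_lt_trans h _.
  by rewrite gtr_pMr//; case/andP: (y01 i).
pose h (i : 'I_N.+1) : 'I_N := Ordinal (tN i).
have [i [j [ij hij]]] : exists i j : 'I_N.+1, (i < j)%N /\ h i = h j.
  have /injectivePn[i [j ij hij]] : ~~ injectiveb h.
    apply/negP => /injectiveP inj.
    by have := leq_card _ inj; rewrite !card_ord ltnn.
  case: (ltngtP i j) => [lij|lji|/val_inj E]; first by exists i, j.
    by exists j, i.
  by rewrite E eqxx in ij.
pose b2 : int := (j : nat)%:Z - (i : nat)%:Z.
pose b1 : int := Num.floor (i%:R * al) - Num.floor (j%:R * al).
have b20 : 1 <= b2 by rewrite /b2; lia.
have b2N : b2 <= N by rewrite /b2; have := ltn_ord j; lia.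
have bE : b2%:~R * al + b1%:~R = y j - y i.
  by rewrite /b2 /b1 !intrB /y; ring.
have bN : `|b2%:~R * al + b1%:~R| <= N%:R^-1.
  have tij : t i = t j by have := congr1 val hij.
  have := tP i; have := tP j; rewrite tij => /andP[h1 h2] /andP[h3 h4].
  rewrite bE -(ler_pM2l NR) mulfV ?gt_eqF// -{1}(ger0_norm (ltW NR)) -normrM ler_norml.
  by move: h2 h4; rewrite -natr1 => h2 h4; apply/andP; split; lra.
have [u [v uv]] := Bezoutz b1 b2.
set g := gcdz b1 b2 in uv.
have g0 : 0 < g.
  have gn0 : g != 0 by rewrite /g gcdz_eq0 negb_and; apply/orP; right; lia.
  by have : 0 <= g by []; lia.
have [c1 c1E] := dvdzP (dvdz_gcdl b1 b2); have [c2 c2E] := dvdzP (dvdz_gcdr b1 b2).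
rewrite -/g in c1E c2E.
exists c1, c2, u, v.
have c20 : 1 <= c2 by nia.
split=> //; first by nia.
  have E : (u * c1 + v * c2) * g = u * b1 + v * b2 by rewrite c1E c2E; ring.
  by apply: (@mulIf _ g); [lia|]; rewrite mul1r E uv.
apply: le_trans bN; rewrite c1E c2E !intrM.
have -> : c2%:~R * g%:~R * al + c1%:~R * g%:~R = g%:~R * (c2%:~R * al + c1%:~R) :> R by ring.
rewrite normrM; apply: ler_peMl => //.
by rewrite -intr_norm -[1]/(1%:~R) ler_int; lia.
Qed.

Lemma geometric_level (R : realType) (Y t y : R) (n : nat) : y <= t ->
  (exists2 j, (j < n)%N & t / Y ^+ j.+1 <= y <= t / Y ^+ j) \/ y <= t / Y ^+ n.
Proof.
move=> yt; elim: n => [|n [[j jn h]|h]]; first by right; rewrite expr0 divr1.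
  by left; exists j => //; exact: ltnW.
have [h'|h'] := leP (t / Y ^+ n.+1) y; last by right; exact: ltW.
by left; exists n => //; rewrite h' h.
Qed.

(** * Summation over all directions *)

Section Tangential.
Context {R : realType}.
Variables (s : R) (J : set R) (C : R) (f f1 l l1 : R -> R).
Hypothesis s_gt0 : 0 < s.
Hypothesis cb : curve_bounds J C f f1 l l1.
Variables (X B M psi : R) (N : nat) (e : int).
Hypothesis X_ge1 : 1 <= X.
Hypothesis NX : N%:R = X ^+ 2.
Let Q : R := X ^+ 5.
Let D : R := 33 * C ^+ 2.
Hypothesis CQ : 8 * C ^+ 3 <= Q.
Hypothesis B1 : 1 <= B.
Hypothesis M01 : 0 < M <= 1.
Hypothesis psiB : 0 <= psi <= B * M ^+ 2 / Q.
Hypothesis e1 : e = 1 \/ e = -1.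
Variable T : int * int * int -> R -> Prop.
Hypothesis TP : forall a x, T a x -> [/\ J x, Q / (4 * C) <= (e * a.2)%:~R <= 32 * Q,
  `|dual_form f l a x| <= psi & `|dual_form1 f1 l1 a x| <= M].
Variable k : R.
Hypothesis Tk : forall a, scover s [set x | T a x] k.

Let form (b1 b2 : int) (x : R) : R := `|b2%:~R * f1 x + b1%:~R|.

Let consts : [/\ 1 <= B, 1 <= C, 1 <= D & 1 <= Q] /\ [/\ 0 < M, M <= 1, 0 <= k & 1 <= X].
Proof.
have C1 := cb_ge1 cb; case/andP: M01 => M0 M1.
split; split=> //; last exact: scover_ge0 (Tk (0, 0, 0)).
  have : 1 <= C ^+ 2 by rewrite exprn_ege1.
  by rewrite /D; lra.
by rewrite exprn_ege1.
Qed.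

(** A cost proportional to [1 / b2] is the natural one: for given [b2], boundedness of [f1] leaves
    O([b2]) values of [b1], so each of the X^2 possible [b2] contributes O([Z]). *)
Lemma sum_directions (L : int -> int -> R -> Prop) (Z : R) : 0 <= Z ->
    (forall b1 b2 u v : int, 1 <= b2 -> b2 <= N%:Z -> u * b1 + v * b2 = 1 ->
      scover s [set x | exists a, [/\ T a x, form b1 b2 x <= 1 & L b1 b2 x]] (Z / b2%:~R)) ->
  scover s [set x | exists b : int * int, [/\ 1 <= b.2, b.2 <= N%:Z,
      exists u v : int, u * b.1 + v * b.2 = 1 & exists a, [/\ T a x, form b.1 b.2 x <= 1 & L b.1 b.2 x]]]
    (3 * X ^+ 2 * (9 * C * Z)).
Proof.
move=> Z0 LZ; have [[B1' C1' D1' Q1'] [M0' M1' k0' X1']] := consts.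
have CZ0 : 0 <= 9 * C * Z by rewrite !mulr_ge0//; lra.
have X2 : 1 <= X ^+ 2 by rewrite exprn_ege1.
apply: (@scover_le _ _ _ ((2 * X ^+ 2 + 1) * (9 * C * Z))).
  by rewrite ler_wpM2r//; lra.
apply: (@scover_fiber _ _ s_gt0 _ (fun (b : int * int) x => [/\ 1 <= b.2, b.2 <= N%:Z,
      exists u v : int, u * b.1 + v * b.2 = 1 & exists a, [/\ T a x, form b.1 b.2 x <= 1 & L b.1 b.2 x]])
    (fun b : int * int => b.2)) => //; first lra.
  move=> t t' x x' [h1 h2 _ _] [h3 h4 _ _]; rewrite /= -NX -intr_norm -[N%:R]/(N%:Z%:~R) ler_int.
  by clear -h1 h2 h3 h4; lia.
move=> b2.
have [b20|b20] := leP 1 b2; last first.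
  by apply: scover_sub (scover0 s_gt0 CZ0) => x [b [h _ _ _] E]; clear -h b20 E; lia.
have b2R : 1 <= b2%:~R :> R by rewrite -[1]/(1%:~R) ler_int.
have Zb0 : 0 <= Z / b2%:~R by rewrite divr_ge0//; lra.
apply: (@scover_le _ _ _ ((2 * (4 * C * b2%:~R) + 1) * (Z / b2%:~R))).
  have -> : 9 * C * Z = (9 * C * b2%:~R) * (Z / b2%:~R) by field; lra.
  rewrite ler_wpM2r//; nra.
apply: scover_sub (@scover_fiber _ _ s_gt0 _ (fun (b1 : int) x => [/\ b2 <= N%:Z,
      exists u v : int, u * b1 + v * b2 = 1 & exists a, [/\ T a x, form b1 b2 x <= 1 & L b1 b2 x]])
    id (4 * C * b2%:~R) (Z / b2%:~R) _ Zb0 _ _).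
- by move=> x [[b1 b2'] [h1 h2 h3 h4] /= E]; exists b1; rewrite -E.
- by rewrite !mulr_ge0//; lra.
- move=> b b' x x' [_ _ [a [Ta fa _]]] [_ _ [a' [Ta' fa' _]]].
  have [Jx _ _ _] := TP Ta; have [Jx' _ _ _] := TP Ta'.
  have -> : (b - b')%:~R = (b2%:~R * f1 x + b%:~R) - (b2%:~R * f1 x' + b'%:~R)
     - b2%:~R * (f1 x - f1 x') by rewrite intrB; ring.
  apply: le_trans (ler_normB _ _) _; apply: le_trans (lerD (ler_normB _ _) (lexx _)) _.
  have h : `|f1 x - f1 x'| <= 2 * C.
    by apply: le_trans (ler_normB _ _) _; have := cb_f1 cb Jx; have := cb_f1 cb Jx'; lra.
  rewrite [`|b2%:~R * (f1 x - f1 x')|]normrM (ger0_norm (le_trans ler01 b2R)).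
  have := ler_wpM2l (le_trans ler01 b2R) h.
  have : 1 <= C * b2%:~R by nra.
  by move: fa fa'; rewrite /form; lra.
move=> b1.
have [[u [v uv]]|nb] := pselect (exists u v : int, u * b1 + v * b2 = 1); last first.
  by apply: scover_sub (scover0 s_gt0 Zb0) => x [b [_ h _] E]; case: nb; rewrite -E.
have [b2N|b2N] := leP b2 N; last first.
  by apply: scover_sub (scover0 s_gt0 Zb0) => x [b [h _ _] E]; clear -h b2N; lia.
by apply: scover_sub (LZ b1 b2 u v b20 b2N uv) => x [b [_ _ h] <-].
Qed.

Let k1 : R := (2 * (2 * B + 6 * D ^+ 3) + 1) * k.

Let k1_ge0 : 0 <= k1.
Proof.
have [[B1' C1' D1' Q1'] [M0' M1' k0' X1']] := consts.
have : 0 <= D ^+ 3 by rewrite exprn_ge0//; lra.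
by move=> ?; rewrite /k1 mulr_ge0//; lra.
Qed.

Let b2N_le (b2 : int) : 1 <= b2 -> b2 <= N%:Z -> 1 <= (b2%:~R : R) <= X ^+ 2.
Proof.
by move=> h1 h2; rewrite -NX -[N%:R]/(N%:Z%:~R) ler_int h2 andbT -[1]/(1%:~R) ler_int.
Qed.

Lemma small_form_cover :
  scover s [set x | exists b : int * int, [/\ 1 <= b.2, b.2 <= N%:Z,
      exists u v : int, u * b.1 + v * b.2 = 1 & exists a, [/\ T a x, form b.1 b.2 x <= 1 &
        Q * form b.1 b.2 x <= b.2%:~R * M + 1]]]
    (3 * X ^+ 2 * (9 * C * (137 * C ^+ 2 * (X ^+ 2 * M + 1) * (65 * Q * k1)))).
Proof.
have [[B1' C1' D1' Q1'] [M0' M1' k0' X1']] := consts; have k10 := k1_ge0.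
have X2 : 1 <= X ^+ 2 by rewrite exprn_ege1.
have C20 : 1 <= C ^+ 2 by rewrite exprn_ege1.
have XM0 : 0 <= X ^+ 2 * M by rewrite mulr_ge0//; lra.
have Qk0 : 0 <= 65 * Q * k1 by apply: mulr_ge0 k10; lra.
apply: (@sum_directions (fun b1 b2 x => Q * form b1 b2 x <= b2%:~R * M + 1)).
  by apply: mulr_ge0 Qk0; apply: mulr_ge0; lra.
move=> b1 b2 u v b21 b2N uv; have /andP[b2R b2X] := b2N_le b21 b2N.
have bM0 : 0 <= b2%:~R * M by rewrite mulr_ge0//; lra.
set tp := (b2%:~R * M + 1) / Q.
have tp0 : 0 <= tp by rewrite divr_ge0//; lra.
have Qtp : Q * tp = b2%:~R * M + 1 by rewrite /tp; field; lra.
have := @direction_cover_small _ s J C f f1 l l1 s_gt0 cb Q B M psi e CQ B1 M01 psiB e1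
  (fun a x => [/\ T a x, form b1 b2 x <= 1 & Q * form b1 b2 x <= b2%:~R * M + 1]) _ k _
  b1 b2 u v uv b21 0 tp tp0 _.
move=> /(_ _ _ _) H; apply: scover_le (H _ _ _).
- clear H; rewrite -/D -/k1.
  have h1 : 2 * (2 * b2%:~R * M + (64 * Q + 2 * C ^+ 2) * tp) + 1 <= 137 * C ^+ 2 * (X ^+ 2 * M + 1).
    have tpQ : C ^+ 2 * tp <= C ^+ 2 * (b2%:~R * M + 1).
      by rewrite ler_wpM2l//; [lra|]; rewrite -Qtp ler_peMl.
    have bX : b2%:~R * M <= X ^+ 2 * M by rewrite ler_wpM2r//; lra.
    have t1 : b2%:~R * M + 1 <= C ^+ 2 * (X ^+ 2 * M + 1).
      by apply: (@le_trans _ _ (X ^+ 2 * M + 1)); [lra|]; rewrite ler_peMl//; lra.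
    have t2 : C ^+ 2 * (b2%:~R * M + 1) <= C ^+ 2 * (X ^+ 2 * M + 1) by rewrite ler_wpM2l//; lra.
    lra.
  have h2 : 2 * (32 * Q / b2%:~R) + 1 <= 65 * Q / b2%:~R.
    have -> : 65 * Q / b2%:~R = 2 * (32 * Q / b2%:~R) + Q / b2%:~R by ring.
    rewrite lerD2l ler_pdivlMr ?mul1r; [|lra].
    by apply: le_trans b2X _; rewrite ler_weXn2l.
  have -> : 137 * C ^+ 2 * (X ^+ 2 * M + 1) * (65 * Q * k1) / b2%:~R
    = 137 * C ^+ 2 * (X ^+ 2 * M + 1) * (65 * Q / b2%:~R * k1) by ring.
  apply: ler_pM => //.
  + have : 0 <= Q * tp by rewrite Qtp; lra.
    have : 0 <= C ^+ 2 * tp by rewrite mulr_ge0//; lra.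
    lra.
  + apply: mulr_ge0 k10; have : 0 <= Q / b2%:~R by rewrite divr_ge0//; lra.
    lra.
  + exact: ler_wpM2r k10 _ _ h2.
- by move=> a x [Ta _ _]; exact: TP.
- by move=> a; apply: scover_sub (Tk a) => x [].
- move=> a x [_ _ h]; rewrite normr_ge0 /=.
  by rewrite /tp ler_pdivlMr ?(mulrC _ Q)//; lra.
Qed.

(** Up to its constant, the longest admissible block. For [tp <= X^-2] the slope varies by
    [K * tp <= X] in a block, so the bound on the second difference is of order K X^2 / Q = K
    X^(-3); the denominator [64 * D ^+ 3 * B] brings it below 1. *)
Let K : R := X ^+ 3 / (64 * D ^+ 3 * B).
Let E0 : R := 2 + D * (4 * D * (1 + (4 * B + D))).

Let block_small tp : 0 <= tp -> tp * X ^+ 2 <= 1 ->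
  K * (2 * psi + 2 * D ^+ 3 * (2 * M + K * tp) ^+ 2 / Q) < 1.
Proof.
move=> tp0 tpX; have [[B1' C1' D1' Q1'] [M0' M1' k0' X1']] := consts.
case/andP: psiB => psi0 psiB'.
have D3 : 1 <= D ^+ 3 by rewrite exprn_ege1.
set kap := (64 * D ^+ 3 * B)^-1.
have BD0 : 1 <= D ^+ 3 * B by nra.
have kap0 : 0 < kap by rewrite invr_gt0; lra.
have kapE : 64 * (D ^+ 3 * B) * kap = 1 by rewrite /kap; field; lra.
have KE : K = kap * X ^+ 3 by rewrite /K mulrC.
have Xn n : 1 <= X ^+ n by rewrite exprn_ege1.
have X2 := Xn 2; have X3 := Xn 3.
have Ktp : K * tp <= X.
  rewrite KE (_ : _ * tp = kap * X * (tp * X ^+ 2)); last by ring.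
  have kap1 : kap <= 1 by nra.
  have : kap * X <= X by rewrite ler_piMl//; lra.
  have : 0 <= kap * X by rewrite mulr_ge0//; lra.
  have : 0 <= tp * X ^+ 2 by rewrite mulr_ge0//; lra.
  nra.
have Y2 : (2 * M + K * tp) ^+ 2 <= 9 * X ^+ 2.
  have -> : 9 * X ^+ 2 = (3 * X) ^+ 2 by ring.
  have : 0 <= K * tp by rewrite KE !mulr_ge0//; lra.
  by move=> ?; rewrite ler_sqr ?nnegrE; lra.
have KQ : K / Q * X ^+ 2 = kap by rewrite KE /Q; field; lra.
have Kpsi : K * psi <= kap * B.
  apply: (@le_trans _ _ (K * (B * 1 / Q))).
    have K0 : 0 <= K by rewrite KE mulr_ge0//; lra.
    apply: ler_wpM2l => //; apply: le_trans psiB' _.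
    rewrite ler_pM2r ?invr_gt0; last lra.
    by rewrite ler_pM2l; [rewrite expr_le1 ?(ltW M0')|lra].
  have -> : K * (B * 1 / Q) = kap * B / X ^+ 2 by rewrite -KQ; field; lra.
  by rewrite ler_pdivrMr ?ler_peMr//; [apply: mulr_ge0; lra|lra].
have KD : K * (2 * D ^+ 3 * (2 * M + K * tp) ^+ 2 / Q) <= 18 * (D ^+ 3 * kap).
  have -> : 18 * (D ^+ 3 * kap) = 2 * D ^+ 3 * (K / Q) * (9 * X ^+ 2) by rewrite -KQ; ring.
  rewrite (_ : K * _ = 2 * D ^+ 3 * (K / Q) * (2 * M + K * tp) ^+ 2); last by ring.
  apply: ler_wpM2l Y2; apply: mulr_ge0; first lra.
  by apply: divr_ge0; [rewrite KE; apply: mulr_ge0; lra|lra].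
rewrite mulrDr.
have b1 : kap * B <= D ^+ 3 * B * kap.
  by rewrite -mulrA mulrC ler_peMl// mulr_ge0//; lra.
have b2 : D ^+ 3 * kap <= D ^+ 3 * B * kap.
  by rewrite ler_pM2r// ler_peMr//; lra.
lra.
Qed.

(** Lines are counted by the upper end of the level, as [Q * tp], and the forms of a cluster by the
    lower end, as [M / (tp / Y) + 1]. The main part [Q * M * Y] of the product does not depend on
    the level, and the width of the level costs just the factor [Y]. *)
Lemma level_form_cover (tp Y : R) : 1 <= Y -> 0 < tp -> tp * X ^+ 2 <= 1 ->
  scover s [set x | exists b : int * int, [/\ 1 <= b.2, b.2 <= N%:Z,
      exists u v : int, u * b.1 + v * b.2 = 1 & exists a, [/\ T a x, form b.1 b.2 x <= 1 &
        (tp / Y <= form b.1 b.2 x <= tp) /\ b.2%:~R * M + 1 <= Q * form b.1 b.2 x]]]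
    (3 * X ^+ 2 * (9 * C * (137 * C ^+ 2 * (Q * tp) *
      ((64 * (64 * D ^+ 3 * B) + 3) * X ^+ 2 * (2 * ((4 * (E0 * M / (tp / Y)) + 1) * k1)))))).
Proof.
move=> Y1 tp0 tpX; have [[B1' C1' D1' Q1'] [M0' M1' k0' X1']] := consts; have k10 := k1_ge0.
have X2 : 1 <= X ^+ 2 by rewrite exprn_ege1.
have C20 : 1 <= C ^+ 2 by rewrite exprn_ege1.
have D3 : 1 <= D ^+ 3 by rewrite exprn_ege1.
have BD0 : 1 <= D ^+ 3 * B by nra.
have Y0 : 0 < Y by lra.
have tm0 : 0 < tp / Y by rewrite divr_gt0.
have E00 : 0 <= E0.
  by rewrite /E0 addr_ge0// mulr_ge0//; [lra|]; rewrite mulr_ge0//; lra.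
have g0 : 0 <= E0 * M / (tp / Y) by rewrite divr_ge0 ?(ltW tm0)// mulr_ge0//; lra.
have G0 : 0 <= 2 * ((4 * (E0 * M / (tp / Y)) + 1) * k1).
  by apply: mulr_ge0 => //; apply: mulr_ge0 k10; lra.
have Qtp0 : 0 <= Q * tp by apply: mulr_ge0; lra.
have K0 : 0 < K by rewrite /K divr_gt0// ?exprn_gt0//; lra.
apply: (@sum_directions (fun b1 b2 x => (tp / Y <= form b1 b2 x <= tp) /\
    b2%:~R * M + 1 <= Q * form b1 b2 x)).
  by apply: mulr_ge0; [|apply: mulr_ge0 G0]; apply: mulr_ge0; lra.
move=> b1 b2 u v b21 b2N uv; have /andP[b2R b2X] := b2N_le b21 b2N.
have bM0 : 0 <= b2%:~R * M by rewrite mulr_ge0//; lra.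
set Z := 137 * C ^+ 2 * (Q * tp) * _.
have Zb0 : 0 <= Z / b2%:~R.
  apply: divr_ge0; last lra.
  by apply: mulr_ge0; [|apply: mulr_ge0 G0]; apply: mulr_ge0; lra.
(* If [Q * tp] is below [b2 * M + 1], the two conditions on the form contradict each other and
   nothing is to be covered. If not, the term [b2 * M] in the number of lines is absorbed by
   [Q * tp]. *)
have [bQ|bQ] := leP (b2%:~R * M + 1) (Q * tp); last first.
  apply: scover_sub (scover0 s_gt0 Zb0) => x [a [_ _ [/andP[_ h] h']]].
  suff : Q * form b1 b2 x <= Q * tp by lra.
  by apply: ler_wpM2l h; lra.
have := @direction_cover _ s J C f f1 l l1 s_gt0 cb Q B M psi e CQ B1 M01 psiB e1
  (fun a x => [/\ T a x, form b1 b2 x <= 1 & (tp / Y <= form b1 b2 x <= tp) /\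
    b2%:~R * M + 1 <= Q * form b1 b2 x]) _ k _
  b1 b2 u v uv b21 (tp / Y) tp (ltW tp0) _ K K0 _ tm0.
move=> /(_ _ _ _ _) H; apply: scover_le (H _ _ _ _).
- clear H; rewrite -/D -/k1 -/E0.
  have h1 : 2 * (2 * b2%:~R * M + (64 * Q + 2 * C ^+ 2) * tp) + 1 <= 137 * C ^+ 2 * (Q * tp).
    have t1 : C ^+ 2 * tp <= C ^+ 2 * (Q * tp).
      by rewrite ler_wpM2l//; [lra|]; rewrite ler_peMl//; lra.
    have t2 : Q * tp <= C ^+ 2 * (Q * tp) by rewrite ler_peMl.
    lra.
  have h2 : 2 * (32 * Q / b2%:~R / K + 1) + 1 <= (64 * (64 * D ^+ 3 * B) + 3) * X ^+ 2 / b2%:~R.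
    have QK : Q / K = 64 * D ^+ 3 * B * X ^+ 2.
      have w0 : 0 < 64 * D ^+ 3 * B by lra.
      by rewrite /K /Q; move: (64 * D ^+ 3 * B) w0 => w w0; field; rewrite !gt_eqF//; lra.
    have -> : 32 * Q / b2%:~R / K = 32 * (64 * D ^+ 3 * B * X ^+ 2) / b2%:~R.
      by rewrite -QK; ring.
    have h3 : 3 <= 3 * X ^+ 2 / b2%:~R by rewrite ler_pdivlMr; lra.
    by rewrite (_ : _ * X ^+ 2 / _ = 64 * (64 * D ^+ 3 * B * X ^+ 2) / b2%:~R
      + 3 * X ^+ 2 / b2%:~R); [lra|ring].
  have -> : Z / b2%:~R = 137 * C ^+ 2 * (Q * tp) *
     ((64 * (64 * D ^+ 3 * B) + 3) * X ^+ 2 / b2%:~R *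
       (2 * ((4 * (E0 * M / (tp / Y)) + 1) * k1))) by rewrite /Z; ring.
  have Bk0 : 0 <= 2 * (32 * Q / b2%:~R / K + 1) + 1.
    have : 0 <= 32 * Q / b2%:~R / K.
      by apply: divr_ge0 (ltW K0); apply: divr_ge0; lra.
    lra.
  have L0 : 0 <= 2 * (2 * b2%:~R * M + (64 * Q + 2 * C ^+ 2) * tp) + 1.
    have : 0 <= C ^+ 2 * tp by apply: mulr_ge0; lra.
    lra.
  apply: ler_pM => //; first exact: mulr_ge0 Bk0 G0.
  exact: ler_wpM2r G0 _ _ h2.
- by move=> a x [Ta _ _]; exact: TP.
- by move=> a; apply: scover_sub (Tk a) => x [].
- by move=> a x [_ _ [h _]].
- exact: block_small (ltW tp0) tpX.
Qed.

Lemma tangential_cover (Y : R) : 1 <= Y -> Y ^+ 8 = X ->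
  scover s [set x | exists a, T a x]
   (200 * (137 * C ^+ 3 * 27 * (64 * (64 * D ^+ 3 * B) + 3) * 2 * (4 * E0 + 1) *
     (2 * (2 * B + 6 * D ^+ 3) + 1)) * (X ^+ 9 * M * Y + X ^+ 7) * k).
Proof.
move=> Y1 YX; have [[B1' C1' D1' Q1'] [M0' M1' k0' X1']] := consts; have k10 := k1_ge0.
set W := 64 * (64 * D ^+ 3 * B) + 3.
have Xn n : 1 <= X ^+ n by rewrite exprn_ege1.
have X2 := Xn 2; have X5 := Xn 5; have X7 := Xn 7; have X9 := Xn 9.
have Y0 : 0 < Y by lra.
have X0 : 0 < X by lra.
have W1 : 1 <= W.
  have D3 : 1 <= D ^+ 3 by rewrite exprn_ege1.
  have : 0 <= D ^+ 3 * B by apply: mulr_ge0; lra.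
  by rewrite /W; lra.
have E00 : 0 <= E0.
  rewrite /E0; apply: addr_ge0 => //; apply: mulr_ge0; first lra.
  by apply: mulr_ge0; lra.
have C30 : 0 <= C ^+ 3 by apply: exprn_ge0; lra.
have XMY : X ^+ 9 * M <= X ^+ 9 * M * Y by rewrite ler_peMr//; apply: mulr_ge0; lra.
have XM0 : 0 <= X ^+ 9 * M by apply: mulr_ge0; lra.
set S := X ^+ 9 * M * Y + X ^+ 7; have S0 : 0 <= S by rewrite /S; lra.
pose P := C ^+ 3 * S * k1.
have P0 : 0 <= P by apply: mulr_ge0 k10; apply: mulr_ge0.
pose t : R := (X ^+ 2)^-1.
have t0 : 0 < t by rewrite invr_gt0; lra.
pose A j : set R := [set x | exists b : int * int, [/\ 1 <= b.2, b.2 <= N%:Z,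
      exists u v : int, u * b.1 + v * b.2 = 1 & exists a, [/\ T a x, form b.1 b.2 x <= 1 &
        (t / Y ^+ j / Y <= form b.1 b.2 x <= t / Y ^+ j) /\
        b.2%:~R * M + 1 <= Q * form b.1 b.2 x]]].
pose L := 137 * 27 * W * 2 * (4 * E0 + 1) * P.
have AL j : scover s (A j) L.
  have Yj : 1 <= Y ^+ j by rewrite exprn_ege1.
  have Yj0 : 0 < Y ^+ j by lra.
  set tp := t / Y ^+ j.
  have tp0 : 0 < tp by rewrite divr_gt0.
  have tpX : tp * X ^+ 2 <= 1.
    rewrite /tp /t mulrAC mulVf ?mul1r ?invf_le1//.
    by rewrite gt_eqF//; lra.
  apply: scover_le (level_form_cover Y1 tp0 tpX).
  rewrite -/W.
  have -> : 3 * X ^+ 2 * (9 * C * (137 * C ^+ 2 * (Q * tp) *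
      (W * X ^+ 2 * (2 * ((4 * (E0 * M / (tp / Y)) + 1) * k1)))))
    = 137 * 27 * W * 2 * (C ^+ 3 * k1) * (4 * E0 * (X ^+ 9 * M * Y) + X ^+ 7 * (tp * X ^+ 2)).
    by rewrite /Q; field; rewrite !gt_eqF.
  have -> : L = 137 * 27 * W * 2 * (C ^+ 3 * k1) * ((4 * E0 + 1) * S) by rewrite /L /P; ring.
  apply: ler_wpM2l.
    by apply: mulr_ge0; [lra|apply: mulr_ge0].
  have h1 : X ^+ 7 * (tp * X ^+ 2) <= X ^+ 7 by rewrite ler_piMr//; lra.
  have h2 : 0 <= E0 * X ^+ 7 by apply: mulr_ge0; lra.
  by rewrite /S; lra.
(* Since [Y ^+ 24 = X ^+ 3], 24 levels lead from the Dirichlet bound X^-2 down to X^-5 = 1 / Q,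
   where [small_form_cover] takes over. *)
have cov := scoverU s_gt0 small_form_cover (scover_iter s_gt0 (N := 24) (fun j _ => AL j)).
have PL : P <= W * 2 * (4 * E0 + 1) * P.
  rewrite ler_peMl//; have : 0 <= W * E0 by apply: mulr_ge0; lra.
  lra.
apply: scover_le (scover_sub _ cov).
  have -> : 3 * X ^+ 2 * (9 * C * (137 * C ^+ 2 * (X ^+ 2 * M + 1) * (65 * Q * k1)))
    = 3 * 9 * 137 * 65 * (C ^+ 3 * k1 * (X ^+ 9 * M + X ^+ 7)) by rewrite /Q; ring.
  have h : C ^+ 3 * k1 * (X ^+ 9 * M + X ^+ 7) <= P.
    have -> : P = C ^+ 3 * k1 * S by rewrite /P; ring.
    by apply: ler_wpM2l; [apply: mulr_ge0|rewrite /S lerD2r].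
  have -> : 200 * (137 * C ^+ 3 * 27 * W * 2 * (4 * E0 + 1) *
     (2 * (2 * B + 6 * D ^+ 3) + 1)) * S * k = 200 * L by rewrite /L /P /k1; ring.
  have L0 : 137 * 27 * P <= L by rewrite /L; lra.
  lra.
move=> x [a Ta].
have N0 : (0 < N)%N by rewrite -(ltr_nat R) NX; lra.
have [b1 [b2 [u [v [b21 b2N uv]]]]] := dirichlet_primitive (f1 x) N0.
rewrite NX -/t -/(form b1 b2 x) => bt.
have ft : form b1 b2 x <= 1.
  by apply: le_trans bt _; rewrite invf_le1//; lra.
have [h|h] := leP (b2%:~R * M + 1) (Q * form b1 b2 x); last first.
  left; exists (b1, b2); split=> //; first by exists u, v.
  by exists a; split=> //=; exact: ltW.
have [[j j24 jl]|small] := geometric_level Y 24 bt.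
  right; exists j => //; exists (b1, b2); split=> //; first by exists u, v.
  by exists a; split=> //=; split=> //; rewrite -mulrA -invfM -exprSr.
left; exists (b1, b2); split=> //; first by exists u, v.
exists a; split=> //=.
have E : t / Y ^+ 24 = Q^-1.
  by rewrite (exprM Y 8 3) YX /t /Q; field; rewrite gt_eqF.
rewrite E in small.
have bM0 : 0 <= b2%:~R * M by rewrite mulr_ge0 ?(ltW M0')// ler0z; clear -b21; lia.
have : Q * form b1 b2 x <= 1.
  by rewrite -(@mulfV _ Q) ?ler_wpM2l//; [lra|rewrite gt_eqF//; lra].
lra.
Qed.

End Tangential.

(** * Steep forms *)

Lemma powR_div (R : realType) (x y s : R) : 0 <= x -> 0 < y ->
  (x / y) `^ s = x `^ s / y `^ s.
Proof.
move=> x0 y0; rewrite powRM ?invr_ge0 ?(ltW y0)//.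
by rewrite -powR_inv1 ?(ltW y0)// -powRrM mulN1r powRN.
Qed.

Lemma powR_add (R : realType) (x r s : R) : 0 < x -> x `^ (r + s) = x `^ r * x `^ s.
Proof. by move=> x0; rewrite powRD//; apply/implyP => _; rewrite gt_eqF. Qed.

Lemma expanding_cover (R : realType) (s : R) (P : set R) (F : R -> R) (m V psi : R) :
    0 < s -> 0 < m -> 0 <= V -> 0 <= psi ->
    (forall x y, P x -> P y -> m * `|x - y| <= `|F x - F y| <= V) ->
  scover s [set x | exists a0 : int, P x /\ `|F x + a0%:~R| <= psi]
    ((2 * (V + 2 * psi) + 1) * (2 * psi / m) `^ s).
Proof.
move=> s0 m0 V0 psi0 PF.
apply: (@scover_fiber _ _ s0 _ (fun (a0 : int) x => P x /\ `|F x + a0%:~R| <= psi) id) => //.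
- lra.
- exact: powR_ge0.
- move=> a a' x x' [Px h] [Px' h'] /=; have /andP[_ hV] := PF _ _ Px Px'.
  have -> : (a - a')%:~R = (F x + a%:~R) - (F x' + a'%:~R) - (F x - F x').
    by rewrite intrB; ring.
  apply: le_trans (ler_normB _ _) _; apply: le_trans (lerD (ler_normB _ _) (lexx _)) _.
  lra.
move=> z; apply: (scover_diam s0) => [|x y [a [Px h] <-] [a' [Py h'] aE]].
  by rewrite divr_ge0 ?(ltW m0)//; lra.
have /andP[hm _] := PF _ _ Px Py.
rewrite ler_pdivlMr// mulrC; apply: le_trans hm _.
have -> : F x - F y = (F x + a%:~R) - (F y + a'%:~R) by rewrite aE; ring.
by apply: le_trans (ler_normB _ _) _; lra.
Qed.

(** Where [F1] has one sign and modulus between [m] and [M], two points are at distance at most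
    [D * M / Q], so [F] varies by at most [D * M ^+ 2 / Q] and few integers [a0] occur. The outer
    factor 2 accounts for the two signs. *)
Lemma convex_level_cover (R : realType) (s : R) (J : set R) (Q D : R) (F F1 : R -> R)
    (m M psi : R) : 0 < s -> 0 < Q -> 0 < D -> 0 < m -> m <= M -> 0 <= psi ->
    convex_pair J Q D F F1 ->
  scover s [set x | exists a0 : int, (J x /\ m <= `|F1 x| <= M) /\ `|F x + a0%:~R| <= psi]
    (2 * ((2 * (D * M ^+ 2 / Q + 2 * psi) + 1) * (2 * psi / m) `^ s)).
Proof.
move=> s0 Q0 D0 m0 mM psi0 cp.
have V0 : 0 <= D * M ^+ 2 / Q by rewrite divr_ge0 ?(ltW Q0)// mulr_ge0 ?sqr_ge0// ltW.
have grow x y : J x -> J y -> F x + F1 x * (y - x) <= F y.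
  move=> Jx Jy; apply: le_trans (cp_ge cp Jx Jy); rewrite lerDl.
  by rewrite mulr_ge0 ?sqr_ge0// divr_ge0// ltW.
have M0 : 0 < M by lra.
(* On a set where the derivative keeps its sign, convexity alone pins the
   difference quotients between the two derivative values. *)
have side (P : set R) : (forall x, P x -> J x) ->
    (forall x y, P x -> P y -> x <= y -> m * (y - x) <= `|F x - F y| <= M * (y - x)) ->
    (forall x y, P x -> P y -> `|F1 x - F1 y| <= M) ->
    forall x y, P x -> P y -> m * `|x - y| <= `|F x - F y| <= D * M ^+ 2 / Q.
  move=> PJ h h1 x y; wlog xy : x y / x <= y => [H|].
    have [|/ltW yx] := leP x y; first exact: H.
    by move=> Px Py; rewrite distrC (distrC (F x)); exact: H.
  move=> Px Py; have /andP[h2 h3] := h _ _ Px Py xy.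
  rewrite distrC ger0_norm ?subr_ge0// h2 /=; apply: le_trans h3 _.
  have h4 := le_trans (cp_incr cp (PJ _ Px) (PJ _ Py)) (h1 _ _ Px Py).
  rewrite distrC ger0_norm ?subr_ge0// in h4.
  have -> : D * M ^+ 2 / Q = M * (D / Q * M) by ring.
  rewrite ler_pM2l//.
  have -> : y - x = D / Q * (Q / D * (y - x)) by field; lra.
  by rewrite ler_wpM2l// divr_ge0// ltW.
pose P1 : set R := [set x | J x /\ m <= F1 x <= M].
pose P2 : set R := [set x | J x /\ m <= - F1 x <= M].
have c1 := @expanding_cover _ s P1 F m _ psi s0 m0 V0 psi0 (side P1 _ _ _).
have c2 := @expanding_cover _ s P2 F m _ psi s0 m0 V0 psi0 (side P2 _ _ _).
rewrite mulrDl mul1r; apply: scover_sub (scoverU s0 (c1 _ _ _) (c2 _ _ _)).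
- move=> x [a0 [[Jx /andP[h1 h2]] h3]].
  have [F0|F0] := leP 0 (F1 x).
    by left; exists a0; split=> //; split=> //; rewrite -{1 2}(ger0_norm F0) h1.
  by right; exists a0; split=> //; split=> //; rewrite -{1 2}(ltr0_norm F0) h1.
- by move=> x [].
- move=> x y [Jx /andP[x1 x2]] [Jy /andP[y1 y2]] xy.
  have yx0 : 0 <= y - x by rewrite subr_ge0.
  have g1 := grow _ _ Jx Jy; have g2 := grow _ _ Jy Jx.
  have k1 := ler_wpM2r yx0 x1; have k2 := ler_wpM2r yx0 y2.
  have k0 : 0 <= m * (y - x) by rewrite mulr_ge0// ltW.
  rewrite distrC ger0_norm; last lra.
  by apply/andP; split; lra.
- by move=> x y [_ /andP[? ?]] [_ /andP[? ?]]; rewrite ler_norml; apply/andP; split; lra.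
- by move=> x [].
- move=> x y [Jx /andP[x1 x2]] [Jy /andP[y1 y2]] xy.
  have yx0 : 0 <= y - x by rewrite subr_ge0.
  have g1 := grow _ _ Jx Jy; have g2 := grow _ _ Jy Jx.
  have k1 := ler_wpM2r yx0 y1; have k2 := ler_wpM2r yx0 x2.
  have k0 : 0 <= m * (y - x) by rewrite mulr_ge0// ltW.
  rewrite ger0_norm; last lra.
  by apply/andP; split; lra.
- by move=> x y [_ /andP[? ?]] [_ /andP[? ?]]; rewrite ler_norml; apply/andP; split; lra.
Qed.

(** A dyadic level at [M] costs about (M^2 / Q) (psi / M)^s = psi^s M^(2-s) / Q. As [2 - s >= 1],
    this decays geometrically as [M] decreases, so the top level [M = L * Q] decides and gives
    [psi^s Q^(1-s)]. *)
Lemma convex_steep_cover (R : realType) (s : R) (J : set R) (Q D L B : R) (F F1 : R -> R)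
    (psi : R) : 0 < s -> s < 1 -> 1 <= Q -> 1 <= D -> 1 <= L -> 1 <= B -> 0 <= psi <= B ->
    convex_pair J Q D F F1 -> (forall x, J x -> `|F1 x| <= L * Q) ->
  scover s [set x | exists a0 : int, (J x /\ 1 <= `|F1 x|) /\ `|F x + a0%:~R| <= psi]
    (100 * (D + B) * L ^+ 2 * (psi `^ s * Q `^ (1 - s))).
Proof.
move=> s0 s1 Q1 D1 L1 B1 /andP[psi0 psiB] cp F1L.
have Q0 : 0 < Q by lra.
set Z := psi `^ s * Q `^ (1 - s).
have p0 : 0 <= psi `^ s by exact: powR_ge0.
have q1 : 1 <= Q `^ (1 - s) by rewrite -[leLHS](powRr0 Q) ler_powR//; lra.
have Z0 : 0 <= Z by rewrite mulr_ge0//; lra.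
have pZ : psi `^ s <= Z by rewrite ler_peMr.
(* For slopes up to [sqrt Q] the quantity [M ^+ 2 / Q] is at most 1 and boundedly many [a0] occur,
   so the range from 1 to [r] is one level. *)
pose r := Num.sqrt Q.
have r2 : r ^+ 2 = Q by rewrite sqr_sqrtr// ltW.
have r1 : 1 <= r by rewrite -sqrtr1 ler_wsqrtr.
have L2 : 1 <= L ^+ 2 by rewrite exprn_ege1.
have two : 2 `^ s <= 2 by apply: ler1_powR; lra.
have four : 4 `^ s <= 4 by apply: ler1_powR; lra.
have D0 : 0 < D by lra.
have mid := convex_level_cover s0 Q0 D0 ltr01 r1 psi0 cp.
pose t := L * Q.
have t0 : 0 < t by rewrite mulr_gt0//; lra.
pose A (j : nat) : set R := [set x | exists a0 : int,
  (J x /\ r <= `|F1 x| /\ t / 2 ^+ j.+1 <= `|F1 x| <= t / 2 ^+ j) /\ `|F x + a0%:~R| <= psi].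
pose K := 8 * (2 * D + 4 * B + 1) * L ^+ 2 * Z.
have K0 : 0 <= K by apply: mulr_ge0 Z0; apply: mulr_ge0; lra.
have Acov j : scover s (A j) (K / 2 ^+ j).
  have j0 : 0 < 2 ^+ j :> R by rewrite exprn_gt0.
  set M := t / 2 ^+ j; have M0 : 0 < M by rewrite divr_gt0.
  have ME : t / 2 ^+ j.+1 = M / 2 by rewrite /M exprS; field; rewrite gt_eqF.
  have Kj0 : 0 <= K / 2 ^+ j by rewrite divr_ge0// ltW.
  have [rM|Mr] := leP r M; last first.
    apply: scover_sub (scover0 s0 Kj0) => x [a0 [[_ [h1 /andP[_ h2]]] _]].
    by have := le_lt_trans (le_trans h1 h2) Mr; rewrite ltxx.
  have M20 : 0 < M / 2 by lra.
  have M2M : M / 2 <= M by lra.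
  have lev := convex_level_cover s0 Q0 D0 M20 M2M psi0 cp.
  apply: scover_sub (scover_le _ lev).
    by move=> x [a0 [[Jx [_ h]] h']]; exists a0; split=> //; split=> //; rewrite -ME.
  have MQ : 1 <= M ^+ 2 / Q.
    by rewrite ler_pdivlMr// mul1r -r2 ler_sqr ?nnegrE//; lra.
  have h1 : 2 * (D * M ^+ 2 / Q + 2 * psi) + 1 <= (2 * D + 4 * B + 1) * (M ^+ 2 / Q).
    have := ler_wpM2l (le_trans ler01 B1) MQ; rewrite -mulrA; lra.
  have h2 : (2 * psi / (M / 2)) `^ s <= 4 * (psi `^ s / M `^ s).
    have -> : 2 * psi / (M / 2) = 4 * psi / M by field; lra.
    rewrite powR_div//; last lra.
    by rewrite powRM// -mulrA ler_wpM2r// divr_ge0// powR_ge0.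
  have h3 : M ^+ 2 / M `^ s / Q <= L ^+ 2 * Q `^ (1 - s) / 2 ^+ j.
    have -> : M ^+ 2 / M `^ s = M `^ (2 - s).
      by rewrite powR_add// powRN -powR_mulrn// ltW.
    have -> : M = (L * (2 ^+ j)^-1) * Q by rewrite /M /t; ring.
    have Lj : 0 <= L * (2 ^+ j)^-1 by rewrite divr_ge0//; lra.
    rewrite powRM ?(ltW Q0)// -mulrA.
    have -> : Q `^ (2 - s) / Q = Q `^ (1 - s).
      have -> : 2 - s = (1 - s) + 1 by ring.
      by rewrite powR_add// powRr1 ?(ltW Q0)// mulfK// gt_eqF.
    rewrite [leRHS]mulrAC; apply: ler_wpM2r; first exact: powR_ge0.
    have L0 : 0 <= L by lra.
    rewrite powRM// ?invr_ge0 ?(ltW j0)//.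
    apply: ler_pM; rewrite ?powR_ge0//.
      by rewrite -powR_mulrn; [apply: ler_powR; lra|lra].
    rewrite -[in leLHS](mul1r (2 ^+ j)^-1) powR_div// powR1 mul1r.
    rewrite lef_pV2 ?posrE ?powR_gt0//.
    rewrite -{1}(@powRr1 _ (2 ^+ j)) ?(ltW j0)//; apply: ler_powR; last lra.
    by rewrite exprn_ege1//; lra.
  have a0 : 0 <= 2 * (D * M ^+ 2 / Q + 2 * psi) + 1.
    have : 0 <= D * M ^+ 2 / Q.
      by apply: divr_ge0 (ltW Q0); apply: mulr_ge0 (ltW D0) (sqr_ge0 M).
    lra.
  have h4 := ler_pM a0 (powR_ge0 _ _) h1 h2.
  have h5 : (2 * D + 4 * B + 1) * (M ^+ 2 / Q) * (4 * (psi `^ s / M `^ s))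
     = 4 * (2 * D + 4 * B + 1) * psi `^ s * (M ^+ 2 / M `^ s / Q) by ring.
  rewrite h5 in h4.
  have c0 : 0 <= 4 * (2 * D + 4 * B + 1) * psi `^ s by rewrite mulr_ge0//; lra.
  have h6 := le_trans h4 (ler_wpM2l c0 h3).
  have -> : K / 2 ^+ j = 2 * (4 * (2 * D + 4 * B + 1) * psi `^ s *
    (L ^+ 2 * Q `^ (1 - s) / 2 ^+ j)) by rewrite /K /Z; ring.
  by rewrite ler_pM2l.
have top := @scover_bigcup _ _ s0 A (fun j => K / 2 ^+ j) (2 * K) Acov _.
have {}top : scover s (\bigcup_i A i) (2 * K).
  apply: top => n.
  have -> : \sum_(j < n) K / 2 ^+ j = 2 * K - 2 * K / 2 ^+ n.
    elim: n => [|n IH]; first by rewrite big_ord0 expr0 divr1 subrr.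
    rewrite big_ord_recr /= IH exprS; field.
    by rewrite expf_neq0.
  by rewrite gerBl; apply: divr_ge0; [apply: mulr_ge0|apply: exprn_ge0].
apply: scover_sub (scover_le _ (scoverU s0 mid top)).
  move=> x [a0 [[Jx h1] h]].
  have [h2|h2] := leP `|F1 x| r; first by left; exists a0; rewrite h1 h2.
  right.
  pose n := (Num.truncn t).+1.
  have tn : t / 2 ^+ n < 1.
    rewrite ltr_pdivrMr ?exprn_gt0// mul1r.
    apply: lt_trans (_ : n%:R < _); first by have /andP[] := truncn_itv (ltW t0).
    by rewrite -natrX ltr_nat ltn_expl.
  have [[j jn hj]|hs] := geometric_level 2 n (F1L _ Jx); last first.
    by have := le_lt_trans hs tn; lra.
  by exists j => //; exists a0; split=> //; split=> //; split=> //; exact: ltW.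
have h1 : D * r ^+ 2 / Q = D by rewrite r2; field; lra.
have h2 : (2 * psi / 1) `^ s <= 2 * Z.
  rewrite divr1 powRM//; apply: ler_pM => //; exact: powR_ge0.
have h3 : (2 * (D * r ^+ 2 / Q + 2 * psi) + 1) * (2 * psi / 1) `^ s
    <= (2 * D + 4 * B + 1) * (2 * Z).
  apply: ler_pM => //; rewrite ?powR_ge0// h1; lra.
have h4 : (2 * D + 4 * B + 1) * (2 * Z) <= 8 * (D + B) * L ^+ 2 * Z.
  rewrite mulrA; apply: ler_wpM2r => //.
  have : 8 * (D + B) <= 8 * (D + B) * L ^+ 2 by rewrite ler_peMr//; lra.
  lra.
have h5 : K <= 40 * (D + B) * L ^+ 2 * Z.
  rewrite /K; apply: ler_wpM2r => //; apply: ler_wpM2r; lra.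
lra.
Qed.

(** The ratio 32 is 2^5: [X] will run through the powers of 2, so that [Q = X ^+ 5] and the
    Dirichlet bound [X ^+ 2] are both integers. *)
Definition coeff_block (R : realType) (Q : R) (a : int * int * int) : Prop :=
  [/\ Q <= `|a.1.2%:~R| \/ Q <= `|a.2%:~R|, `|a.1.2%:~R| <= 32 * Q & `|a.2%:~R| <= 32 * Q].

Section Blocks.
Context {R : realType}.
Variables (s : R) (J : set R) (C : R) (f f1 l l1 : R -> R).
Hypothesis s_gt0 : 0 < s.
Hypothesis s_lt1 : s < 1.
Hypothesis cb : curve_bounds J C f f1 l l1.

Lemma dual_form1_le Q a x : 1 <= Q -> J x -> coeff_block Q a ->
  `|dual_form1 f1 l1 a x| <= 65 * C * Q.
Proof.
move=> Q1 Jx [_ h1 h2]; have C1 := cb_ge1 cb.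
apply: le_trans (ler_normD _ _) _; apply: le_trans (lerD (ler_normD _ _) (lexx _)) _.
rewrite normrM.
have k1 : `|a.2%:~R| * `|f1 x| <= 32 * Q * C by apply: ler_pM => //; exact: (cb_f1 cb Jx).
have k2 := cb_l1 cb Jx.
have k3 : Q <= C * Q by rewrite ler_peMl//; lra.
have k4 : C <= C * Q by rewrite ler_peMr//; lra.
lra.
Qed.

(** When [a2] is small, [a1] has to be large, and the term [a1 x] dominates the variation of the
    other two. Such a form lacks the curvature used elsewhere, but it is steep everywhere. *)
Lemma flat_coefficients Q a : 8 * C ^+ 3 <= Q -> coeff_block Q a ->
  `|a.2%:~R| < Q / (4 * C) ->
  (forall x y, J x -> J y ->
     Q / 2 * `|x - y| <= `|dual_form f l a x - dual_form f l a y|) /\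
  (forall x, J x -> Q / 2 <= `|dual_form1 f1 l1 a x|).
Proof.
move=> CQ [big _ _] small; have C1 := cb_ge1 cb.
have C0 : 0 < C by lra.
have CQ8 : 8 * C <= Q by apply: le_trans CQ; rewrite ler_pM2l// -{1}(expr1 C) ler_weXn2l.
have QC : Q / (4 * C) <= Q.
  by rewrite ler_pdivrMr ?mulr_gt0// ler_peMr//; lra.
have {}big : Q <= `|a.1.2%:~R| by case: big => //; lra.
have aC : `|a.2%:~R| * C <= Q / 4.
  apply: (@le_trans _ _ (Q / (4 * C) * C)); first by rewrite ler_pM2r// ltW.
  by rewrite (_ : Q / (4 * C) * C = Q / 4)//; field; lra.
have C8 : C <= Q / 4 by lra.
split=> [x y Jx Jy|x Jx].
- have E : a.1.2%:~R * (x - y) = (dual_form f l a x - dual_form f l a y)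
    - a.2%:~R * (f x - f y) - (l x - l y) by rewrite /dual_form; ring.
  have h : `|a.1.2%:~R * (x - y)| <= `|dual_form f l a x - dual_form f l a y|
     + `|a.2%:~R * (f x - f y)| + `|l x - l y|.
    rewrite E; apply: le_trans (ler_normB _ _) _; rewrite lerD2r; exact: ler_normB.
  rewrite !normrM in h.
  have d0 : 0 <= `|x - y| by [].
  have k1 := ler_wpM2r d0 big.
  have k2 := ler_wpM2l (normr_ge0 a.2%:~R) (cb_flip cb Jx Jy).
  have k3 := cb_llip cb Jx Jy.
  have k4 := ler_wpM2r d0 aC; have k5 := ler_wpM2r d0 C8.
  by rewrite mulrA in k2; lra.
- have E : a.1.2%:~R = dual_form1 f1 l1 a x - a.2%:~R * f1 x - l1 x :> R.
    by rewrite /dual_form1; ring.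
  have h : `|a.1.2%:~R| <= `|dual_form1 f1 l1 a x| + `|a.2%:~R * f1 x| + `|l1 x|.
    rewrite {1}E; apply: le_trans (ler_normB _ _) _; rewrite lerD2r; exact: ler_normB.
  rewrite normrM in h.
  have k1 := ler_wpM2l (normr_ge0 a.2%:~R) (cb_f1 cb Jx); have k2 := cb_l1 cb Jx.
  lra.
Qed.

Lemma steep_fixed_cover Q B psi (c1 c2 : int) : 8 * C ^+ 3 <= Q -> 1 <= B -> 0 <= psi <= B ->
  scover s [set x | exists a0 : int, [/\ J x, coeff_block Q (a0, c1, c2),
     `|dual_form f l (a0, c1, c2) x| <= psi & 1 <= `|dual_form1 f1 l1 (a0, c1, c2) x|]]
   (100 * (33 * C ^+ 2 + B) * (65 * C) ^+ 2 * (psi `^ s * Q `^ (1 - s))).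
Proof.
have s1 := s_lt1; move=> CQ B1 psiB; have C1 := cb_ge1 cb; case/andP: (psiB) => psi0 psiB'.
have C2 : 1 <= C ^+ 2 by rewrite exprn_ege1.
have C3 : 1 <= C ^+ 3 by rewrite exprn_ege1.
have Q1 : 1 <= Q by lra.
have Q0 : 0 < Q by lra.
have F0 a0 x : dual_form f l (a0, c1, c2) x = dual_form f l (0, c1, c2) x + a0%:~R.
  by rewrite /dual_form /=; ring.
have F10 a0 x : dual_form1 f1 l1 (a0, c1, c2) x = dual_form1 f1 l1 (0, c1, c2) x by [].
set Z := psi `^ s * Q `^ (1 - s); have Z0 : 0 <= Z by rewrite mulr_ge0 ?powR_ge0.
set W := 100 * _ * _.
have W0 : 0 <= W by apply: mulr_ge0; [lra|exact: sqr_ge0].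
have WZ0 : 0 <= W * Z by exact: mulr_ge0.
have [bl|nbl] := pselect (coeff_block Q (0, c1, c2)); last first.
  by apply: scover_sub (scover0 s_gt0 WZ0) => x [a0 [_ h _ _]]; exact: nbl.
have [small|big] := ltP `|c2%:~R| (Q / (4 * C)).
- have [exp _] := flat_coefficients CQ bl small.
  have V0 : 0 <= 65 * C ^+ 2 * Q by apply: mulr_ge0; lra.
  have m0 : 0 < Q / 2 by lra.
  have cov := @expanding_cover _ s J (dual_form f l (0, c1, c2)) (Q / 2) _ psi s_gt0 m0 V0 psi0.
  apply: scover_sub (scover_le _ (cov _)).
  + by move=> x [a0 [Jx _ h _]]; exists a0; rewrite -F0.
  + have h1 : 2 * (65 * C ^+ 2 * Q + 2 * psi) + 1 <= (130 * C ^+ 2 + 4 * B + 1) * Q.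
      have : B <= B * Q by rewrite ler_peMr//; lra.
      lra.
    have h2 : (2 * psi / (Q / 2)) `^ s <= 4 * psi `^ s / Q `^ s.
      have -> : 2 * psi / (Q / 2) = 4 * psi / Q by field; lra.
      rewrite powR_div//; last lra.
      rewrite powRM// ler_pM2r ?invr_gt0 ?powR_gt0//; apply: ler_wpM2r; first exact: powR_ge0.
      by apply: ler1_powR; lra.
    have h0 : 0 <= 2 * (65 * C ^+ 2 * Q + 2 * psi) + 1 by lra.
    apply: le_trans (ler_pM h0 (powR_ge0 _ _) h1 h2) _.
    have -> : (130 * C ^+ 2 + 4 * B + 1) * Q * (4 * psi `^ s / Q `^ s)
      = 4 * (130 * C ^+ 2 + 4 * B + 1) * Z.
      rewrite /Z powR_add// powRN powRr1 ?(ltW Q0)//; ring.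
    apply: ler_wpM2r Z0 _ _ _; rewrite /W.
    have -> : (65 * C) ^+ 2 = 4225 * C ^+ 2 by ring.
    have : 33 * C ^+ 2 + B <= (33 * C ^+ 2 + B) * C ^+ 2 by rewrite ler_peMr//; lra.
    lra.
  + move=> x y Jx Jy; rewrite exp//=.
    have E : dual_form f l (0, c1, c2) x - dual_form f l (0, c1, c2) y
      = c2%:~R * (f x - f y) + c1%:~R * (x - y) + (l x - l y) by rewrite /dual_form /=; ring.
    have [_ /= b1 b2] := bl.
    rewrite E; apply: le_trans (ler_normD _ _) _.
    apply: le_trans (lerD (ler_normD _ _) (lexx _)) _; rewrite !normrM.
    have len := cb_len cb Jx Jy.
    have k0 : `|f x - f y| <= C * C.
      by apply: le_trans (cb_flip cb Jx Jy) _; rewrite ler_wpM2l//; lra.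
    have k1 : `|c2%:~R| * `|f x - f y| <= 32 * Q * (C * C) by apply: ler_pM.
    have k2 : `|c1%:~R| * `|x - y| <= 32 * Q * C by apply: ler_pM.
    have k3 : `|l x - l y| <= C * C.
      by apply: le_trans (cb_llip cb Jx Jy) _; rewrite ler_wpM2l//; lra.
    have k4 : Q * C <= Q * C ^+ 2 by rewrite ler_pM2l// -{1}(expr1 C) ler_weXn2l.
    have k5 : C ^+ 2 <= C ^+ 2 * Q by rewrite ler_peMr//; lra.
    lra.
- have [e [e1 ec]] : exists e : int, (e = 1 \/ e = -1) /\ `|c2%:~R| = (e * c2)%:~R :> R.
    have [h|h] := leP 0 c2.
      by exists 1; split; [left|rewrite mul1r ger0_norm// ler0z].
    by exists (-1); split; [right|rewrite mulN1r rmorphN /= ltr0_norm// ltrz0].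
  have [_ _ /= b2] := bl.
  have en (y : R) : `|e%:~R * y| = `|y|.
    by rewrite normrM; case: e1 => ->; rewrite ?rmorphN normrN1 mul1r || rewrite normr1 mul1r.
  have cp : convex_pair J Q (33 * C ^+ 2) (fun x => e%:~R * dual_form f l (0, c1, c2) x)
     (fun x => e%:~R * dual_form1 f1 l1 (0, c1, c2) x).
    by apply: dual_form_convex => //=; rewrite -ec big.
  have cov := @convex_steep_cover _ s J Q (33 * C ^+ 2) (65 * C) B _ _ psi s_gt0 s_lt1 Q1 _ _ B1 psiB cp _.
  have {}cov := cov ltac:(lra) ltac:(lra) (fun x Jx => ltac:(rewrite /= en; exact: dual_form1_le)).
  apply: scover_sub cov => x [a0 [Jx _ h1 h2]].
  exists (e * a0); rewrite en; split=> //.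
  by rewrite intrM -mulrDr en -F0.
Qed.

Lemma steep_block_cover Q B psi : 8 * C ^+ 3 <= Q -> 1 <= B -> 0 <= psi <= B ->
  scover s [set x | exists a, [/\ J x, coeff_block Q a,
     `|dual_form f l a x| <= psi & 1 <= `|dual_form1 f1 l1 a x|]]
   (129 ^+ 2 * (100 * (33 * C ^+ 2 + B) * (65 * C) ^+ 2) * (psi `^ s * Q `^ (3 - s))).
Proof.
move=> CQ B1 psiB; have C1 := cb_ge1 cb.
have C2 : 1 <= C ^+ 2 by rewrite exprn_ege1.
have C3 : 1 <= C ^+ 3 by rewrite exprn_ege1.
have Q1 : 1 <= Q by lra.
have Q0 : 0 < Q by lra.
set W := 100 * _ * _.
have W0 : 0 <= W by apply: mulr_ge0; [lra|exact: sqr_ge0].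
set Z := psi `^ s * Q `^ (1 - s); have Z0 : 0 <= Z by rewrite mulr_ge0 ?powR_ge0.
have WZ0 : 0 <= W * Z by exact: mulr_ge0.
have -> : 129 ^+ 2 * W * (psi `^ s * Q `^ (3 - s)) = (129 * Q) * ((129 * Q) * (W * Z)).
  have -> : 3 - s = 1 - s + 2%:R by ring.
  by rewrite powR_add// powR_mulrn ?(ltW Q0)// /Z; ring.
have diff (c c' : int) : `|c%:~R| <= 32 * Q -> `|c'%:~R| <= 32 * Q -> `|(c - c')%:~R| <= 64 * Q.
  by move=> h h'; rewrite intrB; apply: le_trans (ler_normB _ _) _; lra.
have QWZ : 0 <= 129 * Q * (W * Z) by apply: mulr_ge0 WZ0; lra.
apply: (@scover_le _ _ _ ((2 * (64 * Q) + 1) * (129 * Q * (W * Z)))).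
  by apply: ler_wpM2r QWZ _ _ _; lra.
apply: (@scover_fiber _ _ s_gt0 _ (fun a x => [/\ J x, coeff_block Q a,
     `|dual_form f l a x| <= psi & 1 <= `|dual_form1 f1 l1 a x|]) (fun a => a.1.2)) => //.
- lra.
- by move=> a a' x x' [_ [_ h _] _ _] [_ [_ h' _] _ _]; exact: diff.
move=> c1; apply: (@scover_le _ _ _ ((2 * (64 * Q) + 1) * (W * Z))).
  by apply: ler_wpM2r WZ0 _ _ _; lra.
have Q64 : 0 <= 64 * Q by lra.
apply: scover_sub (@scover_fiber _ _ s_gt0 _ (fun a x => [/\ J x, coeff_block Q a,
     `|dual_form f l a x| <= psi & 1 <= `|dual_form1 f1 l1 a x|] /\ a.1.2 = c1)
     (fun a => a.2) _ _ Q64 WZ0 _ _).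
- by move=> x [a h E]; exists a.
- by move=> a a' x x' [[_ [_ _ h] _ _] _] [[_ [_ _ h'] _ _] _]; exact: diff.
move=> c2; apply: scover_sub (steep_fixed_cover c1 c2 CQ B1 psiB) => x.
by move=> [[[a0 a1] a2] /= [h <-] <-]; exists a0.
Qed.

End Blocks.

(** The first factor is the constant of [tangential_cover], the second the constant in the cost of
    one form on one level, and the final 2 adds the contributions of X^9 M Y and X^7. *)
Definition tangential_const (R : realType) (C B : R) : R :=
  let D := 33 * C ^+ 2 in
  200 * (137 * C ^+ 3 * 27 * (64 * (64 * D ^+ 3 * B) + 3) * 2 *
    (4 * (2 + D * (4 * D * (1 + (4 * B + D)))) + 1) * (2 * (2 * B + 6 * D ^+ 3) + 1)) *
  (2 * (2 * D + 4 * B + 1) * (2 * B)) * 2.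

(** * Nearly tangent forms, by size of the derivative *)

Section TangentialBlocks.
Context {R : realType}.
Variables (s : R) (J : set R) (C : R) (f f1 l l1 : R -> R).
Hypothesis s_gt0 : 0 < s.
Hypothesis s_lt1 : s < 1.
Hypothesis cb : curve_bounds J C f f1 l l1.
Variables (X B psi : R) (N : nat) (e : int).
Hypothesis X_ge1 : 1 <= X.
Hypothesis NX : N%:R = X ^+ 2.
Let Q : R := X ^+ 5.
Let D : R := 33 * C ^+ 2.
Hypothesis CQ : 8 * C ^+ 3 <= Q.
Hypothesis B1 : 1 <= B.
Hypothesis psiB : 0 <= psi <= B * X `^ (5 - 15 / s).
Hypothesis e1 : e = 1 \/ e = -1.

Let Y : R := X `^ (1 / 8).
(* The smallest derivative worth distinguishing: there the two bounds
   [psi / |F'|] and [|F'| / Q] on the length of a solution interval agree. *)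
Let M0 : R := X `^ (5 - 15 / (2 * s)).
Let E0 : R := 2 + D * (4 * D * (1 + (4 * B + D))).
Let G : R := 200 * (137 * C ^+ 3 * 27 * (64 * (64 * D ^+ 3 * B) + 3) * 2 * (4 * E0 + 1) *
     (2 * (2 * B + 6 * D ^+ 3) + 1)).
Let kap : R := 2 * (2 * D + 4 * B + 1) * (2 * B).

Let tangent (M : R) (a : int * int * int) (x : R) : Prop :=
  [/\ J x, Q / (4 * C) <= (e * a.2)%:~R <= 32 * Q,
    `|dual_form f l a x| <= psi & `|dual_form1 f1 l1 a x| <= M].

Let consts : [/\ 1 <= X, 1 <= Y, Y ^+ 8 = X & 0 < M0 <= 1] /\
  [/\ 1 <= C, 1 <= D, 1 <= Q & 15 < 15 / s].
Proof.
have s0 := s_gt0; have s1 := s_lt1; have C1 := cb_ge1 cb; have X1 := X_ge1.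
have C2 : 1 <= C ^+ 2 by rewrite exprn_ege1.
have s15 : 15 < 15 / s by rewrite ltr_pdivlMr//; lra.
split; split => //.
- by rewrite -[leLHS](powRr0 X); apply: ler_powR.
- rewrite /Y -powR_mulrn ?powR_ge0// -powRrM (_ : 1 / 8 * 8%:R = 1); last by field.
  by rewrite powRr1//; lra.
- rewrite powR_gt0/=; last lra.
  rewrite -[leRHS](powRr0 X); apply: ler_powR => //.
  by rewrite (_ : 15 / (2 * s) = 15 / s / 2); [lra|field; lra].
- by rewrite /D; lra.
- by rewrite exprn_ege1.
Qed.

Let G_ge0 : 0 <= G.
Proof.
have [_ [C1 D1 _ _]] := consts; have B1' := B1.
have D3 : 1 <= D ^+ 3 by rewrite exprn_ege1.
have C3 : 1 <= C ^+ 3 by rewrite exprn_ege1.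
have DB : 0 <= D ^+ 3 * B by apply: mulr_ge0; lra.
have E00 : 0 <= E0.
  rewrite /E0; apply: addr_ge0 => //; apply: mulr_ge0; first lra.
  by apply: mulr_ge0; lra.
rewrite /G; do ![apply: mulr_ge0]; lra.
Qed.

Let kap_ge : 2 * D <= kap /\ 0 <= kap.
Proof.
have [_ [C1 D1 _ _]] := consts; have B1' := B1; rewrite /kap.
by split; nra.
Qed.

Let XpowE : Q = X `^ 5.
Proof. by rewrite -[5]/(5%:R) powR_mulrn//; have := X_ge1; lra. Qed.

Let psi_le M : M0 <= M -> 0 <= psi <= B * M ^+ 2 / Q.
Proof.
have [[X1 _ _ /andP[M00 _]] [_ _ Q1 _]] := consts; have s0 := s_gt0; have B1' := B1.
move=> M0M; case/andP: psiB => -> /= h; apply: le_trans h _; rewrite -mulrA.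
apply: ler_wpM2l; first lra.
apply: (@le_trans _ _ (M0 ^+ 2 / Q)); last first.
  by rewrite ler_pM2r ?invr_gt0; [rewrite ler_sqr ?nnegrE; lra|lra].
rewrite XpowE -powRN /M0 -powR_mulrn ?powR_ge0// -powRrM -powR_add; last lra.
by apply: ler_powR => //; rewrite le_eqVlt; apply/orP; left; apply/eqP; field; lra.
Qed.

Let tangent_sum M k (T : int * int * int -> R -> Prop) : M0 <= M <= 1 ->
  (forall a x, T a x -> tangent M a x) -> (forall a, scover s [set x | T a x] k) ->
  scover s [set x | exists a, T a x] (G * (X ^+ 9 * M * Y + X ^+ 7) * k).
Proof.
move=> /andP[M0M M1] TM Tk; have [[X1 Y1 YX /andP[M00 _]] _] := consts.
have M01 : 0 < M <= 1 by rewrite (lt_le_trans M00 M0M).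
exact: (@tangential_cover _ s J C f f1 l l1 s_gt0 cb X B M psi N e X1 NX CQ B1 M01
   (psi_le M0M) e1 T TM k Tk Y Y1 YX).
Qed.

Let tangent_convex M a x : tangent M a x -> convex_pair J Q D
   (fun x => e%:~R * dual_form f l a x) (fun x => e%:~R * dual_form1 f1 l1 a x).
Proof. by case=> _ h _ _; exact: dual_form_convex. Qed.

Let norm_e (y : R) : `|e%:~R * y| = `|y|.
Proof. by rewrite normrM; case: e1 => ->; rewrite ?normrN1 ?normr1 mul1r. Qed.

(** Near-tangency alone confines the points of a form to length of order [M0 / Q], with [s]-th power
    X^(-15/2). Against X^7 forms this leaves X^(-1/2); the term X^9 M0 Y is smaller because
    [15 / (2 * s)] exceeds 15/2. *)
Lemma bottom_cover :
  scover s [set x | exists a, tangent M0 a x] (G * kap * 2 * X `^ (- (3 / 8))).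
Proof.
have [[X1 Y1 YX /andP[M00 M01]] [C1 D1 Q1 s15]] := consts; have [kD k0] := kap_ge.
have s0 := s_gt0; have s1 := s_lt1.
have X0 : 0 < X by lra.
have k1 : 0 <= kap * X `^ (- (15 / 2)) by apply: mulr_ge0 => //; exact: powR_ge0.
apply: scover_le (@tangent_sum M0 (kap * X `^ (- (15 / 2))) (tangent M0) _ _ _) => //.
- have -> : G * kap * 2 * X `^ (- (3 / 8)) = G * (kap * (2 * X `^ (- (3 / 8)))) by ring.
  rewrite -[leLHS]mulrA; apply: ler_wpM2l; first exact: G_ge0.
  rewrite mulrCA; apply: ler_wpM2l => //.
  rewrite mulrDl -![X ^+ _](@powR_mulrn _ X) ?(ltW X0)// /Y /M0 -!powR_add//.
  have a1 : X `^ (9%:R + (5 - 15 / (2 * s)) + 1 / 8 + - (15 / 2)) <= X `^ (- (3 / 8)).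
    apply: ler_powR => //.
    by rewrite (_ : 15 / (2 * s) = 15 / s / 2); [lra|field; lra].
  have a2 : X `^ (7%:R + - (15 / 2)) <= X `^ (- (3 / 8)) by apply: ler_powR => //; lra.
  lra.
- by rewrite lexx.
move=> a; have [[y ty]|nt] := pselect (exists y, tangent M0 a y); last first.
  by apply: scover_sub (scover0 s_gt0 k1) => x Tx; apply: nt; exists x.
have cp := tangent_convex ty.
have d0 : 0 <= 2 * D * M0 / Q by apply: divr_ge0; [apply: mulr_ge0; lra|lra].
apply: scover_le (scover_diam s_gt0 d0 _).
  have -> : 2 * D * M0 / Q = 2 * D * (M0 / Q) by ring.
  have -> : M0 / Q = X `^ (- (15 / (2 * s))).
    by rewrite XpowE -powRN /M0 -powR_add//; congr (_ `^ _); ring.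
  rewrite powRM ?powR_ge0//; last lra.
  rewrite -powRrM (_ : - (15 / (2 * s)) * s = - (15 / 2)); last by field; lra.
  apply: ler_wpM2r; first exact: powR_ge0.
  by apply: le_trans kD; apply: ler1_powR; lra.
move=> x z [Jx _ _ h] [Jz _ _ h'].
have := cp_incr cp Jx Jz; rewrite -mulrBr norm_e => h2.
have h3 := le_trans h2 (ler_normB _ _).
have -> : 2 * D * M0 / Q = D / Q * (2 * M0) by ring.
have -> : `|x - z| = D / Q * (Q / D * `|x - z|) by field; lra.
by apply: ler_wpM2l; [apply: divr_ge0; lra|lra].
Qed.

Lemma level_cover M : M0 <= M <= 1 ->
  scover s [set x | exists a, tangent M a x /\ M / Y <= `|dual_form1 f1 l1 a x|]
    (G * kap * 2 * X `^ (- (3 / 8))).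
Proof.
move=> /andP[M0M M1].
have [[X1 Y1 YX /andP[M00 M01]] [C1 D1 Q1 s15]] := consts; have [kD kap0] := kap_ge.
have s0 := s_gt0; have s1 := s_lt1; have B1' := B1.
have X0 : 0 < X by lra.
have Y0 : 0 < Y by lra.
have Mpos : 0 < M by lra.
case/andP: psiB => psi0 psib.
set w := X `^ (5 - 15 / s) * Y / M.
have w0 : 0 <= w by apply: divr_ge0; [apply: mulr_ge0; [exact: powR_ge0|lra]|lra].
pose k := kap * w `^ s.
have k0 : 0 <= k by apply: mulr_ge0 => //; exact: powR_ge0.
apply: scover_le (@tangent_sum M k (fun a x => tangent M a x /\ M / Y <= `|dual_form1 f1 l1 a x|) _ _ _).
- have -> : G * kap * 2 * X `^ (- (3 / 8)) = G * (kap * (2 * X `^ (- (3 / 8)))) by ring.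
  rewrite -[leLHS]mulrA; apply: ler_wpM2l; first exact: G_ge0.
  rewrite /k mulrCA; apply: ler_wpM2l => //.
  have wE : w `^ s = X `^ (5 * s - 15 + s / 8) / M `^ s.
    rewrite /w powR_div//; last by apply: mulr_ge0; [exact: powR_ge0|lra].
    congr (_ / _); rewrite /Y -powR_add// -powRrM; congr (_ `^ _); field; lra.
  have Xs0 := powR_ge0 X (5 * s - 15 + s / 8).
  have Ms0 : 0 < M `^ s by rewrite powR_gt0.
  rewrite mulrDl; have -> : X ^+ 9 * M * Y * w `^ s
    = X ^+ 9 * Y * X `^ (5 * s - 15 + s / 8) * (M / M `^ s) by rewrite wE; ring.
  have Ms1 : M / M `^ s <= 1.
    by rewrite ler_pdivrMr// mul1r ger1_powR// ?M1 ?Mpos// ltW.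
  have a1 : X ^+ 9 * Y * X `^ (5 * s - 15 + s / 8) <= X `^ (- (3 / 8)).
    rewrite -[X ^+ 9](@powR_mulrn _ X) ?(ltW X0)// /Y -!powR_add//.
    by apply: ler_powR => //; lra.
  (* This term is largest at [M = M0], where the exponent is [- 1 / 2 + s / 8], below -3/8. This is
     the origin of 3/8; in [a1] the exponent stays below -3/4. *)
  have a2 : X ^+ 7 * w `^ s <= X `^ (- (3 / 8)).
    have M0s : M0 `^ s <= M `^ s by apply: ge0_ler_powR; rewrite ?nnegrE; lra.
    rewrite wE mulrA ler_pdivrMr//.
    apply: (@le_trans _ _ (X `^ (- (3 / 8)) * M0 `^ s)); last first.
      by apply: ler_wpM2l => //; exact: powR_ge0.
    rewrite -[X ^+ 7](@powR_mulrn _ X) ?(ltW X0)// /M0 -powRrM -!powR_add//.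
    apply: ler_powR => //.
    rewrite (_ : (5 - 15 / (2 * s)) * s = 5 * s - 15 / 2); last by field; lra.
    lra.
  have a3 : X ^+ 9 * Y * X `^ (5 * s - 15 + s / 8) * (M / M `^ s)
     <= X ^+ 9 * Y * X `^ (5 * s - 15 + s / 8).
    apply: ler_piMr Ms1; apply: mulr_ge0 Xs0.
    by apply: mulr_ge0; [apply: exprn_ge0|]; lra.
  lra.
- by rewrite M0M.
- by move=> a x [].
move=> a; have [[y [ty _]]|nt] := pselect (exists y, tangent M a y /\ M / Y <= `|dual_form1 f1 l1 a y|);
    last by apply: scover_sub (scover0 s_gt0 k0) => x Tx; apply: nt; exists x.
have cp := tangent_convex ty.
have m0 : 0 < M / Y by rewrite divr_gt0.
have mM : M / Y <= M by rewrite ler_pdivrMr// ler_peMr//; lra.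
have Q0 : 0 < Q by lra.
have D0 : 0 < D by lra.
apply: scover_sub (scover_le _ (convex_level_cover s_gt0 Q0 D0 m0 mM psi0 cp)).
  move=> x [[Jx _ h1 h2] h3]; exists 0; rewrite addr0 !norm_e; split=> //; split=> //.
  by rewrite h3 h2.
have psiB1 : psi <= B.
  apply: le_trans psib _; rewrite ler_piMr//; first lra.
  by rewrite -[leRHS](powRr0 X); apply: ler_powR => //; lra.
have MQ : D * M ^+ 2 / Q <= D.
  rewrite ler_pdivrMr//; apply: ler_wpM2l; first lra.
  by apply: le_trans Q1; apply: exprn_ile1; lra.
have MQ0 : 0 <= D * M ^+ 2 / Q.
  by apply: divr_ge0 (ltW Q0); apply: mulr_ge0; [lra|exact: sqr_ge0].
have h : (2 * psi / (M / Y)) `^ s <= 2 * B * w `^ s.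
  apply: (@le_trans _ _ ((2 * B * w) `^ s)).
    apply: ge0_ler_powR; rewrite ?nnegrE; first lra.
    - by apply: divr_ge0; [lra|exact: ltW].
    - by apply: mulr_ge0 w0; lra.
    have -> : 2 * psi / (M / Y) = 2 * (Y / M) * psi by field; rewrite !gt_eqF.
    have -> : 2 * B * w = 2 * (Y / M) * (B * X `^ (5 - 15 / s)) by rewrite /w; ring.
    by apply: ler_wpM2l psib; apply: mulr_ge0 => //; apply: divr_ge0; exact: ltW.
  rewrite powRM//; last lra.
  apply: ler_wpM2r; first exact: powR_ge0.
  by apply: ler1_powR; lra.
have -> : k = 2 * ((2 * D + 4 * B + 1) * (2 * B * w `^ s)) by rewrite /k /kap; ring.
rewrite ler_pM2l//; apply: ler_pM => //; [lra|exact: powR_ge0|lra].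
Qed.

(** The hypothesis says that [L] levels of ratio [Y] lead from 1 down to [M0]. Both ends are powers
    of [X] with exponents depending on [s] alone, so [L] can be fixed before [X]. *)
Lemma tangential_sign_cover (L : nat) : 15 / (2 * s) - 5 <= L%:R / 8 ->
  scover s [set x | exists a, [/\ J x, Q / (4 * C) <= (e * a.2)%:~R <= 32 * Q,
      `|dual_form f l a x| <= psi & `|dual_form1 f1 l1 a x| <= 1]]
    ((1 + L%:R) * (tangential_const C B * X `^ (- (3 / 8)))).
Proof.
move=> hL; have [[X1 Y1 YX /andP[M00 M01]] [C1 D1 Q1 s15]] := consts.
have -> : tangential_const C B = G * kap * 2 by [].
have Yn n : 0 < Y ^+ n by rewrite exprn_gt0//; lra.
have Z0 := scover_ge0 bottom_cover.
pose A i : set R := [set x | exists a, [/\ M0 <= 1 / Y ^+ i, tangent (1 / Y ^+ i) a x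
  & 1 / Y ^+ i / Y <= `|dual_form1 f1 l1 a x|]].
have Acov i : (i < L)%N -> scover s (A i) (G * kap * 2 * X `^ (- (3 / 8))).
  move=> _; have [h|h] := leP M0 (1 / Y ^+ i); last first.
    by apply: scover_sub (scover0 s_gt0 Z0) => x [a [h' _ _]]; move: h; rewrite ltNge h'.
  have M1 : M0 <= 1 / Y ^+ i <= 1 by rewrite h /= ler_pdivrMr// mul1r exprn_ege1.
  by apply: scover_sub (level_cover M1) => x [a [_ h1 h2]]; exists a.
rewrite (_ : (1 + L%:R) * _ = G * kap * 2 * X `^ (- (3 / 8)) +
  L%:R * (G * kap * 2 * X `^ (- (3 / 8)))); last by ring.
apply: scover_sub (scoverU s_gt0 bottom_cover (scover_iter s_gt0 Acov)).
move=> x [a [Jx ha h1 h2]].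
have bot : `|dual_form1 f1 l1 a x| <= M0 -> exists a, tangent M0 a x by move=> ?; exists a.
have [[i iL /andP[g1 g2]]|small] := geometric_level Y L h2.
  have [h|h] := leP M0 (1 / Y ^+ i).
    right; exists i => //; exists a; split=> //.
    by rewrite -mulrA -invfM -exprSr.
  by left; apply: bot; apply: le_trans g2 (ltW h).
left; apply: bot; apply: le_trans small _.
rewrite div1r /Y -powR_mulrn ?powR_ge0// -powRrM -powRN; apply: ler_powR => //.
lra.
Qed.

End TangentialBlocks.

Lemma tangential_block_cover (R : realType) (s : R) (J : set R) (C : R)
    (f f1 l l1 : R -> R) (B : R) : 0 < s -> s < 1 -> curve_bounds J C f f1 l l1 -> 1 <= B ->
  exists W : R, forall (X psi : R) (N : nat), 1 <= X -> N%:R = X ^+ 2 -> 8 * C ^+ 3 <= X ^+ 5 ->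
    0 <= psi <= B * X `^ (5 - 15 / s) ->
    scover s [set x | exists a, [/\ J x, coeff_block (X ^+ 5) a,
      `|dual_form f l a x| <= psi & `|dual_form1 f1 l1 a x| <= 1]] (W * X `^ (- (3 / 8))).
Proof.
move=> s0 s1 cb B1.
pose L := (Num.truncn (8 * (15 / (2 * s)))).+1.
have hL : 15 / (2 * s) - 5 <= L%:R / 8.
  have h0 : 0 <= 8 * (15 / (2 * s)) by rewrite mulr_ge0// divr_ge0//; lra.
  by have /andP[_] := truncn_itv h0; rewrite -/L; lra.
exists (2 * ((1 + L%:R) * tangential_const C B)) => X psi N X1 NX CQ psiB.
have C1 := cb_ge1 cb.
have C3 : 1 <= C ^+ 3 by rewrite exprn_ege1.
have cov e (he : e = 1 \/ e = -1) :=
  tangential_sign_cover s0 s1 cb X1 NX CQ B1 psiB he hL.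
have -> : 2 * ((1 + L%:R) * tangential_const C B) * X `^ (- (3 / 8))
  = (1 + L%:R) * (tangential_const C B * X `^ (- (3 / 8)))
  + (1 + L%:R) * (tangential_const C B * X `^ (- (3 / 8))) by ring.
apply: scover_sub (scoverU s0 (cov 1 (or_introl erefl)) (cov (-1) (or_intror erefl))).
move=> x [a [Jx bl h1 h2]]; have [_ _ b2] := bl.
(* A form with small [a2] has slope at least [Q / 2 > 1] and is never nearly tangent; for the
   remaining ones the sign of [a2] selects [e]. *)
have [small|big] := ltP `|a.2%:~R| (X ^+ 5 / (4 * C)).
  by have [_ /(_ _ Jx)] := flat_coefficients cb CQ bl small; lra.
have [h|h] := leP 0 a.2.
- left; exists a; split=> //; rewrite mul1r.
  by move: big b2; rewrite ger0_norm ?ler0z// => -> ->.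
- right; exists a; split=> //; rewrite mulN1r rmorphN /=.
  by move: big b2; rewrite ltr0_norm ?ltrz0// => -> ->.
Qed.

(** * Summation over the blocks *)

Definition approx_triples (R : realType) (f l : R -> R) (psi : nat -> R) (x : R) :
    set (int * int * int) :=
  [set t | (t.1.2, t.2) <> (0, 0) /\
    `|dual_form f l t x| < psi (maxn `|t.1.2|%N `|t.2|%N)].

Lemma finite_int_ball (K : nat) : finite_set [set z : int | (`|z| <= K)%N].
Proof.
apply: (@sub_finite_set _ _ ((fun i : nat => i%:Z - K%:Z) @` `I_(2 * K).+1)).
  by move=> z /= zK; exists (absz (z + K%:Z)) => /=; lia.
exact/finite_image/finite_II.
Qed.

Section Condensation.
Context {R : realType}.
Variables (s : R) (psi : nat -> R).
Hypothesis s_gt0 : 0 < s.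
Hypothesis s_lt1 : s < 1.
Hypothesis psi_approx : approximating_function psi.
Hypothesis sum_fin : (\sum_(1 <= q <oo) (psi q `^ s * q%:R `^ (2 - s))%:E < +oo)%E.

Let X (n : nat) : R := 2 ^+ n.
Let T (n : nat) : R := psi (32 ^ n)%N `^ s * (X n ^+ 5) `^ (3 - s).

Lemma natr_32X n : (32 ^ n)%N%:R = X n ^+ 5.
Proof.
have E : 32 = 2 ^+ 5 :> R by rewrite -natrX.
by rewrite natrX E /X -!exprM mulnC.
Qed.

(** Cauchy condensation: on the integers [q] above 32^N and up to 32^(N+1), [psi q] is at least its
    value at the right end and [q^(2-s)] at least its value at the left end, and their number is
    comparable to 32^N. *)
Lemma condensation : exists S : R, forall N, \sum_(n < N) T n <= S.
Proof.
have s0 := s_gt0; have s1 := s_lt1.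
have [psi0 psid _] := psi_approx.
pose w (q : nat) : R := psi q `^ s * q%:R `^ (2 - s).
have w0 q : 0 <= w q by rewrite mulr_ge0 ?powR_ge0.
have [S HS] : exists S : R, forall k, \sum_(1 <= q < k) w q <= S.
  exists (fine (\sum_(1 <= q <oo) (w q)%:E)%E) => k.
  rewrite -lee_fin -sumEFin fineK.
    by apply: nneseries_lim_ge => q _ _; rewrite lee_fin.
  rewrite ge0_fin_numE//; apply: nneseries_ge0 => q _ _; by rewrite lee_fin.
(* Each [T n] is compared with the integers preceding 32^n in its block, which leaves [T 0] apart.
   Passing from the left end of a block to the right end costs at most 32^(3-s). *)
exists (T 0 + 32 ^+ 3 * S) => N.
have S0 : 0 <= S by have := HS 1%N; rewrite big_geq.
have T0 n : 0 <= T n by rewrite mulr_ge0 ?powR_ge0.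
case: N => [|N]; first by rewrite big_ord0 addr_ge0// mulr_ge0.
suff h : \sum_(n < N.+1) T n <= T 0 + 32 ^+ 3 * \sum_(2 <= q < (32 ^ N).+1) w q.
  apply: le_trans h _; rewrite lerD2l ler_wpM2l//.
  have [h1|h1] := ltnP 1 (32 ^ N).+1; last by rewrite big_geq// (leq_trans h1).
  by apply: le_trans (HS (32 ^ N).+1); rewrite [leRHS]big_ltn// lerDr.
elim: N => [|N IH]; first by rewrite big_ord_recl big_ord0 addr0 big_geq// mulr0 addr0.
rewrite big_ord_recr /=; apply: le_trans (lerD IH (lexx _)) _.
have le1 : (1 <= 32 ^ N)%N by rewrite expn_gt0.
have le2 : (32 ^ N <= 32 ^ N.+1)%N by rewrite leq_exp2l.
rewrite (@big_cat_nat _ _ _ (32 ^ N).+1 2 (32 ^ N.+1).+1)//= mulrDr addrA lerD2l.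
have lo q : (32 ^ N < q)%N && (q < (32 ^ N.+1).+1)%N ->
    psi (32 ^ N.+1)%N `^ s * (X N ^+ 5) `^ (2 - s) <= w q.
  move=> /andP[q1 q2]; apply: ler_pM; rewrite ?powR_ge0//.
    apply: ge0_ler_powR; rewrite ?nnegrE; first lra.
    - by apply/ltW/psi0; rewrite expn_gt0.
    - by apply/ltW/psi0; apply: leq_ltn_trans q1.
    by apply: psid => //; apply: leq_ltn_trans q1.
  apply: ge0_ler_powR; rewrite ?nnegrE//; first lra.
  - by rewrite !exprn_ge0.
  - by rewrite -natr_32X ler_nat ltnW.
have h : \sum_((32 ^ N).+1 <= q < (32 ^ N.+1).+1) psi (32 ^ N.+1)%N `^ s * (X N ^+ 5) `^ (2 - s)
    <= \sum_((32 ^ N).+1 <= q < (32 ^ N.+1).+1) w q.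
  by apply: ler_sum_nat => q; exact: lo.
rewrite big_const_nat subSS iter_addr_0 -[leLHS]mulr_natr natrB// !natr_32X in h.
apply: le_trans (ler_wpM2l _ h) => //.
rewrite /T.
have XS : X N.+1 ^+ 5 = 32 * X N ^+ 5 by rewrite -!natr_32X expnS natrM.
have x0 : 0 < X N ^+ 5 by rewrite !exprn_gt0.
rewrite XS powRM ?(ltW x0)//.
have -> : (X N ^+ 5) `^ (3 - s) = (X N ^+ 5) `^ (2 - s) * X N ^+ 5.
  by rewrite (_ : 3 - s = 2 - s + 1); [rewrite powR_add// powRr1// ltW|ring].
have c : 32 `^ (3 - s) <= 32 ^+ 3 :> R.
  by rewrite -powR_mulrn//; apply: ler_powR; lra.
set p := psi _ `^ s; set y := _ `^ (2 - s); set z := X N ^+ 5 in x0 *.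
have py : 0 <= p * y * z by apply: mulr_ge0 (ltW x0); apply: mulr_ge0; exact: powR_ge0.
have := ler_wpM2r py c.
have -> : 32 ^+ 3 * (p * y * (32 * z - z)) = 31 * (32 ^+ 3 * (p * y * z)) by ring.
have : 0 <= 32 ^+ 3 * (p * y * z) by apply: mulr_ge0 => //; apply: exprn_ge0.
lra.
Qed.

(** Boundedness of the single terms [T n] gives this: solving psi^s Q^(3-s) <= S for psi yields the
    order Q^(1-3/s) = X^(5-15/s). *)
Lemma psi_decay S : (forall N, \sum_(n < N) T n <= S) ->
  exists2 B : R, 1 <= B & forall n, psi (32 ^ n)%N <= B * X n `^ (5 - 15 / s).
Proof.
move=> HS; have s0 := s_gt0; have [psi0 _ _] := psi_approx.
exists (1 + `|S| `^ (1 / s)); first by rewrite lerDl powR_ge0.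
move=> n; have Xn0 : 0 < X n by rewrite exprn_gt0.
have p0 : 0 < psi (32 ^ n)%N by apply: psi0; rewrite expn_gt0.
have TS : T n <= `|S|.
  apply: le_trans (le_trans (HS n.+1) (ler_norm _)).
  rewrite big_ord_recr /= lerDr sumr_ge0// => i _.
  by rewrite mulr_ge0 ?powR_ge0.
have h : (T n) `^ (1 / s) <= `|S| `^ (1 / s).
  have Tn0 : 0 <= T n by rewrite mulr_ge0 ?powR_ge0.
  by apply: ge0_ler_powR; rewrite ?nnegrE// divr_ge0// ltW.
have X0 : 0 < X n `^ (5 - 15 / s) by rewrite powR_gt0.
apply: (@le_trans _ _ ((T n) `^ (1 / s) * X n `^ (5 - 15 / s))); last first.
  by rewrite ler_pM2r//; lra.
rewrite /T powRM ?powR_ge0// -!powRrM (_ : s * (1 / s) = 1); last by field; lra.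
rewrite powRr1 ?(ltW p0)// -mulrA -powR_mulrn ?(ltW Xn0)// -powRrM -powR_add//.
rewrite (_ : 5%:R * ((3 - s) * (1 / s)) + (5 - 15 / s) = 0); last by field; lra.
by rewrite powRr0 mulr1.
Qed.

Lemma local_null (J : set R) (C : R) (f f1 l l1 : R -> R) :
    curve_bounds J C f f1 l l1 ->
  forall e, 0 < e ->
    scover s [set x | J x /\ infinite_set (approx_triples f l psi x)] e.
Proof.
move=> cb; have s0 := s_gt0; have s1 := s_lt1; have [psi0 psid _] := psi_approx.
have [S HS] := condensation; have [B B1 HB] := psi_decay HS.
have [W HW] := tangential_block_cover s0 s1 cb B1.
have X1 n : 1 <= X n by rewrite exprn_ege1// ler1n.
pose n0 := (Num.truncn (8 * C ^+ 3)).+1.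
have C1 := cb_ge1 cb.
have CQ n : 8 * C ^+ 3 <= X (n0 + n) ^+ 5.
  have h0 : 0 <= 8 * C ^+ 3 by rewrite mulr_ge0// exprn_ge0//; lra.
  have /andP[_ /ltW h] := truncn_itv h0; apply: le_trans h _.
  rewrite -natr_32X ler_nat; apply: leq_trans (_ : 32 ^ n0 <= _)%N.
    by apply: ltnW; apply: ltn_expl.
  by rewrite leq_exp2l// leq_addr.
set K := 129 ^+ 2 * (100 * (33 * C ^+ 2 + B) * (65 * C) ^+ 2).
have p0 n : 0 < psi (32 ^ n)%N by apply: psi0; rewrite expn_gt0.
(* By monotonicity [psi] is largest at the start of a block, so [psi (32 ^ (n0 + n))] serves for all
   its forms; the shift [n0] ensures [8 * C ^+ 3 <= Q]. *)
pose U n : set R := [set x | exists a, [/\ J x, coeff_block (X (n0 + n) ^+ 5) a &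
     `|dual_form f l a x| <= psi (32 ^ (n0 + n))%N]].
pose t n := K * T (n0 + n) + W * X (n0 + n) `^ (- (3 / 8)).
have Ut n : scover s (U n) (t n).
  have psiB : 0 <= psi (32 ^ (n0 + n))%N <= B * X (n0 + n) `^ (5 - 15 / s).
    by rewrite HB ltW.
  have psiB1 : 0 <= psi (32 ^ (n0 + n))%N <= B.
    case/andP: psiB => -> h /=; apply: le_trans h _; rewrite ler_piMr//; first lra.
    rewrite -[leRHS](powRr0 (X (n0 + n))); apply: ler_powR => //.
    by have : 15 <= 15 / s by [rewrite ler_pdivlMr//; lra]; lra.
  have NX : ((2 ^ (n0 + n)) ^ 2)%N%:R = X (n0 + n) ^+ 2 by rewrite !natrX.
  apply: scover_sub (scoverU s0 (steep_block_cover s0 s1 cb (CQ n) B1 psiB1)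
    (HW _ _ _ (X1 _) NX (CQ n) psiB)) => x [a [Jx bl h]].
  by have [h1|/ltW h1] := leP 1 `|dual_form1 f1 l1 a x|; [left|right]; exists a.
have K0 : 0 <= K.
  rewrite /K; apply: mulr_ge0; first exact: sqr_ge0.
  apply: mulr_ge0; last exact: sqr_ge0.
  have : 0 <= C ^+ 2 by exact: sqr_ge0.
  lra.
pose r : R := 2 `^ (- (3 / 8)).
have r0 : 0 < r by rewrite powR_gt0.
have r1 : r < 1.
  have one : 1 `^ (3 / 8) = 1 :> R by rewrite powR1.
  rewrite /r powRN invf_lt1 ?powR_gt0// -[ltLHS]one.
  by apply: gt0_ltr_powR; rewrite ?nnegrE; lra.
have Xr n : X n `^ (- (3 / 8)) = r ^+ n.
  have -> : X n = 2 `^ n%:R by rewrite powR_mulrn.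
  have -> : r ^+ n = r `^ n%:R by rewrite powR_mulrn// ltW.
  by rewrite -!powRrM; congr (_ `^ _); exact: mulrC.
(* [W] comes without a sign; a cover with [psi] replaced by 0 has nonnegative cost and forces it. *)
have W0 : 0 <= W.
  have NX : ((2 ^ (n0 + 0)) ^ 2)%N%:R = X (n0 + 0) ^+ 2 by rewrite !natrX.
  have psi00 : 0 <= (0 : R) <= B * X (n0 + 0) `^ (5 - 15 / s).
    by rewrite lexx /= mulr_ge0 ?powR_ge0//; lra.
  have := scover_ge0 (HW _ _ _ (X1 _) NX (CQ 0%N) psi00).
  by rewrite pmulr_lge0// powR_gt0// exprn_gt0.
have T0 n : 0 <= T n by rewrite mulr_ge0 ?powR_ge0.
apply: (@limsup_scover _ _ s0 U t (K * S + W / (1 - r))) => //.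
- by move=> n; rewrite /t addr_ge0// mulr_ge0 ?powR_ge0.
- move=> N; rewrite big_split /= -!mulr_sumr; apply: lerD.
    apply: ler_wpM2l => //; apply: le_trans (HS (n0 + N)%N).
    by rewrite big_split_ord /= lerDr sumr_ge0.
  apply: ler_wpM2l => //; under eq_bigr do rewrite Xr exprD.
  rewrite -mulr_sumr; apply: (@le_trans _ _ (\sum_(i < N) r ^+ i)).
    rewrite ler_piMl ?sumr_ge0//; first by move=> i _; rewrite exprn_ge0// ltW.
    by rewrite exprn_ile1// ltW.
  rewrite -[leRHS]mul1r ler_pdivlMr ?subr_gt0// mulrC.
  have -> : (1 - r) * \sum_(i < N) r ^+ i = 1 - r ^+ N.
    by rewrite -opprB mulNr -subrX1 opprB.
  by rewrite gerBl exprn_ge0// ltW.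
(* If [x] misses all [U n] with [n >= N], all its triples have height at most [M]. Then [a0] is
   bounded as well, since the form is small, and only finitely many triples remain. *)
move=> x [Jx inf] N; apply: contrapT => nU; apply: inf.
pose M := (32 ^ (n0 + N))%N.
pose Z : R := psi 1%N + M%:R * `|f x| + M%:R * `|x| + `|l x|.
have Z0 : 0 <= Z by rewrite !addr_ge0// ?mulr_ge0// ltW// psi0.
pose M' := Num.truncn Z.
have /andP[_ ZM] := truncn_itv Z0.
apply: (@sub_finite_set _ _ (([set z : int | (`|z| <= M')%N] `*` [set z : int | (`|z| <= M)%N])
   `*` [set z : int | (`|z| <= M)%N])); last first.
  by apply: finite_setX; [apply: finite_setX|]; exact: finite_int_ball.
move=> a [anz h]; set m := maxn _ _ in h.
have m0 : (0 < m)%N.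
  rewrite lt0n; apply/eqP => mz; apply: anz; rewrite /m in mz.
  by clear -mz; congr pair; lia.
have mM : (m <= M)%N.
  rewrite leqNgt; apply/negP => Mm; apply: nU.
  pose n := trunc_log 32 m.
  have /andP[n1 n2] := trunc_log_bounds (isT : (1 < 32)%N) m0.
  rewrite -/n in n1 n2.
  have nN : (n0 + N <= n)%N.
    rewrite -ltnS -(@ltn_exp2l 32)//; apply: ltn_trans n2; exact: Mm.
  exists (n - n0)%N; first by clear -nN; lia.
  have En : (n0 + (n - n0) = n)%N by clear -nN; lia.
  exists a; rewrite En; split=> //; last first.
    by apply: le_trans (ltW h) _; apply: psid => //; rewrite expn_gt0.
  have up k : (k <= m)%N -> k%:R <= 32 * X n ^+ 5 :> R.
    move=> km; rewrite -natr_32X -natrM ler_nat -expnS; apply: leq_trans km _; exact: ltnW.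
  have lo k : (32 ^ n <= k)%N -> X n ^+ 5 <= k%:R by rewrite -natr_32X ler_nat.
  have nE (z : int) : `|z%:~R| = `|z|%N%:R :> R by rewrite natr_absz intr_norm.
  rewrite /coeff_block !nE; split.
  - have [h1|h1] := leqP `|a.1.2|%N `|a.2|%N.
      by right; apply: lo; apply: leq_trans n1 _; rewrite geq_max h1 /=.
    by left; apply: lo; apply: leq_trans n1 _; rewrite geq_max leqnn ltnW.
  - by apply: up; exact: leq_maxl.
  - by apply: up; exact: leq_maxr.
have a1 : (`|a.1.2| <= M)%N by exact: leq_trans (leq_maxl _ _) mM.
have a2 : (`|a.2| <= M)%N by exact: leq_trans (leq_maxr _ _) mM.
split=> //; split=> //=.
rewrite -ltnS -(ltr_nat R); apply: le_lt_trans ZM.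
have nE (z : int) : `|z%:~R| = `|z|%N%:R :> R by rewrite natr_absz intr_norm.
rewrite -nE (_ : a.1.1%:~R = dual_form f l a x - a.2%:~R * f x - a.1.2%:~R * x - l x); last first.
  by rewrite /dual_form; ring.
do ![apply: le_trans (ler_normB _ _) _; apply: lerD] => //.
- by apply: le_trans (ltW h) _; exact: psid.
- by rewrite normrM ler_wpM2r// nE ler_nat.
- by rewrite normrM ler_wpM2r// nE ler_nat.
Qed.

End Condensation.

(** * Localisation to rational intervals and the theorem *)

Lemma scover_set1 (R : realType) (s c : R) : 0 < s -> forall e, 0 < e -> scover s [set c] e.
Proof.
move=> s0 e e0; apply: scover_le (scover_diam s0 (lexx 0) _).
  by rewrite powR0 ?gt_eqF// ltW.
by move=> x y -> ->; rewrite subrr normr0.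
Qed.

(** Changing the signs of [f] and [a2] together preserves the form and the height. This reduces
    points with negative second derivative to the convex case. *)
Lemma approx_triplesN (R : realType) (f l : R -> R) (psi : nat -> R) (x : R) :
  infinite_set (approx_triples f l psi x) ->
  infinite_set (approx_triples (fun y => - f y) l psi x).
Proof.
apply: contra_not => fin.
pose flip (t : int * int * int) := (t.1, - t.2).
apply: sub_finite_set (finite_image flip fin).
move=> t [tn h]; exists (flip t); last by case: t {tn h} => t1 t2; rewrite /flip /= opprK.
split=> /=.
  by apply: contra_not tn => -[-> /eqP]; rewrite oppr_eq0 => /eqP ->.
by rewrite abszN /dual_form /= rmorphN /= mulrNN.
Qed.

Lemma locally_null (R : realType) (a b s : R) (f f1 f2 l l1 l2 : R -> R) (psi : nat -> R) (x : R) :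
    0 < s -> s < 1 -> approximating_function psi ->
    (\sum_(1 <= q <oo) (psi q `^ s * q%:R `^ (2 - s))%:E < +oo)%E ->
    (forall x, a < x < b -> is_derive x 1 f (f1 x)) ->
    (forall x, a < x < b -> is_derive x 1 f1 (f2 x)) ->
    (forall x, a < x < b -> {for x, continuous f2}) ->
    (forall x, a < x < b -> is_derive x 1 l (l1 x)) ->
    (forall x, a < x < b -> is_derive x 1 l1 (l2 x)) ->
    (forall x, a < x < b -> {for x, continuous l2}) ->
    a < x < b -> 0 < f2 x ->
  exists p q : rat, ratr p <= x <= ratr q /\ forall e, 0 < e ->
    scover s [set y | ratr p <= y <= ratr q /\ infinite_set (approx_triples f l psi y)] e.
Proof.
move=> s0 s1 psia sumf df df1 cf dl dl1 cl xab fx.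
(* Continuity at [x] keeps [f2] between half and twice its value and [l2] within 1 of its value, so
   [K] bounds both on a neighbourhood. *)
pose K := Num.max (2 * f2 x) (`|l2 x| + 1).
have [d /= d0 near_d] : exists2 d, 0 < d & forall y, `|x - y| < d ->
    [/\ a < y < b, f2 x / 2 <= f2 y <= K & `|l2 y| <= K].
  have : \forall y \near x, [/\ a < y < b, f2 x / 2 <= f2 y <= K & `|l2 y| <= K].
    near=> y; split.
    - suff : y \in `]a, b[ by rewrite in_itv.
      by near: y; apply: near_in_itvoo; rewrite in_itv.
    - apply/andP; split.
        apply: ltW; near: y; apply: (cvgr_gt (f2 x)); first exact: cf.
        lra.
      rewrite le_max; apply/orP; left.
      apply: ltW; near: y; apply: (cvgr_lt (f2 x)); first exact: cf.
      lra.
    - rewrite le_max; apply/orP; right.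
      apply: ltW; near: y; apply: (cvgr_lt `|l2 x|); last by rewrite ltrDl.
      by apply: cvg_norm; exact: cl.
  by move=> /nbhs_ballP[d d0 h]; exists d => // y xy; exact: h.
have [p _ /andP[p1 p2]] : exists2 p : rat, True & x - d < ratr p < x.
  have /rat_in_itvoo[p] : x - d < x by lra.
  by rewrite in_itv /= => h; exists p.
have [q _ /andP[q1 q2]] : exists2 q : rat, True & x < ratr q < x + d.
  have /rat_in_itvoo[q] : x < x + d by lra.
  by rewrite in_itv /= => h; exists q.
exists p, q; split; first by rewrite !ltW.
have nd y : ratr p <= y <= ratr q -> [/\ a < y < b, f2 x / 2 <= f2 y <= K & `|l2 y| <= K].
  by move=> /andP[h1 h2]; apply: near_d; rewrite ltr_norml; apply/andP; split; lra.
have pq : ratr p <= ratr q :> R by lra.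
have fx2 : 0 < f2 x / 2 by lra.
have [] := @derivatives_curve_bounds _ (ratr p) (ratr q) (f2 x / 2) K f f1 f2 l l1 l2 pq fx2.
- by move=> y /nd[yab _ _]; exact: df.
- by move=> y /nd[yab _ _]; exact: df1.
- by move=> y /nd[yab _ _]; exact: dl.
- by move=> y /nd[yab _ _]; exact: dl1.
- by move=> y /nd[].
- by move=> y /nd[].
move=> C cb; exact: (local_null s0 s1 psia sumf cb).
Unshelve. all: by end_near. Qed.

Theorem theorem5 (R : realType) (a b : R) (f : R -> R) (s : R)
    (psi : nat -> R) (lam : R * R -> R)
    (ab : a < b)
    (f_C2 : C2_on `[a, b] f)
    (s_gt0 : 0 < s) (s_lt1 : s < 1)
    (f_nondeg : nondegenerate_curve `[a, b] f s)
    (psi_approx : approximating_function psi)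
    (lam_C2 : C2_on `[a, b] (fun x => lam (x, f x)))
    (sum_fin : (\sum_(1 <= q <oo)
                  (psi q `^ s * q%:R `^ (2 - s))%:E < +oo)%E) :
  hausdorff_measure s (dual_approx_set `[a, b] f lam psi) = 0%E.
Proof.
apply: (hausdorff_null s_gt0).
have [f1 [f2 [df df1 cf f2E]]] := C2_on_derivatives f_C2.
have [l1 [l2 [dl dl1 cl _]]] := C2_on_derivatives lam_C2.
set l := fun x => lam (x, f x) in dl.
have degenerate := null_hausdorff f_nondeg; rewrite -f2E in degenerate.
pose good (p : rat * rat) : set R :=
  [set y | ratr p.1 <= y <= ratr p.2 /\ infinite_set (approx_triples f l psi y)].
(* The three exceptional sets come first, then the pairs of rationals through their codes. Nullity
   of [good p] is part of the membership condition, so a pair for which it fails contributes the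
   empty set. *)
pose P (i : nat) : set R := match i with
  | 0%N => [set a] | 1%N => [set b] | 2%N => `[a, b] `&` [set x | f2 x = 0]
  | i.+3 => [set y | exists2 p : rat * rat, pickle_inv i = Some p &
      good p y /\ forall e, 0 < e -> scover s (good p) e] end.
apply: (@scover_countable _ _ s_gt0 _ P).
  move=> [|[|[|i]]] e e0; [exact: scover_set1|exact: scover_set1|exact: degenerate|].
  rewrite /P; case: (pickle_inv i) => [p|]; last first.
    by apply: scover_sub (scover0 s_gt0 (ltW e0)) => y [].
  have [h|h] := pselect (forall e, 0 < e -> scover s (good p) e).
    by apply: scover_sub (h _ e0) => y [_ [<-] []].
  by apply: scover_sub (scover0 s_gt0 (ltW e0)) => y [_ [<-] [_ h']]; exact: h.
move=> x [xab inf].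
have {}inf : infinite_set (approx_triples f l psi x).
  apply: contra_not inf; apply: sub_finite_set => -[[a0 a1] a2] [h1 h2].
  by split.
have [->|xa] := eqVneq x a; first by exists 0%N.
have [->|xb] := eqVneq x b; first by exists 1%N.
have {}xab' : a < x < b.
  by move: xab; rewrite /= in_itv /= => /andP[h1 h2]; rewrite !lt_neqAle eq_sym xa h1 xb h2.
have [f0|fn0] := eqVneq (f2 x) 0; first by exists 2%N.
suff [p [q [pq null]]] : exists p q : rat, ratr p <= x <= ratr q /\
    forall e, 0 < e -> scover s (good (p, q)) e.
  by exists (pickle (p, q)).+3 => //; exists (p, q); [rewrite pickleK_inv|].
have [fpos|fneg] := ltP 0 (f2 x).
  exact: (locally_null s_gt0 s_lt1 psi_approx sum_fin df df1 cf dl dl1 cl xab' fpos).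
have fpos : 0 < - f2 x by rewrite oppr_gt0 lt_neqAle fn0 fneg.
have [p [q [pq null]]] := @locally_null _ a b s (fun y => - f y) (fun y => - f1 y)
  (fun y => - f2 y) l l1 l2 psi x s_gt0 s_lt1 psi_approx sum_fin
  (fun y h => is_deriveN (df y h)) (fun y h => is_deriveN (df1 y h))
  (fun y h => cvgN (cf y h)) dl dl1 cl xab' fpos.
exists p, q; split=> // e e0; apply: scover_sub (null e e0) => y [h1 h2].
by split=> //; exact: approx_triplesN.
Qed.
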